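(* Let $\mathfrak{X}$ be an abstract state space, $(\mathcal{U}(t))_{t\ge0}$ a substochastic $C_0$-semigroup on $\mathfrak{X}$ with generator $\mathcal{A}$, $\mathcal{B}:\mathscr{D}(\mathcal{A})\to\mathfrak{X}$ a positive linear operator with $\langle\mathbf{\Psi},(\mathcal{A}+\mathcal{B})u\rangle\le0$ for all $u\in\mathscr{D}(\mathcal{A})\cap\mathfrak{X}_+$, let $(\mathcal{V}(t))_{t\ge0}$ be the associated minimal semigroup with generator $\mathcal{G}$, and $(\mathcal{V}_n(t))_{t\ge0}$, $n\ge0$, the Dyson–Phillips iterates. Given $u\in\mathfrak{X}_+$, the following statements are equivalent: (1) the trajectory $(\mathcal{V}(t)u)_{t\ge0}$ is mild honest; (2) $\lim_{n\to\infty}\big\|\mathcal{B}\int_0^t\mathcal{V}_n(s)u\,\mathrm{d}s\big\|=0$ for any $t>0$; (3) $\int_0^t\mathcal{V}(s)u\,\mathrm{d}s\in\mathscr{D}(\overline{\mathcal{A}+\mathcal{B}})$ for any $t>0$; (4) the set $\big(\mathcal{B}\int_0^t\mathcal{V}_n(s)u\,\mathrm{d}s\big)_n$ is relatively weakly compact in $\mathfrak{X}$ for any $t>0$.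
   Context: An abstract state space is a real ordered Banach space $\mathfrak{X}$ whose positive cone $\mathfrak{X}_+$ is closed, generating ($\mathfrak{X}=\mathfrak{X}_+-\mathfrak{X}_+$), and on which the norm is additive: $\|u+v\|=\|u\|+\|v\|$ for $u,v\in\mathfrak{X}_+$. $\mathbf{\Psi}\in\mathfrak{X}^\star_+$ is the positive functional with $\langle\mathbf{\Psi},u\rangle=\|u\|$ for $u\in\mathfrak{X}_+$. A linear operator is positive if it maps positive elements of its domain into $\mathfrak{X}_+$. A $C_0$-semigroup $(T(t))_{t\ge0}$ is substochastic if each $T(t)$ is positive and $\|T(t)u\|\le\|u\|$ for $u\in\mathfrak{X}_+$. Minimal semigroup: under the stated hypotheses there is a smallest (for the operator order, for each $t$) substochastic $C_0$-semigroup $(\mathcal{V}(t))_{t\ge0}$ whose generator $\mathcal{G}$ extends $(\mathcal{A}+\mathcal{B},\mathscr{D}(\mathcal{A}))$; it satisfies $(\lambda-\mathcal{G})^{-1}u=\lim_{n\to\infty}(\lambda-\mathcal{A})^{-1}\sum_{k=0}^n[\mathcal{B}(\lambda-\mathcal{A})^{-1}]^ku$ for all $\lambda>0$, $u\in\mathfrak{X}$, and $\mathcal{V}(t)u=\sum_{n\ge0}\mathcal{V}_n(t)u$. $\overline{\mathcal{A}+\mathcal{B}}$ is the closure of $(\mathcal{A}+\mathcal{B},\mathscr{D}(\mathcal{A}))$. Dyson–Phillips iterates: $\mathcal{V}_0(t)=\mathcal{U}(t)$, and $\mathcal{V}_{n+1}(t)$ is the unique bounded (positive) operator on $\mathfrak{X}$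 with $\mathcal{V}_{n+1}(t)u=\int_0^t\mathcal{V}_n(t-s)\mathcal{B}\,\mathcal{U}(s)u\,\mathrm{d}s$ for $u\in\mathscr{D}(\mathcal{A})$, $t\ge0$, $n\ge0$; one has $\int_0^t\mathcal{V}_n(s)v\,\mathrm{d}s\in\mathscr{D}(\mathcal{A})$ for $v\in\mathfrak{X}$. Functionals: $\mathfrak{a}(u)=-\langle\mathbf{\Psi},\mathcal{A}u+\mathcal{B}u\rangle$ for $u\in\mathscr{D}(\mathcal{A})$; $\widehat{\mathfrak{a}}(v)=\lim_{t\to0^+}\frac1t\sum_{n=0}^\infty\mathfrak{a}\big(\int_0^t\mathcal{V}_n(s)v\,\mathrm{d}s\big)$ for $v\in\mathscr{D}(\mathcal{G})$ (the limit exists). For $u\in\mathfrak{X}_+$, the trajectory $(\mathcal{V}(t)u)_{t\ge0}$ is mild honest if $\|\mathcal{V}(t)u\|=\|u\|-\widehat{\mathfrak{a}}\big(\int_0^t\mathcal{V}(s)u\,\mathrm{d}s\big)$ for all $t\ge0$. *)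

(* Defs.v *)
From Stdlib Require Import Reals List.
From Coquelicot Require Import Coquelicot.

Set Implicit Arguments.
Unset Strict Implicit.
Unset Printing Implicit Defensive.

Open Scope R_scope.

(** * Abstract state spaces *)

Record abstract_state_space : Type := AbstractStateSpace {
  carrier :> CompleteNormedModule R_AbsRing;
  cone : carrier -> Prop;
  cone_zero : cone zero;
  cone_plus : forall u v, cone u -> cone v -> cone (plus u v);
  cone_scal : forall (a : R) u, 0 <= a -> cone u -> cone (scal a u);
  cone_pointed : forall u, cone u -> cone (opp u) -> u = zero;
  cone_closed : closed cone;
  cone_generating :
    forall x, exists u v, cone u /\ cone v /\ x = minus u v;
  cone_norm_additive :
    forall u v, cone u -> cone v -> norm (plus u v) = norm u + norm v
}.

Arguments cone {_} _.

(* Coquelicot's [is_linear] means linear and bounded. *)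
Definition bounded_op (X : abstract_state_space) (T : X -> X) : Prop :=
  is_linear T.

Definition functional (X : abstract_state_space) (f : X -> R) : Prop :=
  is_linear (V := R_NormedModule) f.

(* The functional Psi: it is unique since the cone is generating. *)
Definition norm_functional (X : abstract_state_space) (Psi : X -> R) : Prop :=
  functional Psi /\ forall u, cone u -> Psi u = norm u.

Definition positive_op (X : abstract_state_space) (T : X -> X) : Prop :=
  forall u, cone u -> cone (T u).

Definition op_le (X : abstract_state_space) (S T : X -> X) : Prop :=
  forall u, cone u -> cone (minus (T u) (S u)).

(** * Unbounded operators *)

(* Only the values of [app] on [dom] are meaningful. *)
Record operator (X : abstract_state_space) : Type := Operator {
  dom : X -> Prop;
  app :> X -> X
}.

Arguments Operator {X} dom app.
Arguments dom {X} _ _.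

(* [T] is linear from the subspace [D] to [X]. *)
Definition linear_on (X : abstract_state_space) (D : X -> Prop) (T : X -> X)
  : Prop :=
  (forall u v, D u -> D v -> T (plus u v) = plus (T u) (T v)) /\
  (forall (a : R) u, D u -> T (scal a u) = scal a (T u)).

Definition positive_on (X : abstract_state_space) (D : X -> Prop) (T : X -> X)
  : Prop :=
  forall u, D u -> cone u -> cone (T u).

(* (A + B, D(A)) for B defined on D(A). *)
Definition perturbed (X : abstract_state_space) (A : operator X) (B : X -> X)
  : operator X :=
  Operator (dom A) (fun u => plus (A u) (B u)).

Definition extends (X : abstract_state_space) (G C : operator X) : Prop :=
  forall u, dom C u -> dom G u /\ G u = C u.

(* (u, w) lies in the closure of the graph of C. *)
Definition in_graph_closure (X : abstract_state_space) (C : operator X)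
    (u w : X) : Prop :=
  forall eps : R, 0 < eps ->
    exists v, dom C v /\ norm (minus v u) < eps /\ norm (minus (C v) w) < eps.

Definition closure_dom (X : abstract_state_space) (C : operator X) (u : X)
  : Prop :=
  exists w, in_graph_closure C u w.

(** * Semigroups *)

(* Families of operators are indexed by [R]; only times t >= 0 matter. *)
Record C0_semigroup (X : abstract_state_space) (T : R -> X -> X) : Prop := {
  C0_bounded : forall t, 0 <= t -> bounded_op (T t);
  C0_zero : forall u, T 0 u = u;
  C0_add : forall s t u, 0 <= s -> 0 <= t -> T (s + t) u = T s (T t u);
  C0_cont : forall u, filterlim (fun t => T t u) (at_right 0) (locally u)
}.

Definition is_generator (X : abstract_state_space) (T : R -> X -> X)
    (A : operator X) : Prop :=
  forall u w,
    (dom A u /\ A u = w) <->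
    filterlim (fun h => scal (/ h) (minus (T h u) u)) (at_right 0) (locally w).

Record substochastic (X : abstract_state_space) (T : R -> X -> X) : Prop := {
  substochastic_C0 : C0_semigroup T;
  substochastic_pos : forall t, 0 <= t -> positive_op (T t);
  substochastic_contr :
    forall t u, 0 <= t -> cone u -> norm (T t u) <= norm u
}.

(* V, with generator G, is the smallest substochastic semigroup whose
   generator extends C. *)
Record minimal_semigroup (X : abstract_state_space) (C : operator X)
    (V : R -> X -> X) (G : operator X) : Prop := {
  minimal_substochastic : substochastic V;
  minimal_generator : is_generator V G;
  minimal_extends : extends G C;
  minimal_least :
    forall (W : R -> X -> X) (H : operator X),
      substochastic W -> is_generator W H -> extends H C ->
      forall t, 0 <= t -> op_le (V t) (W t)
}.

Record dyson_phillips (X : abstract_state_space) (U : R -> X -> X)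
    (A : operator X) (B : X -> X) (Vn : nat -> R -> X -> X) : Prop := {
  dp_zero : forall t u, 0 <= t -> Vn 0%nat t u = U t u;
  dp_bounded : forall n t, 0 <= t -> bounded_op (Vn n t);
  dp_positive : forall n t, 0 <= t -> positive_op (Vn n t);
  dp_succ : forall n t u, 0 <= t -> dom A u ->
    is_RInt (fun s => Vn n (t - s) (B (U s u))) 0 t (Vn (S n) t u)
}.

(** * Mild honesty *)

Definition a_fun (X : abstract_state_space) (Psi : X -> R) (A : operator X)
    (B : X -> X) (u : X) : R :=
  - Psi (plus (A u) (B u)).

Definition is_a_hat (X : abstract_state_space) (Psi : X -> R) (A : operator X)
    (B : X -> X) (Vn : nat -> R -> X -> X) (v : X) (l : R) : Prop :=
  filterlim
    (fun t => / t *
       Series (fun n => a_fun Psi A B (RInt (fun s => Vn n s v) 0 t)))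
    (at_right 0) (locally l).

(* The limit, as a total function in the style of [RInt]. *)
Definition a_hat (X : abstract_state_space) (Psi : X -> R) (A : operator X)
    (B : X -> X) (Vn : nat -> R -> X -> X) (v : X) : R :=
  iota (T := R_CompleteSpace) (is_a_hat Psi A B Vn v).

Definition mild_honest (X : abstract_state_space) (Psi : X -> R)
    (A : operator X) (B : X -> X) (Vn : nat -> R -> X -> X)
    (V : R -> X -> X) (u : X) : Prop :=
  forall t, 0 <= t ->
    norm (V t u) = norm u - a_hat Psi A B Vn (RInt (fun s => V s u) 0 t).

(** * Weak topology *)

Definition weak_nbhd (X : abstract_state_space) (x : X) (P : X -> Prop)
  : Prop :=
  exists (fs : list (X -> R)) (eps : R),
    0 < eps /\
    (forall f, In f fs -> functional f) /\
    forall y, (forall f, In f fs -> Rabs (f y - f x) < eps) -> P y.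

Definition weak_open (X : abstract_state_space) (O : X -> Prop) : Prop :=
  forall x, O x -> weak_nbhd x O.

Definition weak_closure (X : abstract_state_space) (S : X -> Prop) (x : X)
  : Prop :=
  forall P, weak_nbhd x P -> exists y, P y /\ S y.

Definition weakly_compact (X : abstract_state_space) (K : X -> Prop) : Prop :=
  forall C : (X -> Prop) -> Prop,
    (forall O, C O -> weak_open O) ->
    (forall x, K x -> exists O, C O /\ O x) ->
    exists l : list (X -> Prop),
      (forall O, In O l -> C O) /\
      (forall x, K x -> exists O, In O l /\ O x).

Definition relatively_weakly_compact (X : abstract_state_space)
    (S : X -> Prop) : Prop :=
  weakly_compact (weak_closure S).

(* Main.v *)
(* Write [S_n] for the sum of the first [n] Dyson-Phillips iterates.  The cocycle
   identity V_n(t+s) = sum_k V_k(t) V_{n-k}(s) gives the derivative at h = 0 of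
   U(h) int_0^t V_n(s)x ds, whence
     A int_0^t V_n(s)x ds = V_n(t)x - B int_0^t V_{n-1}(s)x ds,
   and, summing and applying Psi,
     sum_{k<=n} a(int_0^t V_k(s)x ds)
       = Psi(x) - Psi(S_{n+1}(t)x) - Psi(B int_0^t V_n(s)x ds).
   So beta_t(x) = lim_n Psi(B int_0^t V_n(s)x ds) exists.  The semigroup V is the
   sum of the V_n, because that sum is a substochastic semigroup whose generator
   extends A+B and Duhamel's formula puts it below every other one.  It follows
   that beta_{t+h}(u) = beta_t(u) + beta_h(V(t)u), and with w = int_0^t V(s)u ds
   that beta_h(w)/h tends to beta_t(u) and a_hat(w) = |u| - |V(t)u| - beta_t(u).
   Each of the four statements therefore says that beta_t(u) = 0 for all t:
   - for the closure, beta_h(v) = o(h) on D(A) while |beta_h(v)| is at most C h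
     times the graph norm of v in D(G), so beta_h(w) = o(h) if w lies in the
     domain of the closure of A+B;
   - for weak compactness, x_n = B int_0^t V_n(s)u ds satisfies
     int_0^h V(s)x_n ds -> 0 for every h, which forces Psi(y) = 0 at a weak
     cluster point y, where also Psi(y) = beta_t(u). *)

(* [B] is merely positive and linear on the domain of [A], with no continuity assumed, and the cone
   is merely generating; both facts must first be made quantitative. A Baire argument bounds the two
   parts of a vector by a multiple of its norm, so that estimates on the cone extend to the space. A
   positive resolvent, built from a unit-time integral and a Neumann series, does the same inside
   the domain of a generator: for [U] it shows that [B] is bounded in the graph norm of [A], for [V]
   it gives the estimate of [beta] on D(G). The limits of partial sums exist for one reason:
   additivity of the norm makes a bounded increasing sequence in the cone Cauchy. For positive v in
   D(A), beta_h(v) = o(h) because (|v| - |V(h)v|)/h and the k = 0 term of the series of [a], divided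
   by h, have the same limit a(v), and beta_h(v) is at most the difference of the two numerators.
   The weak compactness argument only tests with [Psi] and with [Psi] after integration of [V] over
   [0,h]; divided by h, these integrals tend to the identity, so they determine Psi(y). *)
Require Import Defs.
From Stdlib Require Import Reals Lra Lia List ClassicalEpsilon.
From Coquelicot Require Import Coquelicot.

Set Implicit Arguments.
Unset Strict Implicit.
Unset Printing Implicit Defensive.

Open Scope R_scope.

(* [vec] proves identities between linear combinations of vectors by comparing
   the coefficients of each vector. *)
Inductive vexpr : Type :=
| VZero | VVar (n : nat) | VPlus (a b : vexpr) | VOpp (a : vexpr)
| VScal (r : R) (a : vexpr).

Section VecReflection.

Variable V : ModuleSpace R_Ring.

Fixpoint vdenote (env : list V) (e : vexpr) : V :=
  match e with
  | VZero => zero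
  | VVar n => nth n env zero
  | VPlus a b => plus (vdenote env a) (vdenote env b)
  | VOpp a => opp (vdenote env a)
  | VScal r a => scal (r : R_Ring) (vdenote env a)
  end.

Fixpoint vcoef (e : vexpr) (n : nat) : R :=
  match e with
  | VZero => 0
  | VVar m => if Nat.eqb n m then 1 else 0
  | VPlus a b => vcoef a n + vcoef b n
  | VOpp a => - vcoef a n
  | VScal r a => r * vcoef a n
  end.

Fixpoint lincomb (env : list V) (c : nat -> R) : V :=
  match env with
  | nil => zero
  | x :: l => plus (scal (c 0%nat : R_Ring) x) (lincomb l (fun n => c (S n)))
  end.

Fixpoint coef_eq (env : list V) (c d : nat -> R) : Prop :=
  match env with
  | nil => True
  | _ :: l => c 0%nat = d 0%nat /\ coef_eq l (fun n => c (S n)) (fun n => d (S n))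
  end.

Lemma lincomb_ext env c d : coef_eq env c d -> lincomb env c = lincomb env d.
Proof.
revert c d; induction env as [|x l IH]; intros c d; simpl; auto.
intros [H1 H2]; rewrite H1, (IH _ _ H2); auto.
Qed.

Lemma lincomb_zero env c : (forall n, c n = 0) -> lincomb env c = zero.
Proof.
revert c; induction env as [|x l IH]; intros c H; simpl; auto.
rewrite H, IH by auto; rewrite plus_zero_r; apply (@scal_zero_l R_Ring).
Qed.

Lemma lincomb_plus env c d :
  lincomb env (fun n => c n + d n) = plus (lincomb env c) (lincomb env d).
Proof.
revert c d; induction env as [|x l IH]; intros c d; simpl.
- now rewrite plus_zero_r.
- rewrite IH.
  replace (scal (c 0%nat + d 0%nat : R_Ring) x)
    with (plus (scal (c 0%nat : R_Ring) x) (scal (d 0%nat : R_Ring) x))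
    by (symmetry; apply (@scal_distr_r R_Ring)).
  rewrite <- !plus_assoc; f_equal; rewrite !plus_assoc; f_equal; apply plus_comm.
Qed.

Lemma lincomb_scal env r c :
  lincomb env (fun n => r * c n) = scal (r : R_Ring) (lincomb env c).
Proof.
revert c; induction env as [|x l IH]; intros c; simpl.
- symmetry; apply scal_zero_r.
- rewrite IH, scal_distr_l; f_equal; symmetry; apply (@scal_assoc R_Ring).
Qed.

Lemma lincomb_delta env m :
  lincomb env (fun n => if Nat.eqb n m then 1 else 0) = nth m env zero.
Proof.
revert m; induction env as [|x l IH]; intros m; simpl.
- destruct m; reflexivity.
- destruct m as [|m]; simpl.
  + rewrite lincomb_zero by auto; rewrite plus_zero_r; apply (@scal_one R_Ring).
  + rewrite IH.
    replace (scal (0 : R_Ring) x) with (@zero V) by (symmetry; apply (@scal_zero_l R_Ring)).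
    apply plus_zero_l.
Qed.

Lemma vdenote_lincomb env e : vdenote env e = lincomb env (vcoef e).
Proof.
induction e; simpl.
- symmetry; apply lincomb_zero; auto.
- symmetry; apply lincomb_delta.
- rewrite lincomb_plus; congruence.
- rewrite IHe, <- scal_opp_one.
  transitivity (lincomb env (fun n => (-1) * vcoef e n)).
  + rewrite lincomb_scal; reflexivity.
  + f_equal; apply FunctionalExtensionality.functional_extensionality; intros n; ring.
- rewrite lincomb_scal; congruence.
Qed.

Lemma vdenote_eq env a b :
  coef_eq env (vcoef a) (vcoef b) -> vdenote env a = vdenote env b.
Proof. now intros H; rewrite !vdenote_lincomb; apply lincomb_ext. Qed.

End VecReflection.

Ltac vec_mem x env :=
  lazymatch env with
  | nil => constr:(false)
  | cons x _ => constr:(true)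
  | cons _ ?l => vec_mem x l
  end.

Ltac vec_env env e :=
  lazymatch e with
  | zero => env
  | plus ?a ?b => let env := vec_env env a in vec_env env b
  | minus ?a ?b => let env := vec_env env a in vec_env env b
  | opp ?a => vec_env env a
  | scal _ ?a => vec_env env a
  | _ => lazymatch vec_mem e env with
         | true => env
         | false => constr:(cons e env)
         end
  end.

Ltac vec_index x env :=
  lazymatch env with
  | cons x _ => constr:(0%nat)
  | cons _ ?l => let n := vec_index x l in constr:(S n)
  end.

Ltac vec_reify env e :=
  lazymatch e with
  | zero => constr:(VZero)
  | plus ?a ?b =>
      let a' := vec_reify env a in let b' := vec_reify env b in
      constr:(VPlus a' b')
  | minus ?a ?b =>
      let a' := vec_reify env a in let b' := vec_reify env b in
      constr:(VPlus a' (VOpp b'))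
  | opp ?a => let a' := vec_reify env a in constr:(VOpp a')
  | scal ?r ?a => let a' := vec_reify env a in constr:(VScal r a')
  | _ => let n := vec_index e env in constr:(VVar n)
  end.

Ltac vec_start :=
  lazymatch goal with
  | |- @eq ?T ?a ?b =>
      let env0 := constr:(@nil T) in
      let env1 := vec_env env0 a in
      let env := vec_env env1 b in
      let a' := vec_reify env a in
      let b' := vec_reify env b in
      refine (@vdenote_eq _ env a' b' _); cbn
  end.

Ltac vec := vec_start; repeat split; try ring; try (field; repeat split; lra).

(** The structures are written out so that every vector operation elaborates to one syntactic form,
    on which [rewrite] and [vec] can match. *)
Notation "x [+] y" :=
  (@plus (CompleteNormedModule.AbelianMonoid R_AbsRing (carrier _)) x y)
  (at level 50, left associativity).
Notation "x [-] y" :=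
  (@minus (CompleteNormedModule.AbelianGroup R_AbsRing (carrier _)) x y)
  (at level 50, left associativity).
Notation "[-] x" :=
  (@opp (CompleteNormedModule.AbelianGroup R_AbsRing (carrier _)) x)
  (at level 35, right associativity).
Notation "a [*] x" :=
  (@scal R_Ring (CompleteNormedModule.ModuleSpace R_AbsRing (carrier _)) a x)
  (at level 40, left associativity).
Notation "<| x |>" :=
  (@norm R_AbsRing (CompleteNormedModule.NormedModule R_AbsRing (carrier _)) x)
  (at level 0, x at level 99).

(** * The real line as an abstract state space *)

Lemma cone_generating_R (x : R) : exists u v, 0 <= u /\ 0 <= v /\ x = minus u v.
Proof.
exists (Rmax x 0), (Rmax (- x) 0); repeat split; try apply Rmax_r.
unfold minus, plus, opp; simpl; unfold Rmax.
destruct (Rle_dec x 0), (Rle_dec (- x) 0); lra.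
Qed.

Lemma norm_additive_R (u v : R) :
  0 <= u -> 0 <= v -> norm (plus u v) = norm u + norm v.
Proof.
intros Hu Hv; unfold norm, plus; simpl; unfold abs; simpl.
rewrite !Rabs_pos_eq; lra.
Qed.

Lemma cone_pointed_R (u : R) : 0 <= u -> 0 <= opp u -> u = zero.
Proof. unfold opp, zero; simpl; lra. Qed.

(** With the reals as an instance, the results on limits, integrals, monotone sequences and Cauchy
    products also serve for functionals and real series. *)
Canonical R_state_space : abstract_state_space :=
  @AbstractStateSpace R_CompleteNormedModule (fun x => 0 <= x)
    (Rle_refl 0) Rplus_le_le_0_compat Rmult_le_pos cone_pointed_R
    (closed_ge 0) cone_generating_R norm_additive_R.

(** Goals about [R_state_space] are equalities in its carrier; [ring] needs to see the type [R]. *)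
Ltac ring_R := cbv beta; lazymatch goal with |- ?a = ?b => change (@eq R a b); ring end.

(** * Norms and limits *)

Section Norms.

Variable X : abstract_state_space.
Implicit Types x y z : X.

Lemma vnorm_ge_0 x : 0 <= <|x|>.
Proof. exact (norm_ge_0 x). Qed.

Lemma vnorm_zero : <|zero : X|> = 0.
Proof. exact (@norm_zero R_AbsRing X). Qed.

Lemma vnorm_eq_zero x : <|x|> = 0 -> x = zero.
Proof. exact (@norm_eq_zero R_AbsRing X x). Qed.

Lemma vnorm_opp x : <|[-] x|> = <|x|>.
Proof. exact (norm_opp x). Qed.

Lemma vnorm_triangle x y : <|x [+] y|> <= <|x|> + <|y|>.
Proof. exact (norm_triangle x y). Qed.

(** The axioms of a normed module only give the inequality; applying it to [/ a] as well gives the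
    converse. *)
Lemma norm_scal_abs (a : R) x : <|a [*] x|> = Rabs a * <|x|>.
Proof.
assert (Hle : forall (b : R) (y : X), <|b [*] y|> <= Rabs b * <|y|>)
  by (intros b y; exact (norm_scal b y)).
apply Rle_antisym; [apply Hle|].
destruct (Req_dec a 0) as [->|Ha].
- rewrite Rabs_R0, Rmult_0_l; apply vnorm_ge_0.
- replace (<|x|>) with (<|(/ a) [*] (a [*] x)|>)
    by (f_equal; vec; field; auto).
  apply Rle_trans with (Rabs a * (Rabs (/ a) * <|a [*] x|>)).
  + apply Rmult_le_compat_l; [apply Rabs_pos | apply Hle].
  + rewrite <- Rmult_assoc, <- Rabs_mult, Rinv_r, Rabs_R1, Rmult_1_l; auto.
    apply Rle_refl.
Qed.

Lemma norm_scal_pos (a : R) x : 0 <= a -> <|a [*] x|> = a * <|x|>.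
Proof. now intros H; rewrite norm_scal_abs, Rabs_pos_eq. Qed.

Lemma norm_minus_sym x y : <|x [-] y|> = <|y [-] x|>.
Proof. rewrite <- vnorm_opp; f_equal; vec. Qed.

Lemma norm_minus_le x y : <|x [-] y|> <= <|x|> + <|y|>.
Proof.
replace (x [-] y) with (x [+] [-] y) by vec.
rewrite <- (vnorm_opp y); apply vnorm_triangle.
Qed.

Lemma norm_minus_trans y x z : <|x [-] z|> <= <|x [-] y|> + <|y [-] z|>.
Proof.
replace (x [-] z) with ((x [-] y) [+] (y [-] z)) by vec.
apply vnorm_triangle.
Qed.

Lemma norm_le_minus x y : <|x|> <= <|y|> + <|x [-] y|>.
Proof. replace x with (y [+] (x [-] y)) at 1 by vec; apply vnorm_triangle. Qed.

Lemma minus_zero_eq x y : x [-] y = zero -> x = y.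
Proof.
intros H; replace x with ((x [-] y) [+] y) by vec.
rewrite H; vec.
Qed.

Lemma norm_minus_eq0 x y : <|x [-] y|> = 0 -> x = y.
Proof. now intros H; apply minus_zero_eq, vnorm_eq_zero. Qed.

End Norms.

(* A record, so that [tends] is not unfolded when implicit arguments are
   computed. *)
Record tends (T : Type) (F : (T -> Prop) -> Prop)
    (X : abstract_state_space) (f : T -> X) (l : X) : Prop := Tends {
  tends_filterlim : filterlim f F (locally l)
}.

(* [apply] leaves the filter instances open when the filter is only known after
   unification with the goal. *)
Ltac filt :=
  try match goal with
  | |- Filter _ => typeclasses eauto
  | |- ProperFilter _ => typeclasses eauto
  end.

Tactic Notation "tapply" uconstr(l) := apply l; filt.

Section Limits.

Variables (T : Type) (F : (T -> Prop) -> Prop).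
Context {FF : Filter F}.

Lemma tends_norm (X : abstract_state_space) (f : T -> X) l :
  tends F f l <-> forall eps, 0 < eps -> F (fun x => <|f x [-] l|> < eps).
Proof.
split.
- intros [H] eps He.
  exact (proj1 (filterlim_locally_ball_norm f l) H (mkposreal eps He)).
- intros H; constructor; apply (proj2 (filterlim_locally_ball_norm f l)).
  intros eps; apply (H eps), cond_pos.
Qed.

Lemma tends_squeeze (X : abstract_state_space) (f : T -> X) l (g : T -> R) :
  F (fun x => <|f x [-] l|> <= g x) ->
  tends F g 0 -> tends F f l.
Proof.
rewrite !tends_norm; intros H Hg eps He.
generalize (filter_and _ _ H (Hg eps He)); apply filter_imp.
intros x [H1 H2]; change (Rabs (g x - 0) < eps) in H2.
apply Rabs_def2 in H2; lra.
Qed.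

Lemma tends_to_zero (X : abstract_state_space) (f : T -> X) (g : T -> R) :
  F (fun x => <|f x|> <= g x) -> tends F g 0 -> tends F f zero.
Proof.
intros H; apply tends_squeeze; generalize H; apply filter_imp; intros x Hx.
apply Rle_trans with (2 := Hx), Req_le; f_equal; vec.
Qed.

Lemma tends_ext (X : abstract_state_space) (f g : T -> X) l :
  F (fun x => f x = g x) -> tends F f l -> tends F g l.
Proof. intros H [Hf]; constructor; exact (filterlim_ext_loc f g H Hf). Qed.

Lemma tends_const (X : abstract_state_space) (l : X) :
  tends F (fun _ => l) l.
Proof. constructor; apply filterlim_const. Qed.

Lemma tends_plus (X : abstract_state_space) (f g : T -> X) l m :
  tends F f l -> tends F g m -> tends F (fun x => (f x [+] g x)) (l [+] m).
Proof.
intros [Hf] [Hg]; constructor; exact (filterlim_comp_2 f g plus Hf Hg (filterlim_plus l m)).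
Qed.

Lemma tends_scal (X : abstract_state_space) (a : T -> R) (f : T -> X) (b : R) l :
  tends F a b -> tends F f l ->
  tends F (fun x => (a x [*] f x)) (b [*] l).
Proof.
intros [Hf] [Hg]; constructor; exact (filterlim_comp_2 a f scal Hf Hg (filterlim_scal (K := R_AbsRing) b l)).
Qed.

Lemma tends_linear (X Y : abstract_state_space) (L : X -> Y) (f : T -> X) l :
  is_linear L -> tends F f l -> tends F (fun x => L (f x)) (L l).
Proof.
intros HL [Hf]; constructor; apply filterlim_comp with (1 := Hf).
exact (linear_cont L l HL).
Qed.

Lemma tends_opp (X : abstract_state_space) (f : T -> X) l :
  tends F f l -> tends F (fun x => [-] f x) ([-] l).
Proof. exact (tends_linear (@is_linear_opp R_AbsRing X)). Qed.

Lemma tends_minus (X : abstract_state_space) (f g : T -> X) l m :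
  tends F f l -> tends F g m ->
  tends F (fun x => (f x [-] g x)) (l [-] m).
Proof. intros Hf Hg; apply tends_plus; auto; now apply tends_opp. Qed.

Lemma tends_norm_real (X : abstract_state_space) (f : T -> X) l :
  tends F f l ->
  tends F (fun x => <|f x|>) (<|l|>).
Proof. intros [H]; constructor; exact (filterlim_comp _ _ _ _ _ _ _ _ H (filterlim_norm (V := X) l)). Qed.

Lemma tends_norm_zero (X : abstract_state_space) (f : T -> X) l :
  tends F f l ->
  tends F (fun x => <|f x [-] l|>) 0.
Proof.
intros H; replace 0 with (<|l [-] l|>).
- apply tends_norm_real, tends_minus; auto; apply tends_const.
- replace (l [-] l) with (zero : X) by vec; apply vnorm_zero.
Qed.

Lemma tends_norm_lt (f : T -> R) l eps :
  tends F f l -> 0 < eps -> F (fun x => Rabs (f x - l) < eps).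
Proof. intros H He; exact (proj1 (tends_norm f l) H eps He). Qed.

Lemma tends_real (f : T -> R) l :
  (forall eps, 0 < eps -> F (fun x => Rabs (f x - l) < eps)) ->
  tends F f l.
Proof. intros H; apply (proj2 (tends_norm f l)), H. Qed.

Lemma tends_zero_mult (c : R) (f : T -> R) :
  tends F f 0 -> tends F (fun x => c * f x) 0.
Proof.
intros H; rewrite <- (Rmult_0_r c).
exact (@tends_scal R_state_space (fun _ => c) f c 0 (tends_const c) H).
Qed.

Lemma tends_zero_diff (f : T -> R) (l : R) :
  tends F f l -> tends F (fun x => l - f x) 0.
Proof.
intros H; rewrite <- (Rminus_diag l).
exact (@tends_minus R_state_space (fun _ => l) f l l (tends_const l) H).
Qed.

Lemma tends_zero_plus (f g : T -> R) :
  tends F f 0 -> tends F g 0 -> tends F (fun x => f x + g x) 0.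
Proof.
intros Hf Hg; rewrite <- (Rplus_0_r 0).
exact (@tends_plus R_state_space f g 0 0 Hf Hg).
Qed.

End Limits.

Section ProperLimits.

Variables (T : Type) (F : (T -> Prop) -> Prop).
Context {FF : ProperFilter F}.

Lemma tends_unique (X : abstract_state_space) (f : T -> X) l m :
  tends F f l -> tends F f m -> l = m.
Proof. intros [Hl] [Hm]; exact (filterlim_locally_unique (V := X) f l m Hl Hm). Qed.

Lemma tends_le (f g : T -> R) l m :
  F (fun x => f x <= g x) ->
  tends F f l -> tends F g m ->
  l <= m.
Proof.
intros H Hf Hg; destruct (Rle_or_lt l m) as [|Hlt]; auto; exfalso.
assert (He : 0 < (l - m) / 2) by lra.
generalize (filter_and _ _ H
  (filter_and _ _ (tends_norm_lt Hf He) (tends_norm_lt Hg He))).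
intros H'; destruct (filter_ex _ H') as [x [H1 [H2 H3]]].
apply Rabs_def2 in H2; apply Rabs_def2 in H3; lra.
Qed.

Lemma tends_le_const (f : T -> R) l c :
  F (fun x => f x <= c) -> tends F f l -> l <= c.
Proof.
intros H Hf; apply (tends_le (f := f) (g := fun _ => c)); auto.
apply tends_const; auto; apply FF.
Qed.

Lemma tends_ge_const (f : T -> R) l c :
  F (fun x => c <= f x) -> tends F f l -> c <= l.
Proof.
intros H Hf; apply (tends_le (f := fun _ => c) (g := f)); auto.
apply tends_const; auto; apply FF.
Qed.

Lemma tends_closed (X : abstract_state_space) (D : X -> Prop) (f : T -> X) l :
  closed D -> F (fun x => D (f x)) -> tends F f l -> D l.
Proof.
intros HD H [Hf].
exact (closed_filterlim_loc f D l Hf H HD).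
Qed.

End ProperLimits.

Lemma at_right_0 (P : R -> Prop) :
  at_right 0 P <-> exists d, 0 < d /\ forall h, 0 < h < d -> P h.
Proof.
split.
- intros [d Hd]; exists d; split; [apply cond_pos|intros h Hh].
  apply Hd; [|lra]; unfold ball; simpl; unfold AbsRing_ball, abs, minus, plus, opp; simpl.
  rewrite Rabs_pos_eq; lra.
- intros [d [Hd H]]; exists (mkposreal d Hd); intros h Hh Hh0.
  apply H; split; auto.
  revert Hh; unfold ball; simpl; unfold AbsRing_ball, abs, minus, plus, opp; simpl.
  intros Hh; apply Rabs_def2 in Hh; lra.
Qed.

Lemma at_right_pos : at_right 0 (fun h => 0 < h).
Proof. apply at_right_0; exists 1; split; [lra|intros; lra]. Qed.

Lemma tends_at_right (X : abstract_state_space) (f : R -> X) l :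
  tends (at_right 0) f l <->
  forall eps, 0 < eps -> exists d, 0 < d /\
    forall h, 0 < h < d -> <|(f h) [-] l|> < eps.
Proof.
rewrite tends_norm by apply at_right_proper_filter.
split; intros H eps He; apply at_right_0, H, He.
Qed.

Lemma tends_seq (X : abstract_state_space) (f : nat -> X) l :
  tends eventually f l <->
  forall eps, 0 < eps -> exists N, forall n, (N <= n)%nat -> <|(f n) [-] l|> < eps.
Proof.
rewrite tends_norm by apply eventually_filter; unfold eventually; tauto.
Qed.

Lemma complete_seq (X : abstract_state_space) (f : nat -> X) :
  (forall eps, 0 < eps -> exists N, forall n m, (N <= n)%nat -> (n <= m)%nat ->
     <|(f m) [-] (f n)|> < eps) ->
  exists l, tends eventually f l.
Proof.
intros H.
cut (exists l : X, filterlim f eventually (locally l)).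
{ intros [l Hl]; exists l; now constructor. }
apply (filterlim_locally_cauchy (U := X)).
intros eps.
assert (He : 0 < eps / 2) by (generalize (cond_pos eps); lra).
destruct (H _ He) as [N HN].
exists (fun n => (N <= n)%nat); split; [now exists N|].
intros n m Hn Hm.
apply (norm_compat1 (V := X) (f n) (f m)).
apply Rle_lt_trans with (1 := norm_minus_trans (f N) _ _).
rewrite (norm_minus_sym (f N) (f n)).
generalize (HN N n (le_n _) Hn), (HN N m (le_n _) Hm); lra.
Qed.

(** * The cone *)

Lemma tends_half_pow (c : R) : tends eventually (fun n => c * (/ 2) ^ n) 0.
Proof.
assert (H : is_lim_seq (fun n => c * (/ 2) ^ n) (Rbar_mult c 0)).
{ apply is_lim_seq_scal_l, is_lim_seq_geom; rewrite Rabs_pos_eq; lra. }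
simpl in H; rewrite Rmult_0_r in H; constructor; exact H.
Qed.

Section Cone.

Variable X : abstract_state_space.
Implicit Types x y z u v w : X.

Lemma cone_norm_le u v : cone u -> cone (v [-] u) -> <|u|> <= <|v|>.
Proof.
intros Hu Hv; replace v with (u [+] (v [-] u)) at 1 by vec.
rewrite cone_norm_additive by auto; generalize (vnorm_ge_0 (v [-] u)); lra.
Qed.

Lemma cone_norm_minus u v : cone u -> cone (v [-] u) -> <|v [-] u|> = <|v|> - <|u|>.
Proof.
intros Hu Hv; replace v with (u [+] (v [-] u)) at 2 by vec.
rewrite cone_norm_additive by auto; lra.
Qed.

Lemma cone_antisym u v : cone (v [-] u) -> cone (u [-] v) -> u = v.
Proof.
intros H1 H2; symmetry; apply minus_zero_eq, cone_pointed; auto.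
replace (opp (v [-] u)) with (u [-] v) by vec; auto.
Qed.

Lemma cone_trans v u w : cone (v [-] u) -> cone (w [-] v) -> cone (w [-] u).
Proof.
intros H1 H2; replace (w [-] u) with ((w [-] v) [+] (v [-] u)) by vec.
now apply cone_plus.
Qed.

Lemma tends_cone (T : Type) (F : (T -> Prop) -> Prop) {FF : ProperFilter F}
    (f : T -> X) l :
  F (fun i => cone (f i)) -> tends F f l -> cone l.
Proof. exact (@tends_closed T F FF X cone f l (@cone_closed X)). Qed.

Lemma cone_increasing_le (f : nat -> X) n m :
  (forall n, cone (f (S n) [-] f n)) -> (n <= m)%nat -> cone (f m [-] f n).
Proof.
intros H Hnm; induction Hnm as [|m Hnm IH].
- replace (f n [-] f n) with (zero : X) by vec; apply cone_zero.
- apply cone_trans with (f m); auto.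
Qed.

(* On the cone the norm is additive, so the increments of an increasing
   bounded sequence are those of its real sequence of norms. *)
Lemma cone_monotone_cv (f : nat -> X) (C : R) :
  cone (f 0%nat) -> (forall n, cone (f (S n) [-] f n)) ->
  (forall n, <|f n|> <= C) -> exists l, tends eventually f l.
Proof.
intros H0 Hinc HC.
assert (Hcone : forall n, cone (f n)).
{ intros n; replace (f n) with ((f n [-] f 0%nat) [+] f 0%nat) by vec.
  apply cone_plus; auto; apply cone_increasing_le; auto; lia. }
assert (Hdiff : forall n m, (n <= m)%nat -> <|f m [-] f n|> = <|f m|> - <|f n|>).
{ intros n m Hnm; apply cone_norm_minus; auto; now apply cone_increasing_le. }
destruct (completeness (fun r => exists n, r = <|f n|>)) as [s [Hs1 Hs2]].
- exists C; intros r [n ->]; apply HC.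
- exists (<|f 0%nat|>), 0%nat; auto.
- apply complete_seq; intros eps He.
  destruct (excluded_middle_informative (exists n, s - eps < <|f n|>)) as [[N HN]|Hno].
  + exists N; intros n m Hn Hm; rewrite Hdiff by auto.
    assert (<|f m|> <= s) by (apply Hs1; now exists m).
    generalize (vnorm_ge_0 (f n [-] f N)); rewrite Hdiff by auto; lra.
  + exfalso; assert (s <= s - eps); [|lra].
    apply Hs2; intros r [n ->].
    destruct (Rle_or_lt (<|f n|>) (s - eps)) as [|Hlt]; auto.
    exfalso; apply Hno; now exists n.
Qed.

Fixpoint vsum (a : nat -> X) (n : nat) : X :=
  match n with
  | 0%nat => zero
  | S m => vsum a m [+] a m
  end.

Lemma vsum_ext a b n :
  (forall k, (k < n)%nat -> a k = b k) -> vsum a n = vsum b n.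
Proof.
induction n as [|n IH]; intros H; simpl; auto.
rewrite IH, H by (intros; try apply H; lia); auto.
Qed.

Lemma vsum_cone a n : (forall k, (k < n)%nat -> cone (a k)) -> cone (vsum a n).
Proof.
induction n as [|n IH]; intros H; simpl; [apply cone_zero|].
apply cone_plus; [apply IH; intros; apply H|apply H]; lia.
Qed.

Lemma vsum_step a n : vsum a (S n) [-] vsum a n = a n.
Proof. simpl; vec. Qed.

Lemma vsum_cone_le a n m :
  (forall k, cone (a k)) -> (n <= m)%nat -> cone (vsum a m [-] vsum a n).
Proof.
intros H Hnm; apply cone_increasing_le; auto.
intros k; rewrite vsum_step; auto.
Qed.

Lemma vsum_plus a b n : vsum (fun k => a k [+] b k) n = vsum a n [+] vsum b n.
Proof. induction n as [|n IH]; simpl; [vec|rewrite IH; vec]. Qed.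

Lemma vsum_scal (r : R) a n : vsum (fun k => r [*] a k) n = r [*] vsum a n.
Proof. induction n as [|n IH]; simpl; [vec|rewrite IH; vec]. Qed.

Lemma vsum_minus a b n : vsum (fun k => a k [-] b k) n = vsum a n [-] vsum b n.
Proof. induction n as [|n IH]; simpl; [vec|rewrite IH; vec]. Qed.

Lemma vsum_shift a n : vsum a (S n) = a 0%nat [+] vsum (fun k => a (S k)) n.
Proof.
induction n as [|n IH]; [simpl; vec|].
change (vsum a (S (S n))) with (vsum a (S n) [+] a (S n)).
rewrite IH; simpl; vec.
Qed.

Lemma vsum_tends (T : Type) (F : (T -> Prop) -> Prop) {FF : Filter F}
    (a : T -> nat -> X) (l : nat -> X) n :
  (forall k, (k < n)%nat -> tends F (fun i => a i k) (l k)) ->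
  tends F (fun i => vsum (a i) n) (vsum l n).
Proof.
induction n as [|n IH]; intros H; simpl; [apply tends_const; auto|].
apply tends_plus; auto.
Qed.

(** * Decomposition into positive parts with norm control *)

Definition split_within (c : R) x : Prop :=
  exists u v, cone u /\ cone v /\ x = u [-] v /\ <|u|> + <|v|> <= c.

(** Half of [r n] pays for the move of the centre and half for the next radius, so the closed balls
    are nested; the radii decay geometrically and completeness gives a common point. *)
Lemma nested_balls (x : nat -> X) (r : nat -> R) :
  (forall n, 0 < r n) -> (forall n, r (S n) <= r n / 2) ->
  (forall n, <|x (S n) [-] x n|> <= r n / 2) ->
  exists l, forall n, <|l [-] x n|> <= r n.
Proof.
intros Hpos Hr Hx.
assert (Hmn : forall n k, <|x (k + n)%nat [-] x n|> <= r n - r (k + n)%nat).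
{ intros n k; induction k as [|k IH]; simpl.
  - replace (x n [-] x n) with (zero : X) by vec; rewrite vnorm_zero; lra.
  - apply Rle_trans with (1 := norm_minus_trans (x (k + n)%nat) _ _).
    generalize (Hx (k + n)%nat), (Hr (k + n)%nat); lra. }
assert (Hle : forall n m, (n <= m)%nat -> <|x m [-] x n|> <= r n).
{ intros n m Hnm; replace m with ((m - n) + n)%nat by lia.
  generalize (Hmn n (m - n)%nat), (Hpos (m - n + n)%nat); lra. }
assert (Hr0 : forall n, r n <= r 0%nat * (/ 2) ^ n).
{ induction n as [|n IH]; simpl; [lra|]; generalize (Hr n); lra. }
destruct (complete_seq (f := x)) as [l Hl].
{ intros eps He.
  destruct (pow_lt_1_zero (/ 2)) with (y := eps / r 0%nat) as [N HN].
  - rewrite Rabs_pos_eq; lra.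
  - apply Rdiv_lt_0_compat; auto.
  - exists N; intros n m Hn Hm.
    apply Rle_lt_trans with (1 := Hle _ _ Hm).
    apply Rle_lt_trans with (1 := Hr0 n).
    assert (H := HN n Hn); rewrite Rabs_pos_eq in H
      by (apply pow_le; lra).
    apply Rmult_lt_compat_l with (r := r 0%nat) in H; auto.
    replace (r 0%nat * (eps / r 0%nat)) with eps in H; auto.
    field; apply Rgt_not_eq, Hpos. }
exists l; intros n.
apply (@tends_le_const nat eventually _ (fun m => <|x m [-] x n|>)).
- exists n; apply Hle.
- apply tends_norm_real, tends_minus; auto; try apply eventually_filter.
  apply tends_const, eventually_filter.
Qed.

(* Baire's category argument for the closures of the sets [split_within n],
   which cover the space since the cone is generating. *)
Lemma split_within_dense_somewhere :
  exists (n : nat) (x0 : X) (r : R), 0 < r /\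
    forall x, <|x [-] x0|> <= r -> forall eps, 0 < eps ->
      exists y, split_within (INR n) y /\ <|x [-] y|> < eps.
Proof.
apply NNPP; intros Hno.
assert (Hstep : forall (n : nat) (p : {p : X * R | 0 < snd p}),
  exists q : {p : X * R | 0 < snd p},
    snd (proj1_sig q) <= snd (proj1_sig p) / 2 /\
    <|fst (proj1_sig q) [-] fst (proj1_sig p)|> <= snd (proj1_sig p) / 2 /\
    forall y, split_within (INR n) y ->
      snd (proj1_sig q) < <|y [-] fst (proj1_sig q)|>).
{ intros n [[x0 r] Hr]; simpl in *.
  apply NNPP; intros Hno'; apply Hno; exists n, x0, (r / 2); split; [lra|].
  intros x Hx eps He; apply NNPP; intros Hy; apply Hno'.
  assert (Hm : 0 < Rmin (eps / 2) (r / 2)) by (apply Rmin_glb_lt; lra).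
  exists (exist _ (x, Rmin (eps / 2) (r / 2)) Hm); simpl.
  split; [apply Rmin_r|split; auto].
  intros y Hy'; destruct (Rlt_or_le (Rmin (eps / 2) (r / 2)) (<|y [-] x|>)) as [|Hle]; auto.
  exfalso; apply Hy; exists y; split; auto.
  rewrite norm_minus_sym; generalize (Rmin_l (eps / 2) (r / 2)); lra. }
set (step n p := constructive_indefinite_description _ (Hstep n p)).
set (s := fix s n : {p : X * R | 0 < snd p} :=
  match n with
  | 0%nat => exist _ (zero : X, 1) Rlt_0_1
  | S m => proj1_sig (step m (s m))
  end).
destruct (@nested_balls (fun n => fst (proj1_sig (s n)))
  (fun n => snd (proj1_sig (s n)))) as [l Hl].
- intros n; apply (proj2_sig (s n)).
- intros n; exact (proj1 (proj2_sig (step n (s n)))).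
- intros n; exact (proj1 (proj2 (proj2_sig (step n (s n))))).
(* The common point is a difference of cone elements, hence lies in some [split_within (INR n)],
   which ball [S n] was chosen to avoid. *)
- destruct (cone_generating l) as [u [v [Hu [Hv Huv]]]].
  destruct (INR_unbounded (<|u|> + <|v|>)) as [n Hn].
  assert (H : split_within (INR n) l) by (exists u, v; repeat split; auto; lra).
  assert (H1 := proj2 (proj2 (proj2_sig (step n (s n)))) _ H).
  assert (H2 := Hl (S n)); simpl in H2; lra.
Qed.

(** Half the difference of approximations of [x0 + x] and [x0 - x] approximates [x]: this moves the
    ball to the origin, and homogeneity then reaches every vector. The error [<|x|> / 2] is what an
    iteration can absorb. *)
Lemma split_within_dense :
  exists C : R, 0 <= C /\ forall x, exists u v, cone u /\ cone v /\
    <|u|> + <|v|> <= C * <|x|> /\ <|x [-] (u [-] v)|> <= <|x|> / 2.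
Proof.
destruct split_within_dense_somewhere as [n [x0 [r [Hr Hd]]]].
assert (H0 : forall x, <|x|> <= r -> forall eps, 0 < eps -> exists u v,
  cone u /\ cone v /\ <|u|> + <|v|> <= INR n /\ <|x [-] (u [-] v)|> < eps).
{ intros x Hx eps He.
  destruct (Hd (x0 [+] x)) with (eps := eps)
    as [y1 [[u1 [v1 [Hu1 [Hv1 [-> H1]]]]] Hy1]]; auto.
  { replace ((x0 [+] x) [-] x0) with x by vec; auto. }
  destruct (Hd (x0 [-] x)) with (eps := eps)
    as [y2 [[u2 [v2 [Hu2 [Hv2 [-> H2]]]]] Hy2]]; auto.
  { replace ((x0 [-] x) [-] x0) with ([-] x) by vec; rewrite vnorm_opp; auto. }
  exists ((/ 2) [*] (u1 [+] v2)), ((/ 2) [*] (v1 [+] u2)).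
  split; [apply cone_scal, cone_plus; auto; lra|].
  split; [apply cone_scal, cone_plus; auto; lra|].
  rewrite !norm_scal_pos by lra; rewrite !cone_norm_additive by auto.
  split; [lra|].
  replace (x [-] _) with ((/ 2) [*] (((x0 [+] x) [-] (u1 [-] v1))
    [-] ((x0 [-] x) [-] (u2 [-] v2)))) by vec.
  rewrite norm_scal_pos by lra.
  generalize (norm_minus_le ((x0 [+] x) [-] (u1 [-] v1)) ((x0 [-] x) [-] (u2 [-] v2))).
  lra. }
exists (INR n / r); split; [apply Rdiv_le_0_compat; auto; apply pos_INR|].
intros x; destruct (Req_dec (<|x|>) 0) as [Hx|Hx].
- exists zero, zero; repeat split; try apply cone_zero.
  + rewrite !vnorm_zero, Hx; lra.
  + replace (x [-] _) with x by vec; lra.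
- assert (Hx0 : 0 < <|x|>) by (generalize (vnorm_ge_0 x); lra).
  assert (Ha : 0 < r / <|x|>) by (apply Rdiv_lt_0_compat; auto).
  assert (Hb : 0 < <|x|> / r) by (apply Rdiv_lt_0_compat; auto).
  destruct (H0 ((r / <|x|>) [*] x)) with (eps := r / 2)
    as [u [v [Hu [Hv [H1 H2]]]]]; [|lra|].
  { rewrite norm_scal_pos by lra; apply Req_le; field; lra. }
  exists ((<|x|> / r) [*] u), ((<|x|> / r) [*] v).
  split; [apply cone_scal; auto; lra|].
  split; [apply cone_scal; auto; lra|].
  rewrite !norm_scal_pos by lra; split.
  + apply Rle_trans with (<|x|> / r * INR n).
    * rewrite <- Rmult_plus_distr_l; apply Rmult_le_compat_l; lra.
    * apply Req_le; field; lra.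
  + replace (x [-] _) with
      ((<|x|> / r) [*] (((r / <|x|>) [*] x) [-] (u [-] v)))
      by (vec; field; lra).
    rewrite norm_scal_pos by lra.
    apply Rle_trans with (<|x|> / r * (r / 2)).
    * apply Rmult_le_compat_l; lra.
    * apply Req_le; field; lra.
Qed.

(** As in the open mapping theorem, the residual is approximated again and again, its norm halving
    each time. The positive parts sum to at most [2 * C * <|x|>]; the extra 1 in the constant only
    makes it positive. *)
Lemma cone_decomposition :
  exists M : R, 0 < M /\ forall x, exists u v, cone u /\ cone v /\
    x = u [-] v /\ <|u|> <= M * <|x|> /\ <|v|> <= M * <|x|>.
Proof.
destruct split_within_dense as [C [HC Hd]].
exists (2 * C + 1); split; [lra|]; intros x.
assert (Hd' : forall x, exists p : X * X, cone (fst p) /\ cone (snd p) /\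
    <|fst p|> + <|snd p|> <= C * <|x|> /\ <|x [-] (fst p [-] snd p)|> <= <|x|> / 2).
{ intros y; destruct (Hd y) as [u [v H]]; exists (u, v); auto. }
set (dec y := constructive_indefinite_description _ (Hd' y)).
(* [s n] is the residual after [n] approximations, and [a n], [b n] are the positive parts taken
   from it. *)
set (s := fix s n : X := match n with 0%nat => x
  | S m => s m [-] (fst (proj1_sig (dec (s m))) [-] snd (proj1_sig (dec (s m)))) end).
set (a n := fst (proj1_sig (dec (s n)))); set (b n := snd (proj1_sig (dec (s n)))).
assert (Ha : forall n, cone (a n)) by (intros n; apply (proj2_sig (dec (s n)))).
assert (Hb : forall n, cone (b n)) by (intros n; apply (proj2_sig (dec (s n)))).
assert (Hs : forall n, <|s n|> <= <|x|> * (/ 2) ^ n).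
{ induction n as [|n IH]; simpl; [lra|].
  apply Rle_trans with (1 := proj2 (proj2 (proj2 (proj2_sig (dec (s n)))))); lra. }
assert (Hab : forall n, <|a n|> + <|b n|> <= C * <|x|> * (/ 2) ^ n).
{ intros n; apply Rle_trans with (1 := proj1 (proj2 (proj2 (proj2_sig (dec (s n)))))).
  rewrite Rmult_assoc; apply Rmult_le_compat_l; auto. }
assert (Hsum : forall n, <|vsum a n|> + <|vsum b n|> <= 2 * C * <|x|> * (1 - (/ 2) ^ n)).
{ induction n as [|n IH]; simpl; [rewrite !vnorm_zero; lra|].
  generalize (vnorm_triangle (vsum a n) (a n)), (vnorm_triangle (vsum b n) (b n)), (Hab n).
  simpl; lra. }
assert (Hpow : forall n, 0 < (/ 2) ^ n) by (intros n; apply pow_lt; lra).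
assert (HCx : 0 <= 2 * C * <|x|>)
  by (apply Rmult_le_pos; [lra|apply vnorm_ge_0]).
assert (Hbd : forall n, <|vsum a n|> <= 2 * C * <|x|> /\ <|vsum b n|> <= 2 * C * <|x|>).
{ intros n; generalize (Hsum n) (vnorm_ge_0 (vsum a n)) (vnorm_ge_0 (vsum b n)) (Hpow n).
  intros H1 H2 H3 H4.
  assert (0 <= 2 * C * <|x|> * (/ 2) ^ n) by (apply Rmult_le_pos; lra).
  lra. }
destruct (@cone_monotone_cv (vsum a) (2 * C * <|x|>)) as [u Hu];
  [apply cone_zero|intros n; rewrite vsum_step; apply Ha|apply Hbd|].
destruct (@cone_monotone_cv (vsum b) (2 * C * <|x|>)) as [v Hv];
  [apply cone_zero|intros n; rewrite vsum_step; apply Hb|apply Hbd|].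
exists u, v.
assert (Hn : forall (a : nat -> X) w, (forall n, <|vsum a n|> <= 2 * C * <|x|>) ->
  tends eventually (vsum a) w -> <|w|> <= (2 * C + 1) * <|x|>).
{ intros a' w H Hw.
  assert (<|w|> <= 2 * C * <|x|>); [|generalize (vnorm_ge_0 x); lra].
  apply (@tends_le_const nat eventually _ (fun m => <|vsum a' m|>)).
  - exists 0%nat; auto.
  - apply tends_norm_real; auto; apply eventually_filter. }
repeat split.
- apply (@tends_cone _ eventually _ (vsum a)); auto; exists 0%nat; intros; apply vsum_cone; auto.
- apply (@tends_cone _ eventually _ (vsum b)); auto; exists 0%nat; intros; apply vsum_cone; auto.
- apply (@tends_unique nat eventually _ X (fun n => vsum a n [-] vsum b n)).
  + apply (@tends_squeeze nat eventually _ X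
      (fun n => vsum a n [-] vsum b n) x (fun n => <|x|> * (/ 2) ^ n)).
    * exists 0%nat; intros n _.
      replace (vsum a n [-] vsum b n [-] x) with ([-] (s n)).
      { rewrite vnorm_opp; auto. }
      induction n as [|n IH]; simpl; [vec|].
      fold (a n) (b n); transitivity (([-] (s n)) [+] a n [-] b n); [vec|].
      rewrite IH; vec.
    * apply tends_half_pow.
  + apply tends_minus; auto; apply eventually_filter.
- apply (Hn a); auto; intros n; apply Hbd.
- apply (Hn b); auto; intros n; apply Hbd.
Qed.

End Cone.

(** * Integration *)

Section Integration.

Variables X Y : abstract_state_space.

(** Continuity relative to the interval: the values of a semigroup at negative times are
    arbitrary. *)
Definition cont_on (a b : R) (f : R -> X) : Prop :=
  forall s, a <= s <= b -> forall eps, 0 < eps -> exists d, 0 < d /\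
    forall r, a <= r <= b -> Rabs (r - s) < d -> <|f r [-] f s|> < eps.

Definition cont_nonneg (f : R -> X) : Prop :=
  forall s, 0 <= s -> forall eps, 0 < eps -> exists d, 0 < d /\
    forall r, 0 <= r -> Rabs (r - s) < d -> <|f r [-] f s|> < eps.

Lemma cont_nonneg_on f a b : 0 <= a -> cont_nonneg f -> cont_on a b f.
Proof.
intros Ha Hf s Hs eps He; destruct (Hf s) with (eps := eps) as [d [Hd H]]; auto; [lra|].
exists d; split; auto; intros r Hr; apply H; lra.
Qed.

Lemma cont_on_minus f g a b :
  cont_on a b f -> cont_on a b g -> cont_on a b (fun s => f s [-] g s).
Proof.
intros Hf Hg s Hs eps He.
destruct (Hf s Hs (eps / 2)) as [d1 [Hd1 H1]]; [lra|].
destruct (Hg s Hs (eps / 2)) as [d2 [Hd2 H2]]; [lra|].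
exists (Rmin d1 d2); split; [now apply Rmin_glb_lt|].
intros r Hr Hrs.
assert (<|f r [-] f s|> < eps / 2)
  by (apply H1; auto; apply Rlt_le_trans with (1 := Hrs), Rmin_l).
assert (<|g r [-] g s|> < eps / 2)
  by (apply H2; auto; apply Rlt_le_trans with (1 := Hrs), Rmin_r).
replace (_ [-] _) with ((f r [-] f s) [-] (g r [-] g s)) by vec.
apply Rle_lt_trans with (1 := norm_minus_le _ _); lra.
Qed.

(** Because [g] is independent of [s], an increment to the left of [s] is controlled as a right
    increment from the other point. Right continuity at 0 thus becomes two-sided continuity. *)
Lemma cont_nonneg_modulus (f : R -> X) (g : R -> R) :
  (forall s h, 0 <= s -> 0 < h -> <|f (s + h) [-] f s|> <= g h) ->
  tends (at_right 0) g 0 -> cont_nonneg f.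
Proof.
intros Hfg Hg s Hs eps He.
destruct (proj1 (tends_at_right _ _) Hg eps He) as [d [Hd H]].
assert (Hle : forall p q, 0 <= p -> p < q -> q - p < d -> <|f q [-] f p|> < eps).
{ intros p q Hp Hpq Hqp.
  assert (H1 : Rabs (g (q - p) - 0) < eps) by (apply (H (q - p)); lra).
  apply Rabs_def2 in H1.
  assert (H2 := Hfg p (q - p) Hp); replace (p + (q - p)) with q in H2 by ring.
  apply Rle_lt_trans with (g (q - p)); [apply H2|]; lra. }
exists d; split; auto; intros r Hr Hrs; apply Rabs_def2 in Hrs.
destruct (Rtotal_order r s) as [H1|[->|H1]].
- rewrite norm_minus_sym; apply Hle; lra.
- replace (f s [-] f s) with (zero : X) by vec; rewrite vnorm_zero; auto.
- apply Hle; lra.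
Qed.

(** Composition with [clamp] extends a function that is continuous relative to the interval to one
    continuous on the whole line, as the integrability theorems require. *)
Definition clamp (a b s : R) : R := Rmax a (Rmin b s).

Lemma clamp_in a b s : a <= b -> a <= clamp a b s <= b.
Proof.
intros H; unfold clamp; split; [apply Rmax_l|].
apply Rmax_lub; auto; apply Rmin_l.
Qed.

Lemma clamp_id a b s : a <= s <= b -> clamp a b s = s.
Proof. intros H; unfold clamp; rewrite Rmin_right, Rmax_right; lra. Qed.

Lemma clamp_lip a b r s : Rabs (clamp a b r - clamp a b s) <= Rabs (r - s).
Proof.
unfold clamp, Rmax, Rmin.
destruct (Rle_dec b r), (Rle_dec b s);
  repeat match goal with |- context [Rle_dec ?u ?v] => destruct (Rle_dec u v) end;
  unfold Rabs; repeat destruct Rcase_abs; lra.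
Qed.

Lemma cont_on_clamp f a b s :
  a <= b -> cont_on a b f -> continuous (fun r => f (clamp a b r)) s.
Proof.
intros Hab Hf.
refine (@tends_filterlim _ (locally s) X (fun r => f (clamp a b r)) _ _).
apply (proj2 (tends_norm _ _)); intros eps He.
destruct (Hf _ (clamp_in s Hab) eps He) as [d [Hd H]].
exists (mkposreal d Hd); intros r Hr.
apply H; [now apply clamp_in|].
apply Rle_lt_trans with (1 := clamp_lip a b r s), Hr.
Qed.

Lemma ex_RInt_cont_on f a b : a <= b -> cont_on a b f -> ex_RInt f a b.
Proof.
intros Hab Hf.
apply ex_RInt_ext with (fun r => f (clamp a b r)).
- rewrite Rmin_left, Rmax_right by auto; intros s Hs; rewrite clamp_id; auto; lra.
- apply (ex_RInt_continuous (V := X)); intros s _; now apply cont_on_clamp.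
Qed.

Lemma ex_RInt_cont_nonneg f a b : 0 <= a -> 0 <= b -> cont_nonneg f -> ex_RInt f a b.
Proof.
intros Ha Hb Hf; destruct (Rle_or_lt a b) as [Hab|Hab].
- apply ex_RInt_cont_on; auto; now apply cont_nonneg_on.
- apply (ex_RInt_swap (V := X)), ex_RInt_cont_on; [lra|]; now apply cont_nonneg_on.
Qed.

Lemma is_RInt_linear (L : X -> Y) (f : R -> X) a b I :
  is_linear L -> is_RInt f a b I -> is_RInt (fun s => L (f s)) a b (L I).
Proof.
intros HL Hf; unfold is_RInt.
assert (H := filterlim_comp _ _ _ _ _ _ _ _ Hf (linear_cont L I HL)).
apply filterlim_ext with (2 := H); intros ptd.
assert (HR : L (Riemann_sum f ptd) = Riemann_sum (fun s => L (f s)) ptd).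
{ induction ptd as [x0|h s IH] using SF_cons_ind.
  - unfold Riemann_sum; simpl; exact (linear_zero L HL).
  - rewrite !Riemann_sum_cons, (linear_plus L HL), IH; f_equal.
    exact (linear_scal L HL _ _). }
refine (eq_trans (linear_scal L HL _ _) _); exact (f_equal _ HR).
Qed.

Lemma is_RInt_cone (f : R -> X) a b I :
  a <= b -> (forall s, a < s < b -> cone (f s)) -> is_RInt f a b I -> cone I.
Proof.
intros Hab Hpos Hf.
destruct (Req_dec a b) as [<-|Hne].
{ replace I with (zero : X); [apply cone_zero|].
  exact (filterlim_locally_unique (V := X) _ _ _ (is_RInt_point f a) Hf). }
(* Riemann sums may sample the endpoints, where nothing is known about [f]; changing the values
   there leaves the integral alone. *)
set (g s := if Rlt_dec a s then if Rlt_dec s b then f s else zero else zero).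
assert (Hg : forall s, cone (g s)).
{ intros s; unfold g; destruct (Rlt_dec a s); [|apply cone_zero].
  destruct (Rlt_dec s b); [|apply cone_zero]; auto. }
assert (HI : is_RInt g a b I).
{ apply is_RInt_ext with (2 := Hf); rewrite Rmin_left, Rmax_right by auto.
  intros s Hs; unfold g; destruct (Rlt_dec a s); [|lra].
  destruct (Rlt_dec s b); [auto|lra]. }
refine (@tends_cone X _ _ (Riemann_fine_filter a b) _ _ _ (Tends HI)).
exists (mkposreal _ Rlt_0_1); intros ptd _ [Hptd _].
rewrite sign_eq_1 by lra.
apply cone_scal; [lra|].
revert Hptd; induction ptd as [x0|h s IH] using SF_cons_ind; intros Hptd.
- apply cone_zero.
- rewrite Riemann_sum_cons; apply cone_plus; [|apply IH, ptd_cons with h; auto].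
  apply cone_scal; auto.
  assert (H := Hptd 0%nat); rewrite SF_size_cons in H.
  assert (H' := H (Nat.lt_0_succ _)).
  simpl in H'; lra.
Qed.

Lemma norm_is_RInt_const (f : R -> X) a b I (c : R) :
  a <= b -> (forall s, a <= s <= b -> <|f s|> <= c) ->
  is_RInt f a b I -> <|I|> <= (b - a) * c.
Proof. exact (norm_RInt_le_const (V := X) f a b I c). Qed.

Lemma is_RInt_const_vec a b (x : X) : is_RInt (fun _ => x) a b ((b - a) [*] x).
Proof. exact (is_RInt_const (V := X) a b x). Qed.

Lemma is_RInt_minus_vec (f g : R -> X) a b I J :
  is_RInt f a b I -> is_RInt g a b J ->
  is_RInt (fun s => f s [-] g s) a b (I [-] J).
Proof. exact (is_RInt_minus (V := X) f g a b I J). Qed.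

Lemma is_RInt_plus_vec (f g : R -> X) a b I J :
  is_RInt f a b I -> is_RInt g a b J ->
  is_RInt (fun s => f s [+] g s) a b (I [+] J).
Proof. exact (is_RInt_plus (V := X) f g a b I J). Qed.

Lemma is_RInt_shift (f : R -> X) a b h I :
  is_RInt f (a + h) (b + h) I -> is_RInt (fun s => f (s + h)) a b I.
Proof.
intros H; apply is_RInt_ext with (fun s => 1 [*] f (1 * s + h)).
- intros s _; rewrite Rmult_1_l; vec.
- apply (is_RInt_comp_lin (V := X) f 1 h); rewrite !Rmult_1_l; auto.
Qed.

Lemma is_RInt_vsum (f : nat -> R -> X) a b I n :
  (forall k, (k < n)%nat -> is_RInt (f k) a b (I k)) ->
  is_RInt (fun s => vsum (fun k => f k s) n) a b (vsum I n).
Proof.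
induction n as [|n IH]; intros H; simpl.
- assert (H0 := @is_RInt_const_vec a b zero).
  assert (E : (b - a) [*] (zero : X) = zero) by vec.
  exact (eq_ind _ (fun y => is_RInt (fun _ => zero) a b y) H0 _ E).
- apply is_RInt_plus_vec; auto.
Qed.

Lemma RInt_right_tends (f : R -> X) s b :
  s < b -> ex_RInt f s b -> tends (at_right 0) (fun h => f (s + h)) (f s) ->
  tends (at_right 0) (fun h => / h [*] RInt f s (s + h)) (f s).
Proof.
intros Hsb Hex; rewrite !tends_at_right; intros H eps He.
destruct (H (eps / 2)) as [d [Hd H1]]; [lra|].
exists (Rmin d (b - s)); split; [apply Rmin_glb_lt; lra|].
intros h [Hh Hhd].
assert (Hd1 := Rmin_l d (b - s)); assert (Hd2 := Rmin_r d (b - s)).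
assert (HI : is_RInt f s (s + h) (RInt f s (s + h))).
{ apply RInt_correct, (ex_RInt_Chasles_1 (V := X) f s (s + h) b); auto; lra. }
assert (Hn : <|RInt f s (s + h) [-] (h [*] f s)|> <= h * (eps / 2)).
{ replace h with (s + h - s) at 2 3 by ring.
  apply norm_is_RInt_const with (fun r => f r [-] f s); [lra| |].
  - intros r Hr; destruct (Req_dec r s) as [->|Hrs].
    + replace (f s [-] f s) with (zero : X) by vec; rewrite vnorm_zero; lra.
    + replace r with (s + (r - s)) by ring; apply Rlt_le, H1; lra.
  - apply is_RInt_minus_vec; auto; apply is_RInt_const_vec. }
replace (_ [-] _) with (/ h [*] (RInt f s (s + h) [-] (h [*] f s)))
  by (vec; field; lra).
assert (0 < / h) by (apply Rinv_0_lt_compat; lra).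
rewrite norm_scal_pos by lra.
apply Rle_lt_trans with (/ h * (h * (eps / 2))).
- apply Rmult_le_compat_l; lra.
- rewrite <- Rmult_assoc, Rinv_l by lra; lra.
Qed.

Lemma cont_on_right f a b s :
  a <= s < b -> cont_on a b f -> tends (at_right 0) (fun h => f (s + h)) (f s).
Proof.
intros Hs Hf; apply tends_at_right; intros eps He.
destruct (Hf s) with (eps := eps) as [d [Hd H]]; auto; [lra|].
exists (Rmin d (b - s)); split; [apply Rmin_glb_lt; lra|].
intros h [Hh Hhd].
assert (Hd1 := Rmin_l d (b - s)); assert (Hd2 := Rmin_r d (b - s)).
apply H; [lra|]; rewrite Rabs_pos_eq; lra.
Qed.

Lemma cont_nonneg_right f s :
  0 <= s -> cont_nonneg f -> tends (at_right 0) (fun h => f (s + h)) (f s).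
Proof.
intros Hs Hf; apply (cont_on_right (a := 0) (b := s + 1)); [lra|].
apply cont_nonneg_on; auto; lra.
Qed.

(** Continuous induction: let [c] be the supremum of the points up to which [f] moves at rate at
    most [eps]. Continuity gives the bound at [c], and a vanishing right derivative at [c < b] would
    push it further, so [c = b]. *)
Lemma right_derivative_zero (f : R -> X) a b :
  a <= b -> cont_on a b f ->
  (forall s, a <= s < b ->
     tends (at_right 0) (fun h => / h [*] (f (s + h) [-] f s)) zero) ->
  f b = f a.
Proof.
intros Hab Hc Hder.
assert (Heps : forall eps, 0 < eps -> <|f b [-] f a|> <= eps * (b - a)).
{ intros eps He.
  set (E s := a <= s <= b /\ forall r, a <= r <= s -> <|f r [-] f a|> <= eps * (r - a)).
  destruct (completeness E) as [c [Hc1 Hc2]].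
  { exists b; intros s [Hs _]; lra. }
  { exists a; split; [lra|]; intros r Hr; replace r with a by lra.
    replace (f a [-] f a) with (zero : X) by vec; rewrite vnorm_zero; lra. }
  assert (Hac : a <= c).
  { apply Hc1; split; [lra|]; intros r Hr; replace r with a by lra.
    replace (f a [-] f a) with (zero : X) by vec; rewrite vnorm_zero; lra. }
  assert (Hcb : c <= b) by (apply Hc2; intros s [Hs _]; lra).
  assert (Hlt : forall r, a <= r < c -> <|f r [-] f a|> <= eps * (r - a)).
  { intros r Hr.
    destruct (excluded_middle_informative (exists s, E s /\ r < s)) as [[s [[_ Hs] Hrs]]|Hno].
    - apply Hs; lra.
    - exfalso; assert (c <= r); [|lra].
      apply Hc2; intros s Hs; destruct (Rle_or_lt s r); auto.
      exfalso; apply Hno; now exists s. }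
  assert (Hcc : <|f c [-] f a|> <= eps * (c - a)).
  { destruct (Req_dec a c) as [<-|Hne].
    - replace (f a [-] f a) with (zero : X) by vec; rewrite vnorm_zero; lra.
    - apply Rnot_lt_le; intros Hgt.
      destruct (Hc c) with (eps := <|f c [-] f a|> - eps * (c - a))
        as [d [Hd H]]; [lra|lra|].
      set (r := Rmax a (c - d / 2)).
      assert (Hr1 : a <= r) by apply Rmax_l.
      assert (Hr2 : c - d / 2 <= r) by apply Rmax_r.
      assert (Hr3 : r < c) by (apply Rmax_lub_lt; lra).
      assert (H1 := Hlt r (conj Hr1 Hr3)).
      assert (H2 : <|f r [-] f c|> < <|f c [-] f a|> - eps * (c - a)).
      { apply H; [lra|]; rewrite Rabs_left; lra. }
      assert (H3 := norm_minus_trans (f r) (f c) (f a)).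
      rewrite (norm_minus_sym (f c) (f r)) in H3.
      assert (eps * (r - a) <= eps * (c - a)) by (apply Rmult_le_compat_l; lra).
      lra. }
  destruct (Req_dec c b) as [<-|Hne]; auto.
  assert (Hs : a <= c < b) by lra.
  destruct (proj1 (tends_at_right _ _) (Hder c Hs) eps He) as [d [Hd H]].
  set (h0 := Rmin (d / 2) (b - c)).
  assert (Hh0 : 0 < h0) by (apply Rmin_glb_lt; lra).
  assert (Hh1 : h0 <= d / 2) by apply Rmin_l.
  assert (Hh2 : h0 <= b - c) by apply Rmin_r.
  exfalso; assert (c + h0 <= c); [|lra].
  apply Hc1; split; [lra|]; intros r Hr.
  destruct (Rlt_or_le r c) as [Hrc|Hrc]; [apply Hlt; lra|].
  destruct (Req_dec r c) as [->|Hrc']; auto.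
  assert (Hi : 0 < / (r - c)) by (apply Rinv_0_lt_compat; lra).
  assert (H1 : / (r - c) * <|f r [-] f c|> < eps).
  { rewrite <- norm_scal_pos by lra.
    replace (/ (r - c) [*] (f r [-] f c)) with
      ((/ (r - c) [*] (f (c + (r - c)) [-] f c)) [-] zero).
    - apply H; lra.
    - replace (c + (r - c)) with r by ring; vec. }
  assert (H2 : <|f r [-] f c|> <= (r - c) * eps).
  { apply Rmult_le_reg_l with (/ (r - c)); auto.
    rewrite <- Rmult_assoc, Rinv_l, Rmult_1_l by lra; lra. }
  apply Rle_trans with (1 := norm_minus_trans (f c) _ _); lra. }
apply norm_minus_eq0; apply Rle_antisym; [|apply vnorm_ge_0].
apply le_epsilon; intros eps He; rewrite Rplus_0_l.
destruct (Req_dec a b) as [<-|Hne].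
- replace (f a [-] f a) with (zero : X) by vec; rewrite vnorm_zero; lra.
- assert (He' : 0 < eps / (b - a)) by (apply Rdiv_lt_0_compat; lra).
  apply Rle_trans with (1 := Heps _ He').
  apply Req_le; field; lra.
Qed.

Lemma RInt_minus_Chasles (f : R -> X) a b c :
  ex_RInt f a b -> ex_RInt f b c -> RInt f a c [-] RInt f a b = RInt f b c.
Proof.
intros H1 H2; rewrite <- (RInt_Chasles (V := X) f a b c H1 H2).
change (RInt f a b [+] RInt f b c [-] RInt f a b = RInt f b c); vec.
Qed.

(* Semigroup orbits are only known to be differentiable from the right, so
   [is_RInt_derive] does not apply. *)
Lemma is_RInt_right_derivative (f g : R -> X) a b :
  a <= b -> cont_on a b f -> cont_on a b g ->
  (forall s, a <= s < b ->
     tends (at_right 0) (fun h => / h [*] (f (s + h) [-] f s)) (g s)) ->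
  is_RInt g a b (f b [-] f a).
Proof.
intros Hab Hf Hg Hder.
assert (Hex : forall r s, a <= r -> r <= s -> s <= b -> ex_RInt g r s).
{ intros r s H1 H2 H3; apply (ex_RInt_Chasles_2 (V := X) g a r s); [lra|].
  apply (ex_RInt_Chasles_1 (V := X) g a s b); [lra|].
  now apply ex_RInt_cont_on. }
assert (Hc : cont_on a b (fun s => RInt g a s)).
{ intros s Hs eps He.
  set (gc r := g (clamp a b r)).
  assert (Hgc : forall r, continuous gc r) by (intros r; now apply cont_on_clamp).
  assert (Hcs : continuous (fun r => RInt gc a r) s).
  { apply (continuous_RInt_1 (V := X) gc a s).
    exists (mkposreal _ Rlt_0_1); intros r _; apply (RInt_correct (V := X)).
    apply (ex_RInt_continuous (V := X)); auto. }
  destruct (proj1 (tends_norm (F := locally s) (X := X) (fun r => RInt gc a r) (RInt gc a s)) (Tends Hcs) eps He) as [d Hd].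
  exists d; split; [apply cond_pos|]; intros r Hr Hrs.
  assert (Hext : forall q, a <= q <= b -> RInt g a q = RInt gc a q).
  { intros q Hq; apply (RInt_ext (V := X)); rewrite Rmin_left, Rmax_right by lra.
    intros p Hp; unfold gc; rewrite clamp_id; auto; lra. }
  rewrite !Hext by auto; apply Hd, Hrs. }
assert (H0 := @right_derivative_zero (fun s => f s [-] RInt g a s) a b Hab).
cbv beta in H0; rewrite (RInt_point (V := X)) in H0.
replace (f b [-] f a) with (RInt g a b).
{ apply (RInt_correct (V := X)), Hex; lra. }
assert (E : f b [-] RInt g a b = f a [-] zero).
{ apply H0; [now apply cont_on_minus|].
  intros s Hs.
  assert (Ht : tends (at_right 0) (fun h => (/ h [*] (f (s + h) [-] f s)) [-]
    (/ h [*] RInt g s (s + h))) (g s [-] g s)).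
  { apply tends_minus; auto; try apply at_right_proper_filter.
    apply RInt_right_tends with b; [lra|apply Hex; lra|].
    now apply cont_on_right with a b. }
  replace (g s [-] g s) with (zero : X) in Ht by vec.
  refine (tends_ext _ Ht).
  apply at_right_0; exists (b - s); split; [lra|]; intros h Hh.
  rewrite <- (RInt_minus_Chasles (a := a)) by (apply Hex; lra); vec. }
transitivity (f b [-] (f b [-] RInt g a b)); [vec|rewrite E; vec].
Qed.

(** Only the two ends of a sliding window contribute to the derivative of the integral. This one
    computation gives the generator on integrated orbits, on integrated iterates, and the limit of
    [beta] on integrated orbits. *)
Lemma RInt_shift_tends (f : R -> X) t :
  0 <= t -> cont_nonneg f ->
  tends (at_right 0)
    (fun h => / h [*] (RInt (fun s => f (s + h)) 0 t [-] RInt f 0 t))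
    (f t [-] f 0).
Proof.
intros Ht Hf.
assert (Hex : forall r s, 0 <= r -> 0 <= s -> ex_RInt f r s)
  by (intros; now apply ex_RInt_cont_nonneg).
assert (Hd : forall s, 0 <= s ->
  tends (at_right 0) (fun h => / h [*] RInt f s (s + h)) (f s)).
{ intros s Hs; apply RInt_right_tends with (s + 1); [lra|apply Hex; lra|].
  now apply cont_nonneg_right. }
apply (@tends_ext _ _ _ _ (fun h => (/ h [*] RInt f t (t + h)) [-] (/ h [*] RInt f 0 (0 + h)))).
- apply at_right_0; exists 1; split; [lra|]; intros h Hh.
  rewrite (is_RInt_unique (V := X) (fun s => f (s + h)) 0 t (RInt f (0 + h) (t + h))).
  + rewrite <- (RInt_minus_Chasles (a := 0) (b := 0 + h)) by (apply Hex; lra).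
    rewrite <- (RInt_minus_Chasles (a := 0) (b := t)) by (apply Hex; lra).
    vec.
  + apply is_RInt_shift, (RInt_correct (V := X)), Hex; lra.
- apply tends_minus; try apply at_right_proper_filter; apply Hd; lra.
Qed.

End Integration.

(** * Substochastic semigroups *)

(** [K] depends on [X] alone, so the bounds are uniform over families such as [T t] or the partial
    sums of the iterates. *)
Lemma cone_bounded_linear (X : abstract_state_space) :
  exists K : R, 0 < K /\ forall (Y : abstract_state_space) (T : X -> Y) (c : R),
    0 <= c -> (forall u v, T (u [-] v) = T u [-] T v) ->
    (forall u, cone u -> <|T u|> <= c * <|u|>) ->
    forall x, <|T x|> <= K * c * <|x|>.
Proof.
destruct (cone_decomposition X) as [M [HM Hd]].
exists (2 * M); split; [lra|]; intros Y T c Hc Hlin Hb x.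
destruct (Hd x) as [u [v [Hu [Hv [Hx [H1 H2]]]]]].
rewrite Hx at 1; rewrite Hlin.
apply Rle_trans with (1 := norm_minus_le _ _).
apply Rle_trans with (c * <|u|> + c * <|v|>).
- apply Rplus_le_compat; auto.
- apply Rmult_le_compat_l with (r := c) in H1; auto.
  apply Rmult_le_compat_l with (r := c) in H2; auto; lra.
Qed.

Section LinearMaps.

Variables (X Y : abstract_state_space) (L : X -> Y).
Hypothesis HL : is_linear L.

Lemma lin_plus x y : L (x [+] y) = L x [+] L y.
Proof. exact (linear_plus L HL x y). Qed.

Lemma lin_minus x y : L (x [-] y) = L x [-] L y.
Proof. exact (linear_minus L x y HL). Qed.

Lemma lin_scal (a : R) x : L (a [*] x) = a [*] L x.
Proof. exact (linear_scal L HL a x). Qed.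

Lemma lin_zero : L zero = zero.
Proof. exact (linear_zero L HL). Qed.

Lemma lin_vsum a n : L (vsum a n) = vsum (fun k => L (a k)) n.
Proof.
induction n as [|n IH]; simpl; [apply lin_zero|].
now rewrite lin_plus, IH.
Qed.

End LinearMaps.

(** The generator as a graph: it can be used for a semigroup for which no [operator] record has been
    chosen. *)
Definition gen (X : abstract_state_space) (T : R -> X -> X) (u w : X) : Prop :=
  tends (at_right 0) (fun h => / h [*] (T h u [-] u)) w.

Section Semigroup.

Variables (X : abstract_state_space) (T : R -> X -> X).
Hypothesis HT : substochastic T.

Lemma sg_lin t : 0 <= t -> is_linear (T t).
Proof. apply (C0_bounded (substochastic_C0 HT)). Qed.

Lemma sg_plus t u v : 0 <= t -> T t (u [+] v) = T t u [+] T t v.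
Proof. intros Ht; exact (lin_plus (sg_lin Ht) u v). Qed.

Lemma sg_minus t u v : 0 <= t -> T t (u [-] v) = T t u [-] T t v.
Proof. intros Ht; exact (lin_minus (sg_lin Ht) u v). Qed.

Lemma sg_scal t (a : R) u : 0 <= t -> T t (a [*] u) = a [*] T t u.
Proof. intros Ht; exact (lin_scal (sg_lin Ht) a u). Qed.

Lemma sg_add s t u : 0 <= s -> 0 <= t -> T (s + t) u = T s (T t u).
Proof. apply (C0_add (substochastic_C0 HT)). Qed.

Lemma sg_zero u : T 0 u = u.
Proof. apply (C0_zero (substochastic_C0 HT)). Qed.

Lemma sg_tends u : tends (at_right 0) (fun h => T h u) u.
Proof. constructor; exact (@C0_cont X T (substochastic_C0 HT) u). Qed.

Lemma sg_cone t u : 0 <= t -> cone u -> cone (T t u).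
Proof. intros Ht; exact (@substochastic_pos X T HT t Ht u). Qed.

Lemma sg_contr t u : 0 <= t -> cone u -> <|T t u|> <= <|u|>.
Proof. exact (@substochastic_contr X T HT t u). Qed.

Lemma sg_bounded : exists K, 0 < K /\ forall t x, 0 <= t -> <|T t x|> <= K * <|x|>.
Proof.
destruct (cone_bounded_linear X) as [K [HK H]]; exists K; split; auto.
intros t x Ht; rewrite <- (Rmult_1_r K); apply (H X (T t)); [lra| |].
- intros; apply lin_minus, sg_lin, Ht.
- intros u Hu; rewrite Rmult_1_l; now apply sg_contr.
Qed.

Lemma sg_cont u : cont_nonneg (fun t => T t u).
Proof.
destruct sg_bounded as [K [HK Hb]].
apply (cont_nonneg_modulus (g := fun h => K * <|T h u [-] u|>)).
- intros s h Hs Hh; rewrite sg_add, <- sg_minus by lra; now apply Hb.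
- tapply tends_zero_mult; tapply tends_norm_zero; apply sg_tends.
Qed.

Lemma sg_ex_RInt u a b : 0 <= a -> 0 <= b -> ex_RInt (fun s => T s u) a b.
Proof. intros Ha Hb; apply ex_RInt_cont_nonneg; auto; apply sg_cont. Qed.

Lemma sg_is_RInt u a b : 0 <= a -> 0 <= b ->
  is_RInt (fun s => T s u) a b (RInt (fun s => T s u) a b).
Proof. intros Ha Hb; apply (RInt_correct (V := X)), sg_ex_RInt; auto. Qed.

Lemma sg_RInt_cone u a b : 0 <= a <= b -> cone u -> cone (RInt (fun s => T s u) a b).
Proof.
intros Hab Hu; apply is_RInt_cone with (3 := @sg_is_RInt u a b ltac:(lra) ltac:(lra)); [lra|].
intros s Hs; apply sg_cone; auto; lra.
Qed.

Lemma gen_unique u w w' : gen T u w -> gen T u w' -> w = w'.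
Proof. tapply tends_unique. Qed.

Lemma gen_minus u v w z : gen T u w -> gen T v z -> gen T (u [-] v) (w [-] z).
Proof.
intros H1 H2; refine (tends_ext _ (tends_minus H1 H2)).
generalize at_right_pos; apply filter_imp; intros h Hh.
rewrite sg_minus by lra; vec.
Qed.

Lemma gen_plus u v w z : gen T u w -> gen T v z -> gen T (u [+] v) (w [+] z).
Proof.
intros H1 H2; refine (tends_ext _ (tends_plus H1 H2)).
generalize at_right_pos; apply filter_imp; intros h Hh.
rewrite sg_plus by lra; vec.
Qed.

Lemma gen_scal (a : R) u w : gen T u w -> gen T (a [*] u) (a [*] w).
Proof.
intros H.
refine (tends_ext _ (@tends_scal _ _ _ _ (fun _ => a) _ _ _ (tends_const a) H)).
generalize at_right_pos; apply filter_imp; intros h Hh.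
rewrite sg_scal by lra; vec.
Qed.

Lemma gen_integral u t : 0 <= t ->
  gen T (RInt (fun s => T s u) 0 t) (T t u [-] u).
Proof.
intros Ht; assert (H := RInt_shift_tends Ht (sg_cont u)).
cbv beta in H; rewrite (sg_zero u) in H; refine (tends_ext _ H).
generalize at_right_pos; apply filter_imp; intros h Hh.
f_equal; f_equal.
apply (is_RInt_unique (V := X)).
apply is_RInt_ext with (fun s => T h (T s u)).
- rewrite Rmin_left, Rmax_right by auto; intros s Hs; rewrite <- sg_add by lra.
  now rewrite Rplus_comm.
- apply is_RInt_linear; [apply sg_lin; lra|]; apply sg_is_RInt; lra.
Qed.

Lemma gen_orbit u w s : 0 <= s -> gen T u w ->
  tends (at_right 0) (fun h => / h [*] (T (s + h) u [-] T s u)) (T s w).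
Proof.
intros Hs H; refine (tends_ext _ (tends_linear (sg_lin Hs) H)).
generalize at_right_pos; apply filter_imp; intros h Hh.
rewrite sg_scal, sg_minus, sg_add by lra; auto.
Qed.

Lemma gen_invariant u w s : 0 <= s -> gen T u w -> gen T (T s u) (T s w).
Proof.
intros Hs H; refine (tends_ext _ (gen_orbit Hs H)).
generalize at_right_pos; apply filter_imp; intros h Hh.
rewrite Rplus_comm, sg_add by lra; auto.
Qed.

Lemma gen_FTC u w t : 0 <= t -> gen T u w ->
  is_RInt (fun s => T s w) 0 t (T t u [-] u).
Proof.
intros Ht H; rewrite <- (sg_zero u) at 2.
apply (is_RInt_right_derivative (f := fun s => T s u)); auto.
- apply cont_nonneg_on; [lra|apply sg_cont].
- apply cont_nonneg_on; [lra|apply sg_cont].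
- intros s Hs; apply gen_orbit; auto; lra.
Qed.

Lemma sg_mean_tends u :
  tends (at_right 0) (fun h => / h [*] RInt (fun s => T s u) 0 h) u.
Proof.
assert (H := @RInt_right_tends X (fun s => T s u) 0 1 Rlt_0_1
  (@sg_ex_RInt u 0 1 (Rle_refl 0) Rle_0_1) (cont_nonneg_right (Rle_refl 0) (sg_cont u))).
cbv beta in H; rewrite sg_zero in H.
refine (tends_ext _ H).
apply filter_forall; intros h; now rewrite Rplus_0_l.
Qed.

Lemma gen_of_integral u w :
  (forall t, 0 < t -> is_RInt (fun s => T s w) 0 t (T t u [-] u)) -> gen T u w.
Proof.
intros H; refine (tends_ext _ (sg_mean_tends w)).
generalize at_right_pos; apply filter_imp; intros h Hh.
f_equal; apply (is_RInt_unique (V := X)); auto.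
Qed.

(** The limit is taken in the integrated equation [gen_FTC], where the integrands converge uniformly
    on [[0,t]]; [gen_of_integral] then differentiates back. *)
Lemma gen_closed (u w : nat -> X) u0 w0 :
  (forall n, gen T (u n) (w n)) -> tends eventually u u0 -> tends eventually w w0 ->
  gen T u0 w0.
Proof.
intros Hg Hu Hw; destruct sg_bounded as [K [HK Hb]].
apply gen_of_integral; intros t Ht.
replace (T t u0 [-] u0) with (RInt (fun s => T s w0) 0 t).
{ apply sg_is_RInt; lra. }
apply (@tends_unique nat eventually _ X (fun n => T t (u n) [-] u n)).
- refine (tends_squeeze (g := fun n => (t - 0) * (K * <|w n [-] w0|>)) _ _).
  + exists 0%nat; intros n _.
    apply norm_is_RInt_const with (fun s => T s (w n) [-] T s w0); [lra| |].
    * intros s Hs; rewrite <- sg_minus by lra; apply Hb; lra.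
    * apply is_RInt_minus_vec; [apply gen_FTC; auto; lra|apply sg_is_RInt; lra].
  + do 2 tapply tends_zero_mult; now tapply tends_norm_zero.
- tapply tends_minus; auto.
  tapply tends_linear; auto; apply sg_lin; lra.
Qed.

End Semigroup.

(** * Exponential rescaling of a semigroup *)

Section Rescaling.

Variables (X : abstract_state_space) (T : R -> X -> X) (lam : R).
Hypothesis HT : substochastic T.
Hypothesis Hlam : 0 <= lam.

Definition rescaled (t : R) (x : X) : X := exp (- lam * t) [*] T t x.

Lemma exp_tends (c : R) : tends (at_right 0) (fun h => exp (c * h)) 1.
Proof.
assert (H : continuous (fun h => exp (c * h)) 0).
{ apply (ex_derive_continuous (V := R_NormedModule)); auto_derive; auto. }
unfold continuous in H; rewrite Rmult_0_r, exp_0 in H.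
constructor; intros P HP.
destruct (H P HP) as [d Hd]; exists d; intros y Hy _; now apply Hd.
Qed.

Lemma exp_deriv_tends (c : R) :
  tends (at_right 0) (fun h => / h * (exp (c * h) - 1)) c.
Proof.
tapply tends_real; intros eps He.
assert (H : derivable_pt_lim (fun h => exp (c * h)) 0 (c * exp (c * 0))).
{ apply is_derive_Reals; auto_derive; auto; ring. }
rewrite Rmult_0_r, exp_0, Rmult_1_r in H.
destruct (H eps He) as [d Hd].
apply at_right_0; exists d; split; [apply cond_pos|]; intros h Hh.
assert (H1 := Hd h); rewrite Rplus_0_l, Rmult_0_r, exp_0 in H1.
unfold Rdiv in H1; rewrite (Rmult_comm (/ h)); apply H1; [lra|].
rewrite Rabs_pos_eq; lra.
Qed.

Lemma rescaled_substochastic : substochastic rescaled.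
Proof.
constructor; [constructor| |]; unfold rescaled.
- intros t Ht.
  assert (HL := sg_lin HT Ht).
  destruct (linear_norm _ HL) as [M [HM Hb]].
  constructor.
  + intros x y; change (exp (- lam * t) [*] T t (x [+] y) =
      (exp (- lam * t) [*] T t x) [+] (exp (- lam * t) [*] T t y)).
    rewrite (lin_plus HL); vec.
  + intros k x; change (exp (- lam * t) [*] T t (k [*] x) =
      k [*] (exp (- lam * t) [*] T t x)).
    rewrite (lin_scal HL); vec.
  + exists (exp (- lam * t) * M); split.
    * apply Rmult_lt_0_compat; auto; apply exp_pos.
    * intros x; change (<|exp (- lam * t) [*] T t x|> <= exp (- lam * t) * M * <|x|>).
      rewrite norm_scal_pos by apply Rlt_le, exp_pos.
      rewrite Rmult_assoc; apply Rmult_le_compat_l; [apply Rlt_le, exp_pos|apply Hb].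
- intros u; rewrite Rmult_0_r, exp_0, (sg_zero HT); vec.
- intros s t u Hs Ht; rewrite (sg_add HT) by auto.
  rewrite (lin_scal (sg_lin HT Hs)), Rmult_plus_distr_l, exp_plus; vec.
- intros u.
  assert (H := tends_scal (exp_tends (- lam)) (sg_tends HT u)).
  replace (1 [*] u) with u in H by vec; exact (tends_filterlim H).
- intros t Ht u Hu; apply cone_scal; [apply Rlt_le, exp_pos|now apply sg_cone].
- intros t u Ht Hu; change (<|exp (- lam * t) [*] T t u|> <= <|u|>).
  rewrite norm_scal_pos by apply Rlt_le, exp_pos.
  assert (exp (- lam * t) <= 1).
  { rewrite <- exp_0; apply Rnot_lt_le; intros Hlt; apply exp_lt_inv in Hlt.
    assert (0 <= lam * t) by (apply Rmult_le_pos; auto); lra. }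
  assert (H1 := sg_contr HT Ht Hu); assert (H2 := vnorm_ge_0 (T t u)).
  assert (H3 := exp_pos (- lam * t)).
  apply Rle_trans with (1 * <|T t u|>); [apply Rmult_le_compat_r|]; lra.
Qed.

Lemma gen_rescaled u w : gen T u w -> gen rescaled u (w [-] (lam [*] u)).
Proof.
intros H.
assert (Ht := tends_plus (tends_scal (exp_tends (- lam)) H)
  (@tends_scal _ _ _ X _ (fun _ => u) _ _ (exp_deriv_tends (- lam)) (tends_const u))).
replace ((1 [*] w) [+] (- lam [*] u)) with (w [-] (lam [*] u)) in Ht by vec.
refine (tends_ext _ Ht).
apply filter_forall; intros h; unfold rescaled; vec.
Qed.

Lemma gen_unscaled u z : gen rescaled u z -> gen T u (z [+] (lam [*] u)).
Proof.
intros H.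
assert (Ht := tends_scal (exp_tends lam) (tends_minus H
  (@tends_scal _ _ _ X _ (fun _ => u) _ _ (exp_deriv_tends (- lam)) (tends_const u)))).
replace (1 [*] (z [-] (- lam [*] u))) with (z [+] (lam [*] u)) in Ht by vec.
refine (tends_ext _ Ht).
apply filter_forall; intros h; unfold rescaled.
assert (E : exp (lam * h) * exp (- lam * h) = 1).
{ rewrite <- exp_plus, <- exp_0; f_equal; ring. }
transitivity ((exp (lam * h) * exp (- lam * h)) [*] (/ h [*] (T h u [-] u))).
- vec.
- rewrite E; vec.
Qed.

End Rescaling.

(** * Positive decomposition inside the domain of a generator *)

Lemma iter_half_fixed (X : abstract_state_space) (Q : X -> X) (d : X) :
  is_linear Q -> (forall u, cone u -> cone (Q u)) ->
  (forall u, cone u -> <|Q u|> <= / 2 * <|u|>) -> Q d = d -> d = zero.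
Proof.
intros HL Hpos Hhalf Hd.
destruct (cone_generating d) as [p [q [Hp [Hq Hpq]]]].
(* [Q] contracts on the cone only, so the iteration acts on the two positive parts of [d] rather
   than on [d]. *)
assert (Hit : forall n, exists p' q', cone p' /\ cone q' /\ d = p' [-] q' /\
  <|p'|> + <|q'|> <= (<|p|> + <|q|>) * (/ 2) ^ n).
{ induction n as [|n [p' [q' [Hp' [Hq' [Hd' Hn]]]]]].
  - exists p, q; repeat split; auto; simpl; lra.
  - exists (Q p'), (Q q'); repeat split; auto.
    + rewrite <- Hd, Hd' at 1; apply (lin_minus HL).
    + generalize (Hhalf p' Hp'), (Hhalf q' Hq'); simpl; lra. }
apply vnorm_eq_zero, Rle_antisym; [|apply vnorm_ge_0].
tapply (@tends_ge_const nat eventually _ (fun n => (<|p|> + <|q|>) * (/ 2) ^ n)).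
- exists 0%nat; intros n _; destruct (Hit n) as [p' [q' [_ [_ [-> Hn]]]]].
  apply Rle_trans with (1 := norm_minus_le _ _); auto.
- apply tends_half_pow.
Qed.

Lemma neumann_half (X : abstract_state_space) (Q : X -> X) (y : X) :
  is_linear Q -> (forall u, cone u -> cone (Q u)) ->
  (forall u, cone u -> <|Q u|> <= / 2 * <|u|>) -> cone y ->
  exists z, cone z /\ <|z|> <= 2 * <|y|> /\ z = y [+] Q z.
Proof.
intros HL Hpos Hhalf Hy.
set (a n := Nat.iter n Q y).
assert (Ha : forall n, cone (a n)) by (induction n; simpl; auto).
(* The term [2 * <|a n|>] makes the geometric bound inductive: it majorizes the sum of all remaining
   norms. *)
assert (Hs : forall n, <|vsum a n|> <= 2 * <|y|> - 2 * <|a n|>).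
{ induction n as [|n IH]; simpl; [rewrite vnorm_zero; lra|].
  generalize (vnorm_triangle (vsum a n) (a n)), (Hhalf (a n) (Ha n)).
  fold (a n); lra. }
destruct (@cone_monotone_cv X (vsum a) (2 * <|y|>)) as [z Hz].
- apply cone_zero.
- intros n; rewrite vsum_step; auto.
- intros n; generalize (Hs n), (vnorm_ge_0 (a n)); lra.
- exists z; repeat split.
  + tapply (@tends_cone X _ eventually _ (vsum a)); auto.
    exists 0%nat; intros; apply vsum_cone; auto.
  + apply (@tends_le_const nat eventually _ (fun n => <|vsum a n|>)).
    * exists 0%nat; intros n _; generalize (Hs n), (vnorm_ge_0 (a n)); lra.
    * now apply tends_norm_real.
  + tapply (@tends_unique nat eventually _ X (fun n => vsum a (S n))).
    * apply (proj2 (tends_seq _ _)); intros eps He.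
      destruct (proj1 (tends_seq _ _) Hz eps He) as [N HN].
      exists N; intros n Hn; apply HN; lia.
    * tapply (@tends_ext _ _ _ X (fun n => y [+] Q (vsum a n))).
      -- exists 0%nat; intros n _; rewrite vsum_shift, (lin_vsum HL); reflexivity.
      -- tapply tends_plus; [tapply tends_const|]; now apply tends_linear.
Qed.

(** The resolvent at [lam] is J (1 - Q)^(-1), where J integrates the rescaled semigroup over [0,1]
    and Q is its value at time 1; no improper integral is involved. It is positive, so splitting
    [lam u - w] into positive parts splits [u] within the domain, with norms controlled by the graph
    norm of [u]. *)
Lemma gen_positive_decomposition (X : abstract_state_space) (T : R -> X -> X) :
  substochastic T ->
  exists C, 0 < C /\ forall u w, gen T u w -> exists u1 u2 w1 w2,
    cone u1 /\ cone u2 /\ gen T u1 w1 /\ gen T u2 w2 /\ u = u1 [-] u2 /\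
    (<|u1|> <= C * (<|u|> + <|w|>) /\ <|u2|> <= C * (<|u|> + <|w|>)) /\
    (<|w1|> <= C * (<|u|> + <|w|>) /\ <|w2|> <= C * (<|u|> + <|w|>)).
Proof.
(* This rate makes [Q] halve norms on the cone. *)
intros HT; set (lam := ln 2).
assert (Hlam : 0 <= lam) by (apply Rlt_le; unfold lam; rewrite <- ln_1; apply ln_increasing; lra).
assert (HQT := rescaled_substochastic HT Hlam).
set (QT := rescaled T lam) in *; set (Q := QT 1).
assert (HL : is_linear Q) by (apply (sg_lin HQT); lra).
assert (Hpos : forall u, cone u -> cone (Q u)) by (intros; apply (sg_cone HQT); auto; lra).
assert (Hhalf : forall u, cone u -> <|Q u|> <= / 2 * <|u|>).
{ intros u Hu; unfold Q, QT, rescaled.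
  replace (exp (- lam * 1)) with (/ 2)
    by (rewrite Rmult_1_r, exp_Ropp; unfold lam; rewrite exp_ln; lra).
  rewrite norm_scal_pos by lra; apply Rmult_le_compat_l; [lra|].
  apply (sg_contr HT); auto; lra. }
set (J x := RInt (fun s => QT s x) 0 1).
assert (HJ : forall x, is_RInt (fun s => QT s x) 0 1 (J x))
  by (intros x; apply (sg_is_RInt HQT); lra).
assert (HJm : forall x y, J (x [-] y) = J x [-] J y).
{ intros x y; apply (is_RInt_unique (V := X)).
  apply is_RInt_ext with (fun s => QT s x [-] QT s y).
  - rewrite Rmin_left, Rmax_right by lra; intros s Hs.
    rewrite (sg_minus HQT) by lra; auto.
  - now apply is_RInt_minus_vec. }
assert (HJQ : forall x, J (Q x) = Q (J x)).
{ intros x; apply (is_RInt_unique (V := X)).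
  apply is_RInt_ext with (fun s => Q (QT s x)).
  - rewrite Rmin_left, Rmax_right by lra; intros s Hs; unfold Q.
    rewrite <- !(sg_add HQT) by lra; f_equal; ring.
  - now apply is_RInt_linear. }
destruct (cone_decomposition X) as [M [HM Hdec]].
exists (M * (1 + lam) * (2 + 2 * lam)); split.
{ repeat apply Rmult_lt_0_compat; lra. }
intros u w Hg.
set (y := [-] (w [-] (lam [*] u))).
assert (Hy : <|y|> <= (1 + lam) * (<|u|> + <|w|>)).
{ unfold y; rewrite vnorm_opp; apply Rle_trans with (1 := norm_minus_le _ _).
  rewrite norm_scal_pos by lra.
  assert (0 <= lam * <|w|>) by (apply Rmult_le_pos; [lra|apply vnorm_ge_0]).
  generalize (vnorm_ge_0 u); lra. }
assert (HJy : J y = u [-] Q u).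
{ assert (H := gen_FTC HQT Rle_0_1 (gen_rescaled lam Hg)).
  apply (is_RInt_unique (V := X)).
  apply is_RInt_ext with (fun s => [-] QT s (w [-] (lam [*] u))).
  - rewrite Rmin_left, Rmax_right by lra; intros s Hs; unfold y.
    replace ([-] (w [-] (lam [*] u))) with ((-1) [*] (w [-] (lam [*] u))) by vec.
    rewrite (sg_scal HQT) by lra; vec.
  - replace (u [-] Q u) with ([-] (Q u [-] u)) by vec.
    exact (is_RInt_opp (V := X) _ _ _ _ H). }
destruct (Hdec y) as [y1 [y2 [Hy1 [Hy2 [Hy12 [Hn1 Hn2]]]]]].
destruct (neumann_half HL Hpos Hhalf Hy1) as [z1 [Hz1 [Hzn1 Hzy1]]].
destruct (neumann_half HL Hpos Hhalf Hy2) as [z2 [Hz2 [Hzn2 Hzy2]]].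
assert (Hbd : forall yi zi, <|yi|> <= M * <|y|> -> <|zi|> <= 2 * <|yi|> ->
  cone zi -> zi = yi [+] Q zi ->
  cone (J zi) /\ gen T (J zi) ((lam [*] J zi) [-] yi) /\
  <|J zi|> <= M * (1 + lam) * (2 + 2 * lam) * (<|u|> + <|w|>) /\
  <|(lam [*] J zi) [-] yi|> <= M * (1 + lam) * (2 + 2 * lam) * (<|u|> + <|w|>)).
{ intros yi zi H1 H2 H3 H4.
  assert (HJn : <|J zi|> <= 2 * <|yi|>).
  { apply Rle_trans with ((1 - 0) * <|zi|>); [|lra].
    apply norm_is_RInt_const with (3 := HJ zi); [lra|].
    intros s Hs; apply (sg_contr HQT); auto; lra. }
  assert (Hyi : <|yi|> <= M * (1 + lam) * (<|u|> + <|w|>)).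
  { apply Rle_trans with (1 := H1); rewrite Rmult_assoc; apply Rmult_le_compat_l; lra. }
  assert (0 <= lam * <|yi|>) by (apply Rmult_le_pos; [lra|apply vnorm_ge_0]).
  assert (H0 := vnorm_ge_0 yi).
  assert (Hfin : (2 + 2 * lam) * <|yi|> <= M * (1 + lam) * (2 + 2 * lam) * (<|u|> + <|w|>)).
  { replace (M * (1 + lam) * (2 + 2 * lam) * (<|u|> + <|w|>)) with
      ((2 + 2 * lam) * (M * (1 + lam) * (<|u|> + <|w|>))) by ring.
    apply Rmult_le_compat_l; lra. }
  split; [|split; [|split]].
  - apply (sg_RInt_cone HQT); auto; lra.
  - assert (H5 := gen_unscaled (gen_integral HQT zi Rle_0_1)).
    fold Q in H5; fold (J zi) in H5.
    replace ((lam [*] J zi) [-] yi) with ((Q zi [-] zi) [+] (lam [*] J zi)); auto.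
    rewrite H4 at 2; vec.
  - lra.
  - apply Rle_trans with (1 := norm_minus_le _ _); rewrite norm_scal_pos by lra.
    apply Rmult_le_compat_l with (r := lam) in HJn; lra. }
destruct (Hbd y1 z1) as [Hc1 [Hg1 [Hu1 Hw1]]]; auto.
destruct (Hbd y2 z2) as [Hc2 [Hg2 [Hu2 Hw2]]]; auto.
exists (J z1), (J z2), ((lam [*] J z1) [-] y1), ((lam [*] J z2) [-] y2).
repeat (split; auto).
assert (HQJ1 : Q (J z1) = J z1 [-] J y1).
{ rewrite <- HJQ, <- HJm; f_equal; rewrite Hzy1 at 2; vec. }
assert (HQJ2 : Q (J z2) = J z2 [-] J y2).
{ rewrite <- HJQ, <- HJm; f_equal; rewrite Hzy2 at 2; vec. }
(* The difference between [u] and the candidate is fixed by [Q], since [J] takes the value J y1 - J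
   y2 at [y]. *)
apply minus_zero_eq, (iter_half_fixed HL Hpos Hhalf).
rewrite !(lin_minus HL), HQJ1, HQJ2.
replace (Q u) with (u [-] J y) by (rewrite HJy; vec).
rewrite Hy12, HJm; vec.
Qed.

(** * Cauchy products of positive series of maps and vectors *)

Section CauchyProduct.

Variables X Y : abstract_state_space.
Variables (L : nat -> X -> Y) (Lsum : X -> Y).
Hypothesis L_minus : forall k x y, L k (x [-] y) = L k x [-] L k y.
Hypothesis L_cone : forall k x, cone x -> cone (L k x).
Hypothesis L_tends : forall x, cone x -> tends eventually (vsum (fun k => L k x)) (Lsum x).
Variable c : R.
Hypothesis c_pos : 0 <= c.
Hypothesis Lsum_bound : forall x, cone x -> <|Lsum x|> <= c * <|x|>.

Lemma conv_map_plus k x y : L k (x [+] y) = L k x [+] L k y.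
Proof.
replace x with ((x [+] y) [-] y) at 2 by vec; rewrite L_minus; vec.
Qed.

Definition conv (v : nat -> X) (n : nat) : Y :=
  vsum (fun k => L k (v (n - k)%nat)) (S n).

Lemma vsum_conv v n :
  vsum (conv v) n = vsum (fun k => L k (vsum v (n - k))) n.
Proof.
induction n as [|n IH]; [reflexivity|].
rewrite (@vsum_ext _ (fun k => L k (vsum v (S n - k)))
  (fun k => L k (vsum v (n - k)) [+] L k (v (n - k)%nat))).
- rewrite vsum_plus.
  transitivity (vsum (conv v) n [+] conv v n); [reflexivity|].
  rewrite IH; unfold conv; f_equal; simpl.
  replace (n - n)%nat with 0%nat by lia; simpl.
  replace (L n zero) with (L n (zero [-] zero)) by (f_equal; vec).
  rewrite L_minus; vec.
- intros k Hk; rewrite Nat.sub_succ_l by lia; simpl; apply conv_map_plus.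
Qed.

(* The triangle of indices of the convolution lies between two squares. *)
Lemma cauchy_product v y :
  (forall k, cone (v k)) -> tends eventually (vsum v) y ->
  tends eventually (vsum (conv v)) (Lsum y).
Proof.
intros Hv Hy.
assert (Hvs : forall n, cone (vsum v n)) by (intros n; apply vsum_cone; auto).
assert (Hyc : cone y).
{ tapply (@tends_cone X _ eventually _ (vsum v)); auto; now exists 0%nat. }
assert (Hyv : forall n, cone (y [-] vsum v n)).
{ intros n; tapply (@tends_cone X _ eventually _ (fun m => vsum v m [-] vsum v n)).
  - exists n; intros m Hm; now apply vsum_cone_le.
  - tapply tends_minus; auto; tapply tends_const. }
assert (Hconv : forall n, cone (conv v n)).
{ intros n; apply vsum_cone; intros; apply L_cone; auto. }
set (P n x := vsum (fun k => L k x) n).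
assert (Pm : forall n x z, P n (x [-] z) = P n x [-] P n z).
{ intros n x z; unfold P; rewrite <- vsum_minus; apply vsum_ext; intros; apply L_minus. }
(* The square sums converge: by positivity [P n] is dominated by [Lsum] on the remainder [y [-] vsum
   v n], which lies in the cone and tends to zero. *)
assert (Hcv : tends eventually (fun n => P n (vsum v n)) (Lsum y)).
{ refine (tends_squeeze (g := fun n => c * <|vsum v n [-] y|> + <|P n y [-] Lsum y|>) _ _).
  - exists 0%nat; intros n _.
    apply Rle_trans with (1 := norm_minus_trans (P n y) _ _).
    apply Rplus_le_compat_r.
    rewrite norm_minus_sym, <- Pm, (norm_minus_sym (vsum v n)).
    apply Rle_trans with (<|Lsum (y [-] vsum v n)|>); auto.
    tapply (@tends_ge_const nat eventually _ (fun m => <|P m (y [-] vsum v n)|>)).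
    + exists n; intros m Hm; apply cone_norm_le.
      * apply vsum_cone; auto.
      * apply vsum_cone_le; auto.
    + tapply tends_norm_real; apply L_tends; auto.
  - tapply tends_zero_plus; [tapply tends_zero_mult|]; tapply tends_norm_zero; auto.
    now apply L_tends. }
assert (Hup : forall n, cone (P n (vsum v n) [-] vsum (conv v) n)).
{ intros n; rewrite vsum_conv; unfold P; rewrite <- vsum_minus.
  apply vsum_cone; intros k Hk; rewrite <- L_minus; apply L_cone.
  apply vsum_cone_le; auto; lia. }
assert (Hlow : forall n, cone (vsum (conv v) (n + n) [-] P n (vsum v n))).
{ intros n; rewrite vsum_conv; unfold P.
  apply cone_trans with (vsum (fun k => L k (vsum v (n + n - k))) n).
  - rewrite <- vsum_minus.
    apply vsum_cone; intros k Hk; rewrite <- L_minus; apply L_cone.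
    apply vsum_cone_le; auto; lia.
  - apply vsum_cone_le; [|lia].
    intros k; apply L_cone; auto. }
assert (Hb : forall n, <|P n (vsum v n)|> <= c * <|y|>).
{ intros n.
  apply Rle_trans with (<|Lsum (vsum v n)|>).
  - tapply (@tends_ge_const nat eventually _ (fun m => <|P m (vsum v n)|>)).
    + exists n; intros m Hm; apply cone_norm_le.
      * apply vsum_cone; auto.
      * apply vsum_cone_le; auto.
    + tapply tends_norm_real; apply L_tends; auto.
  - apply Rle_trans with (1 := Lsum_bound (Hvs n)).
    apply Rmult_le_compat_l; auto; apply cone_norm_le; auto. }
destruct (@cone_monotone_cv Y (vsum (conv v)) (c * <|y|>)) as [l Hl].
- apply cone_zero.
- intros n; rewrite vsum_step; auto.
- intros n; apply Rle_trans with (2 := Hb n); apply cone_norm_le; auto.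
  apply vsum_cone; auto.
- replace (Lsum y) with l; auto.
  assert (Hl2 : tends eventually (fun n => vsum (conv v) (n + n)) l).
  { apply (proj2 (tends_seq _ _)); intros eps He.
    destruct (proj1 (tends_seq _ _) Hl eps He) as [N HN].
    exists N; intros n Hn; apply HN; lia. }
  apply cone_antisym.
  + tapply (@tends_cone Y _ eventually _ (fun n => P n (vsum v n) [-] vsum (conv v) n)).
    * exists 0%nat; auto.
    * tapply tends_minus; auto.
  + tapply (@tends_cone Y _ eventually _ (fun n => vsum (conv v) (n + n) [-] P n (vsum v n))).
    * exists 0%nat; auto.
    * tapply tends_minus; auto.
Qed.

End CauchyProduct.

(** * Weak topology *)

Section WeakTopology.

Variable X : abstract_state_space.

Lemma weak_nbhd_self (x : X) P : weak_nbhd x P -> P x.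
Proof.
intros [fs [eps [He [_ H]]]]; apply H; intros f _.
now rewrite Rminus_diag, Rabs_R0.
Qed.

Lemma weak_open_indistinct (O : X -> Prop) x y :
  weak_open O -> O x -> (forall f, functional f -> f y = f x) -> O y.
Proof.
intros HO Hx Heq; destruct (HO x Hx) as [fs [eps [He [Hfs H]]]].
apply H; intros f Hf; rewrite Heq, Rminus_diag, Rabs_R0 by auto; auto.
Qed.

Lemma weak_nbhd_eventually (x : nat -> X) y P :
  tends eventually x y -> weak_nbhd y P -> exists N, forall n, (N <= n)%nat -> P (x n).
Proof.
intros Hx [fs [eps [He [Hfs H]]]].
assert (Hev : exists N, forall n, (N <= n)%nat -> forall f, In f fs ->
  Rabs (f (x n) - f y) < eps).
{ clear H; induction fs as [|f fs IH]; [exists 0%nat; simpl; tauto|].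
  destruct IH as [N1 HN1]; [intros; apply Hfs; now right|].
  assert (Hf : functional f) by (apply Hfs; now left).
  destruct (proj1 (tends_seq _ _)
    (tends_linear (Y := R_state_space) Hf Hx) eps He) as [N2 HN2].
  exists (N1 + N2)%nat; intros n Hn g [<-|Hg].
  - apply HN2; lia.
  - apply HN1; auto; lia. }
destruct Hev as [N HN]; exists N; intros n Hn; apply H; auto.
Qed.

(* Points of the weak closure cannot be told apart from a term of the sequence
   or from its limit; this replaces the Hausdorff property, which would
   require the Hahn-Banach theorem. *)
Lemma weak_closure_null_sequence (x : nat -> X) z :
  tends eventually x zero -> weak_closure (fun y => exists n, y = x n) z ->
  (forall f, functional f -> f z = f zero) \/
  exists n, forall f, functional f -> f z = f (x n).
Proof.
intros Hx Hz; apply NNPP; intros Hno.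
assert (H0 : exists f, functional f /\ f z <> f zero).
{ apply NNPP; intros H; apply Hno; left; intros f Hf.
  apply NNPP; intros Hne; apply H; now exists f. }
assert (Hn : forall n, exists f, functional f /\ f z <> f (x n)).
{ intros n; apply NNPP; intros H; apply Hno; right; exists n; intros f Hf.
  apply NNPP; intros Hne; apply H; now exists f. }
destruct H0 as [f0 [Hf0 Hne0]].
assert (Hd0 : 0 < Rabs (f0 z - f0 zero) / 2).
{ assert (0 < Rabs (f0 z - f0 zero)) by (apply Rabs_pos_lt; lra); lra. }
destruct (proj1 (tends_seq _ _)
  (tends_linear (Y := R_state_space) Hf0 Hx) _ Hd0) as [N HN].
(* Finitely many functionals keep [z] away from the first [m] terms; [f0] alone will keep it away
   from all later ones, whose values are close to that at zero. *)
assert (Hsep : forall m, exists fs eps, 0 < eps /\ (forall f, In f fs -> functional f) /\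
  forall n, (n < m)%nat -> exists f, In f fs /\ eps <= Rabs (f (x n) - f z)).
{ induction m as [|m [fs [eps [He [Hfs Hm]]]]].
  - exists nil, 1; split; [lra|split; [simpl; tauto|intros; lia]].
  - destruct (Hn m) as [f [Hf Hfm]].
    assert (Hp : 0 < Rabs (f (x m) - f z)) by (apply Rabs_pos_lt; lra).
    exists (f :: fs)%list, (Rmin eps (Rabs (f (x m) - f z))); split; [now apply Rmin_glb_lt|].
    split; [intros g [<-|Hg]; auto|].
    intros n Hnm; destruct (Nat.eq_dec n m) as [->|Hnm'].
    + exists f; split; [now left|apply Rmin_r].
    + destruct (Hm n) as [g [Hg1 Hg2]]; [lia|].
      exists g; split; [now right|apply Rle_trans with (2 := Hg2), Rmin_l]. }
destruct (Hsep N) as [fs [eps [He [Hfs HmN]]]].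
set (e := Rmin eps (Rabs (f0 z - f0 zero) / 2)).
destruct (Hz (fun y => forall f, In f (f0 :: fs)%list -> Rabs (f y - f z) < e))
  as [y [Hy [n ->]]].
{ exists (f0 :: fs)%list, e; split; [now apply Rmin_glb_lt|].
  split; [intros g [<-|Hg]; auto|auto]. }
destruct (Nat.lt_ge_cases n N) as [Hlt|Hge].
- destruct (HmN n Hlt) as [f [Hf1 Hf2]].
  assert (H := Hy f (or_intror Hf1)); assert (H' := Rmin_l eps (Rabs (f0 z - f0 zero) / 2)).
  unfold e in H; lra.
- assert (H := Hy f0 (or_introl eq_refl)).
  assert (H' := Rmin_r eps (Rabs (f0 z - f0 zero) / 2)); fold e in H'.
  assert (H'' : Rabs (f0 (x n) - f0 zero) < Rabs (f0 z - f0 zero) / 2) by (apply HN; auto).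
  assert (Htri := Rabs_triang (f0 z - f0 (x n)) (f0 (x n) - f0 zero)).
  replace (f0 z - f0 (x n) + (f0 (x n) - f0 zero)) with (f0 z - f0 zero) in Htri by ring.
  rewrite (Rabs_minus_sym (f0 z) (f0 (x n))) in Htri; lra.
Qed.

(** A member of the cover around zero catches all but finitely many terms, and every other point of
    the weak closure lies in the same weakly open sets as zero or as some term. *)
Lemma null_sequence_weakly_compact (x : nat -> X) :
  tends eventually x zero -> relatively_weakly_compact (fun y => exists n, y = x n).
Proof.
intros Hx C HO Hcov.
assert (H0 : weak_closure (fun y => exists n, y = x n) (zero : X)).
{ intros P HP; destruct (weak_nbhd_eventually Hx HP) as [N HN].
  exists (x N); split; [now apply HN|now exists N]. }
assert (Hn : forall n, weak_closure (fun y => exists n, y = x n) (x n)).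
{ intros n P HP; exists (x n); split; [now apply weak_nbhd_self|now exists n]. }
destruct (Hcov _ H0) as [O0 [HC0 HO0]].
destruct (weak_nbhd_eventually Hx (HO O0 HC0 _ HO0)) as [N HN].
assert (Hfin : forall m, exists l, (forall O, In O l -> C O) /\
  forall n, (n < m)%nat -> exists O, In O l /\ O (x n)).
{ induction m as [|m [l [Hl Hm]]].
  - exists nil; split; [simpl; tauto|intros; lia].
  - destruct (Hcov _ (Hn m)) as [O [HC Hxm]].
    exists (O :: l)%list; split; [intros O' [<-|H]; auto|].
    intros n Hnm; destruct (Nat.eq_dec n m) as [->|Hne].
    + exists O; split; [now left|auto].
    + destruct (Hm n) as [O' [H1 H2]]; [lia|exists O'; split; [now right|auto]]. }
destruct (Hfin N) as [l [Hl HlN]].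
exists (O0 :: l)%list; split; [intros O [<-|H]; auto|].
intros z Hz; destruct (weak_closure_null_sequence Hx Hz) as [Hz0|[n Hzn]].
- exists O0; split; [now left|].
  apply weak_open_indistinct with (zero : X); auto.
- destruct (Nat.lt_ge_cases n N) as [Hlt|Hge].
  + destruct (HlN n Hlt) as [O [H1 H2]]; exists O; split; [now right|].
    apply weak_open_indistinct with (x n); auto.
  + exists O0; split; [now left|].
    apply weak_open_indistinct with (x n); auto.
Qed.

(** Without a cluster point, the weakly open sets that miss a tail of the sequence cover the weak
    closure; a finite subcover would then miss some [x N]. *)
Lemma weak_cluster_point (x : nat -> X) :
  relatively_weakly_compact (fun y => exists n, y = x n) ->
  exists y, forall P, weak_nbhd y P -> forall N, exists n, (N <= n)%nat /\ P (x n).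
Proof.
intros Hcpt; apply NNPP; intros Hno.
set (C (O : X -> Prop) := weak_open O /\ exists N, forall n, (N <= n)%nat -> ~ O (x n)).
destruct (Hcpt C) as [l [Hl Hcov]].
- intros O [HO _]; auto.
- intros y _.
  assert (Hy : exists P, weak_nbhd y P /\ exists N, forall n, (N <= n)%nat -> ~ P (x n)).
  { apply NNPP; intros H; apply Hno; exists y; intros P HP N.
    apply NNPP; intros H'; apply H; exists P; split; auto.
    exists N; intros n Hn HPn; apply H'; now exists n. }
  destruct Hy as [P [[fs [eps [He [Hfs HP]]]] [N HN]]].
  (* Covers consist of open sets, so the neighbourhood [P] is shrunk to a basic one; that it is
     weakly open uses the slack [d] left by finitely many strict inequalities. *)
  exists (fun z => forall f, In f fs -> Rabs (f z - f y) < eps); split.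
  + split.
    * intros z Hz; clear HP HN.
      assert (Hd : exists d, 0 < d /\ forall f, In f fs -> Rabs (f z - f y) + d <= eps).
      { clear Hfs; induction fs as [|f fs IH].
        - exists 1; split; [lra|simpl; tauto].
        - destruct IH as [d [Hd H]]; [intros; apply Hz; now right|].
          assert (Hf := Hz f (or_introl eq_refl)).
          exists (Rmin d (eps - Rabs (f z - f y))); split; [apply Rmin_glb_lt; lra|].
          intros g [<-|Hg].
          + generalize (Rmin_r d (eps - Rabs (f z - f y))); lra.
          + generalize (Rmin_l d (eps - Rabs (f z - f y))), (H g Hg); lra. }
      destruct Hd as [d [Hd H]].
      exists fs, d; split; auto; split; auto.
      intros w Hw f Hf; assert (H1 := Hw f Hf); assert (H2 := H f Hf).
      assert (H3 := Rabs_triang (f w - f z) (f z - f y)).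
      replace (f w - f z + (f z - f y)) with (f w - f y) in H3 by ring; lra.
    * exists N; intros n Hn Hxn; apply (HN n Hn); apply HP; auto.
  + intros f _; rewrite Rminus_diag, Rabs_R0; auto.
- assert (HN : exists N, forall O, In O l -> forall n, (N <= n)%nat -> ~ O (x n)).
  { clear Hcov; induction l as [|O l IH]; [exists 0%nat; simpl; tauto|].
    destruct IH as [N1 H1]; [intros; apply Hl; now right|].
    destruct (Hl O (or_introl eq_refl)) as [_ [N2 H2]].
    exists (N1 + N2)%nat; intros O' [<-|HO'] n Hn.
    - apply H2; lia.
    - apply H1; auto; lia. }
  destruct HN as [N HN].
  destruct (Hcov (x N)) as [O [HO HxN]].
  + intros P HP; exists (x N); split; [now apply weak_nbhd_self|now exists N].
  + apply (HN O HO N); auto.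
Qed.

End WeakTopology.

(** * Dyson-Phillips iterates and the minimal semigroup *)

Section DysonPhillips.

Variables (X : abstract_state_space) (Psi : X -> R).
Hypothesis hPsi : norm_functional Psi.
Variables (U : R -> X -> X) (A : operator X).
Hypotheses (hU : substochastic U) (hA : is_generator U A).
Variable B : X -> X.
Hypothesis hB_lin : linear_on (dom A) B.
Hypothesis hB_pos : positive_on (dom A) B.
Hypothesis hAB : forall u, dom A u -> cone u -> Psi (plus (A u) (B u)) <= 0.

(** * The domain of [A] and the relative boundedness of [B] *)

Lemma Psi_lin : is_linear (Psi : X -> R_state_space).
Proof. exact (proj1 hPsi). Qed.

Lemma Psi_cone u : cone u -> Psi u = <|u|>.
Proof. apply (proj2 hPsi). Qed.

Lemma Psi_minus u v : Psi (u [-] v) = Psi u - Psi v.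
Proof. exact (lin_minus Psi_lin u v). Qed.

Lemma Psi_plus u v : Psi (u [+] v) = Psi u + Psi v.
Proof. exact (lin_plus Psi_lin u v). Qed.

Lemma Psi_scal (a : R) u : Psi (a [*] u) = a * Psi u.
Proof. exact (lin_scal Psi_lin a u). Qed.

Lemma Psi_bounded : exists K, 0 < K /\ forall x, Rabs (Psi x) <= K * <|x|>.
Proof. exact (linear_norm _ Psi_lin). Qed.

Lemma gen_dom u w : gen U u w -> dom A u /\ A u = w.
Proof. intros [H]; apply hA, H. Qed.

Lemma dom_gen u : dom A u -> gen U u (A u).
Proof. intros H; constructor; now apply hA. Qed.

Lemma dom_plus u v : dom A u -> dom A v ->
  dom A (u [+] v) /\ A (u [+] v) = A u [+] A v.
Proof. intros Hu Hv; apply gen_dom, gen_plus; auto; now apply dom_gen. Qed.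

Lemma dom_minus u v : dom A u -> dom A v ->
  dom A (u [-] v) /\ A (u [-] v) = A u [-] A v.
Proof. intros Hu Hv; apply gen_dom, gen_minus; auto; now apply dom_gen. Qed.

Lemma dom_scal (a : R) u : dom A u ->
  dom A (a [*] u) /\ A (a [*] u) = a [*] A u.
Proof. intros Hu; apply gen_dom, gen_scal; auto; now apply dom_gen. Qed.

Lemma B_plus u v : dom A u -> dom A v -> B (u [+] v) = B u [+] B v.
Proof. apply (proj1 hB_lin). Qed.

Lemma B_scal (a : R) u : dom A u -> B (a [*] u) = a [*] B u.
Proof. apply (proj2 hB_lin). Qed.

Lemma B_minus u v : dom A u -> dom A v -> B (u [-] v) = B u [-] B v.
Proof.
intros Hu Hv; replace (u [-] v) with (u [+] ((-1) [*] v)) by vec.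
rewrite B_plus, B_scal; auto; [vec|apply dom_scal; auto].
Qed.

Lemma B_norm_cone u : dom A u -> cone u -> <|B u|> <= - Psi (A u).
Proof.
intros Hu Hc; rewrite <- Psi_cone by (now apply hB_pos).
assert (H := hAB Hu Hc); rewrite Psi_plus in H; lra.
Qed.

(** On positive elements of the domain the sign condition bounds [<|B u|>] by [- Psi (A u)]. The
    general case needs a decomposition in which the images under [A] of both parts stay bounded by
    the graph norm. *)
Lemma B_bounded : exists C, 0 < C /\
  forall u, dom A u -> <|B u|> <= C * (<|u|> + <|A u|>).
Proof.
destruct Psi_bounded as [K [HK HPsi]].
destruct (gen_positive_decomposition hU) as [C [HC Hd]].
exists (2 * K * C); split; [repeat apply Rmult_lt_0_compat; lra|].
intros u Hu.
destruct (Hd u (A u) (dom_gen Hu))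
  as [u1 [u2 [w1 [w2 [Hc1 [Hc2 [Hg1 [Hg2 [Hu12 [_ [Hw1 Hw2]]]]]]]]]]].
destruct (gen_dom Hg1) as [Hd1 Ha1]; destruct (gen_dom Hg2) as [Hd2 Ha2].
assert (Hle : forall v w, dom A v -> cone v -> A v = w ->
  <|w|> <= C * (<|u|> + <|A u|>) -> <|B v|> <= K * C * (<|u|> + <|A u|>)).
{ intros v w Hv Hcv <- Hw; apply Rle_trans with (1 := B_norm_cone Hv Hcv).
  apply Rle_trans with (K * <|A v|>).
  - apply Rle_trans with (2 := HPsi (A v)); rewrite <- Rabs_Ropp; apply Rle_abs.
  - rewrite Rmult_assoc; apply Rmult_le_compat_l; lra. }
rewrite Hu12 at 1; rewrite B_minus by auto.
apply Rle_trans with (1 := norm_minus_le _ _).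
generalize (Hle u1 w1 Hd1 Hc1 Ha1 Hw1), (Hle u2 w2 Hd2 Hc2 Ha2 Hw2); lra.
Qed.

Lemma B_tends (T : Type) (F : (T -> Prop) -> Prop) {FF : Filter F} (f : T -> X) u :
  F (fun i => dom A (f i)) -> dom A u -> tends F f u ->
  tends F (fun i => A (f i)) (A u) -> tends F (fun i => B (f i)) (B u).
Proof.
intros Hd Hu Hf HAf; destruct B_bounded as [C [HC Hb]].
refine (tends_squeeze (g := fun i => C * (<|f i [-] u|> + <|A (f i) [-] A u|>)) _ _).
- generalize Hd; apply filter_imp; intros i Hi.
  rewrite <- B_minus by auto; destruct (dom_minus Hi Hu) as [H1 <-]; auto.
- tapply tends_zero_mult; tapply tends_zero_plus; now tapply tends_norm_zero.
Qed.

Lemma U_dom s u : 0 <= s -> dom A u -> dom A (U s u) /\ A (U s u) = U s (A u).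
Proof. intros Hs Hu; apply gen_dom, gen_invariant; auto; now apply dom_gen. Qed.

Lemma BU_cont u : dom A u -> cont_nonneg (fun s => B (U s u)).
Proof.
intros Hu; destruct B_bounded as [C [HC Hb]].
destruct (sg_bounded hU) as [K [HK HUb]].
apply (cont_nonneg_modulus
  (g := fun h => C * (K * (<|U h u [-] u|> + <|U h (A u) [-] A u|>)))).
- intros s h Hs Hh.
  destruct (@U_dom s u) as [H1 H2]; auto.
  destruct (@U_dom (s + h) u) as [H3 H4]; auto; [lra|].
  rewrite <- B_minus by auto.
  apply Rle_trans with (1 := Hb _ (proj1 (dom_minus H3 H1))).
  apply Rmult_le_compat_l; [lra|].
  rewrite (proj2 (dom_minus H3 H1)), H2, H4.
  rewrite !(sg_add hU), <- !(sg_minus hU) by lra.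
  rewrite Rmult_plus_distr_l; apply Rplus_le_compat; apply HUb; auto.
- do 2 tapply tends_zero_mult; tapply tends_zero_plus;
    tapply tends_norm_zero; apply (sg_tends hU).
Qed.

(* The input [B (U s u)] over [[0,t]] is paid for by the mass lost by [U]. *)
Lemma input_bound u t (F : R -> X) I :
  0 <= t -> dom A u -> cone u -> is_RInt F 0 t I ->
  (forall s, 0 <= s <= t -> <|F s|> <= <|B (U s u)|>) ->
  <|I|> <= <|u|> - <|U t u|>.
Proof.
intros Ht Hu Hc HI HF.
apply (norm_RInt_le (V := X) F (fun s => - Psi (U s (A u))) 0 t I); auto.
- intros s Hs; apply Rle_trans with (1 := HF s Hs).
  destruct (@U_dom s u) as [H1 H2]; auto; [lra|].
  rewrite <- H2; apply B_norm_cone; auto; apply (sg_cone hU); auto; lra.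
- assert (H := is_RInt_linear Psi_lin (gen_FTC hU Ht (dom_gen Hu))).
  rewrite Psi_minus, !Psi_cone in H by (auto; apply (sg_cone hU); auto).
  replace (<|u|> - <|U t u|>) with (- (<|U t u|> - <|u|>)) by ring.
  exact (is_RInt_opp (V := R_NormedModule) _ _ _ _ H).
Qed.

Lemma dom_dense u : cone u -> exists f : R -> X,
  at_right 0 (fun h => dom A (f h) /\ cone (f h)) /\ tends (at_right 0) f u.
Proof.
intros Hu; exists (fun h => / h [*] RInt (fun s => U s u) 0 h); split.
- generalize at_right_pos; apply filter_imp; intros h Hh; split.
  + apply dom_scal, (gen_dom (gen_integral hU u (Rlt_le _ _ Hh))).
  + apply cone_scal; [now apply Rlt_le, Rinv_0_lt_compat|].
    apply (sg_RInt_cone hU); auto; lra.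
- apply (sg_mean_tends hU).
Qed.

Lemma dense_eq (L1 L2 : X -> X) : is_linear L1 -> is_linear L2 ->
  (forall u, dom A u -> L1 u = L2 u) -> forall x, L1 x = L2 x.
Proof.
intros H1 H2 H.
assert (Hc : forall u, cone u -> L1 u = L2 u).
{ intros u Hu; destruct (dom_dense Hu) as [f [Hf Hlim]].
  tapply (@tends_unique _ (at_right 0) _ X (fun h => L1 (f h))).
  - now apply tends_linear.
  - refine (tends_ext _ (tends_linear H2 Hlim)).
    generalize Hf; apply filter_imp; intros h [Hd _]; symmetry; auto. }
intros x; destruct (cone_generating x) as [u [v [Hu [Hv ->]]]].
transitivity (L1 u [-] L1 v); [exact (lin_minus H1 u v)|].
rewrite !Hc by auto; symmetry; exact (lin_minus H2 u v).
Qed.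

(** * Mass balance, cocycle identity and continuity of the iterates *)

Variable Vn : nat -> R -> X -> X.
Hypothesis hVn : dyson_phillips U A B Vn.

Lemma Vn_lin n t : 0 <= t -> is_linear (Vn n t).
Proof. intros Ht; exact (dp_bounded hVn n Ht). Qed.

Lemma Vn_minus n t u v : 0 <= t -> Vn n t (u [-] v) = Vn n t u [-] Vn n t v.
Proof. intros Ht; exact (lin_minus (Vn_lin n Ht) u v). Qed.

Lemma Vn_cone n t u : 0 <= t -> cone u -> cone (Vn n t u).
Proof. intros Ht; exact (@dp_positive X U A B Vn hVn n t Ht u). Qed.

Definition Sn (n : nat) (t : R) (x : X) : X := vsum (fun k => Vn k t x) n.

(** The part of [Sn (S n)] produced by [B]; Duhamel's formula gives it from [Sn n]. *)
Definition tail (n : nat) (t : R) (x : X) : X := vsum (fun k => Vn (S k) t x) n.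

Lemma Sn_succ n t x : 0 <= t -> Sn (S n) t x = U t x [+] tail n t x.
Proof. intros Ht; unfold Sn; now rewrite vsum_shift, (dp_zero hVn). Qed.

Lemma vsum_is_linear (f : nat -> X -> X) n :
  (forall k, is_linear (f k)) -> is_linear (fun x => vsum (fun k => f k x) n).
Proof.
intros H; induction n as [|n IH]; simpl.
- exact (@is_linear_zero R_AbsRing X X).
- apply (is_linear_comp (fun x => (vsum (fun k => f k x) n, f n x))
    (fun p => plus (fst p) (snd p))).
  + apply (is_linear_prod (T := X) (U := X) (V := X)); auto.
  + exact (@is_linear_plus R_AbsRing X).
Qed.

Lemma Sn_lin n t : 0 <= t -> is_linear (Sn n t).
Proof. intros Ht; apply (vsum_is_linear (f := fun k => Vn k t)); intros k; now apply Vn_lin. Qed.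

Lemma tail_lin n t : 0 <= t -> is_linear (tail n t).
Proof. intros Ht; apply (vsum_is_linear (f := fun k => Vn (S k) t)); intros k; now apply Vn_lin. Qed.

Lemma Sn_cone n t u : 0 <= t -> cone u -> cone (Sn n t u).
Proof. intros Ht Hu; apply vsum_cone; intros; now apply Vn_cone. Qed.

Lemma tail_cone n t u : 0 <= t -> cone u -> cone (tail n t u).
Proof. intros Ht Hu; apply vsum_cone; intros; now apply Vn_cone. Qed.

Lemma tail_RInt n t u : 0 <= t -> dom A u ->
  is_RInt (fun s => Sn n (t - s) (B (U s u))) 0 t (tail n t u).
Proof.
intros Ht Hu; apply (is_RInt_vsum (f := fun k s => Vn k (t - s) (B (U s u)))).
intros k _; now apply (dp_succ hVn).
Qed.

(** Contractivity of the sums would not suffice later: the bound by the mass lost by [U] is also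
    small for small [t], uniformly in [n]. By the induction hypothesis [Sn (S n)] is contractive, so
    the Duhamel integrand is at most [<|B (U s u)|>], to which [input_bound] applies. *)
Lemma tail_bound n t u : 0 <= t -> cone u -> <|tail n t u|> <= <|u|> - <|U t u|>.
Proof.
revert t u; induction n as [|n IH]; intros t u Ht Hu.
{ unfold tail; simpl; rewrite vnorm_zero; generalize (sg_contr hU Ht Hu); lra. }
destruct (dom_dense Hu) as [f [Hf Hlim]].
tapply (@tends_le _ (at_right 0) _ (fun h => <|tail (S n) t (f h)|>)
  (fun h => <|f h|> - <|U t (f h)|>)).
- generalize Hf; apply filter_imp; intros h [Hd Hc].
  apply (input_bound Ht Hd Hc (tail_RInt (n := S n) Ht Hd)).
  intros s Hs; rewrite Sn_succ by lra.
  set (y := B (U s (f h))).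
  assert (Hy : cone y).
  { apply hB_pos; [apply U_dom; auto; lra|apply (sg_cone hU); auto; lra]. }
  rewrite cone_norm_additive by
    (auto; try apply tail_cone; auto; try apply (sg_cone hU); auto; lra).
  assert (H := IH (t - s) y ltac:(lra) Hy); lra.
- tapply tends_norm_real; apply tends_linear; auto; now apply tail_lin.
- apply (@tends_minus _ _ _ R_state_space); tapply tends_norm_real; auto.
  apply tends_linear; auto; now apply (sg_lin hU).
Qed.

Lemma Sn_contr n t u : 0 <= t -> cone u -> <|Sn n t u|> <= <|u|>.
Proof.
intros Ht Hu; destruct n as [|n].
- unfold Sn; simpl; rewrite vnorm_zero; apply vnorm_ge_0.
- rewrite Sn_succ by auto.
  apply Rle_trans with (1 := vnorm_triangle _ _).
  generalize (tail_bound n Ht Hu); lra.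
Qed.

Lemma Vn_contr n t u : 0 <= t -> cone u -> <|Vn n t u|> <= <|u|>.
Proof.
intros Ht Hu; apply Rle_trans with (2 := Sn_contr (S n) Ht Hu).
unfold Sn; simpl; rewrite cone_norm_additive.
- generalize (vnorm_ge_0 (vsum (fun k => Vn k t u) n)); lra.
- now apply Sn_cone.
- now apply Vn_cone.
Qed.

Lemma VnS_bound n t u : 0 <= t -> cone u -> <|Vn (S n) t u|> <= <|u|> - <|U t u|>.
Proof.
intros Ht Hu; apply Rle_trans with (2 := tail_bound (S n) Ht Hu).
unfold tail; simpl; rewrite cone_norm_additive.
- generalize (vnorm_ge_0 (vsum (fun k => Vn (S k) t u) n)); lra.
- now apply tail_cone.
- now apply Vn_cone.
Qed.

Lemma Sn_bounded : exists K, 0 < K /\ forall n t x, 0 <= t ->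
  <|Sn n t x|> <= K * <|x|> /\ <|Vn n t x|> <= K * <|x|>.
Proof.
destruct (cone_bounded_linear X) as [K [HK H]]; exists K; split; auto.
intros n t x Ht; rewrite <- (Rmult_1_r K); split.
- apply (H X (Sn n t)); [lra| |].
  + intros; apply lin_minus, Sn_lin, Ht.
  + intros u Hu; rewrite Rmult_1_l; now apply Sn_contr.
- apply (H X (Vn n t)); [lra| |].
  + intros; now apply Vn_minus.
  + intros u Hu; rewrite Rmult_1_l; now apply Vn_contr.
Qed.

(** On the dense domain, the Duhamel integral for [t + s] is cut at [s]. Before [s] the induction
    hypothesis factors the kernel and yields the terms with index at most [n]; after [s] a shift
    yields the last term, [Vn (S n) t (U s u)]. *)
Lemma Vn_cocycle n t s x : 0 <= t -> 0 <= s ->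
  Vn n (t + s) x = conv (fun k => Vn k t) (fun j => Vn j s x) n.
Proof.
intros Ht; revert s x; induction n as [|n IH]; intros s x Hs.
{ unfold conv; simpl; rewrite !(dp_zero hVn), (sg_add hU) by lra; vec. }
assert (HL : is_linear (fun x => conv (fun k => Vn k t) (fun j => Vn j s x) (S n))).
{ apply (vsum_is_linear (f := fun k x => Vn k t (Vn (S n - k) s x))).
  intros k; apply (is_linear_comp (Vn (S n - k) s) (Vn k t)); now apply Vn_lin. }
revert x; apply dense_eq; auto; [apply Vn_lin; lra|].
intros u Hu.
assert (H0 := dp_succ hVn (n := n) (t := t + s) ltac:(lra) Hu).
assert (H1 : is_RInt (fun r => Vn n (t + s - r) (B (U r u))) 0 s
  (vsum (fun k => Vn k t (Vn (S n - k) s u)) (S n))).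
{ apply is_RInt_ext with
    (fun r => vsum (fun k => Vn k t (Vn (n - k) (s - r) (B (U r u)))) (S n)).
  - rewrite Rmin_left, Rmax_right by lra; intros r Hr.
    replace (t + s - r) with (t + (s - r)) by ring; symmetry; apply IH; lra.
  - apply (is_RInt_vsum (f := fun k r => Vn k t (Vn (n - k) (s - r) (B (U r u))))).
    intros k Hk; apply is_RInt_linear; [now apply Vn_lin|].
    rewrite Nat.sub_succ_l by lia; now apply (dp_succ hVn). }
assert (H2 : is_RInt (fun r => Vn n (t + s - r) (B (U r u))) s (t + s)
  (Vn (S n) t (U s u))).
{ apply is_RInt_ext with (fun r => Vn n (t - (r + - s)) (B (U (r + - s) (U s u)))).
  - rewrite Rmin_left, Rmax_right by lra; intros r Hr.
    rewrite <- (sg_add hU) by lra.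
    replace (r + - s + s) with r by ring; f_equal; ring.
  - apply (is_RInt_shift (f := fun r => Vn n (t - r) (B (U r (U s u))))).
    replace (s + - s) with 0 by ring; replace (t + s + - s) with t by ring.
    apply (dp_succ hVn); auto; now apply U_dom. }
assert (E := filterlim_locally_unique (V := X) _ _ _ H0 (is_RInt_Chasles (V := X) _ _ _ _ _ _ H1 H2)).
rewrite E; unfold conv.
change (vsum (fun k => Vn k t (Vn (S n - k) s u)) (S (S n))) with
  (vsum (fun k => Vn k t (Vn (S n - k) s u)) (S n) [+] Vn (S n) t (Vn (S n - S n) s u)).
rewrite Nat.sub_diag, (dp_zero hVn) by auto; reflexivity.
Qed.

Lemma VnS_time0 n x : Vn (S n) 0 x = zero.
Proof.
assert (H : forall u, cone u -> Vn (S n) 0 u = zero).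
{ intros u Hu; apply vnorm_eq_zero, Rle_antisym; [|apply vnorm_ge_0].
  assert (H := VnS_bound n (Rle_refl 0) Hu); rewrite (sg_zero hU) in H; lra. }
destruct (cone_generating x) as [u [v [Hu [Hv ->]]]].
rewrite Vn_minus, !H by (auto; lra); vec.
Qed.

Lemma V0_time0 x : Vn 0 0 x = x.
Proof. rewrite (dp_zero hVn) by lra; apply (sg_zero hU). Qed.

Lemma vsum_norm_le (a : nat -> X) n c :
  (forall k, (k < n)%nat -> <|a k|> <= c) -> <|vsum a n|> <= INR n * c.
Proof.
induction n as [|n IH]; intros H.
- simpl vsum; rewrite vnorm_zero; simpl; lra.
- rewrite S_INR; simpl vsum.
  apply Rle_trans with (1 := vnorm_triangle _ _).
  assert (H1 := IH (fun k Hk => H k (Nat.lt_lt_succ_r _ _ Hk))).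
  assert (H2 := H n (Nat.lt_succ_diag_r n)); lra.
Qed.

(* Bounds [Vn (S n) h (p [-] q)] uniformly in [n], and vanishes as [h] tends
   to 0. *)
Definition loss (p q : X) (h : R) : R := (<|p|> - <|U h p|>) + (<|q|> - <|U h q|>).

Lemma loss_tends p q : tends (at_right 0) (loss p q) 0.
Proof.
apply tends_zero_plus; try apply at_right_proper_filter.
- tapply tends_zero_diff; tapply tends_norm_real; apply (sg_tends hU).
- tapply tends_zero_diff; tapply tends_norm_real; apply (sg_tends hU).
Qed.

Lemma tail_loss n t p q : 0 <= t -> cone p -> cone q ->
  <|tail n t (p [-] q)|> <= loss p q t.
Proof.
intros Ht Hp Hq; rewrite (lin_minus (tail_lin n Ht)).
apply Rle_trans with (1 := norm_minus_le _ _).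
now apply Rplus_le_compat; apply tail_bound.
Qed.

Lemma VnS_loss n t p q : 0 <= t -> cone p -> cone q ->
  <|Vn (S n) t (p [-] q)|> <= loss p q t.
Proof.
intros Ht Hp Hq; rewrite Vn_minus by auto.
apply Rle_trans with (1 := norm_minus_le _ _).
now apply Rplus_le_compat; apply VnS_bound.
Qed.

(** In the cocycle identity all terms but the last contain an iterate of positive index at time [h],
    and these vanish with [loss]. *)
Lemma Vn_cont n x : cont_nonneg (fun t => Vn n t x).
Proof.
destruct Sn_bounded as [K [HK Hb]].
destruct (cone_generating x) as [p [q [Hp [Hq Hx]]]].
apply (cont_nonneg_modulus
  (g := fun h => K * <|U h x [-] x|> + INR n * (K * loss p q h))).
- intros s h Hs Hh; rewrite Vn_cocycle by lra; unfold conv.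
  change (vsum (fun k => Vn k s (Vn (n - k) h x)) (S n)) with
    (vsum (fun k => Vn k s (Vn (n - k) h x)) n [+] Vn n s (Vn (n - n) h x)).
  rewrite Nat.sub_diag, (dp_zero hVn) by lra.
  replace (_ [-] _) with ((Vn n s (U h x) [-] Vn n s x) [+]
    vsum (fun k => Vn k s (Vn (n - k) h x)) n) by vec.
  rewrite <- Vn_minus by auto.
  apply Rle_trans with (1 := vnorm_triangle _ _); apply Rplus_le_compat.
  + now apply Hb.
  + apply vsum_norm_le; intros k Hk.
    replace (n - k)%nat with (S (n - S k)) by lia.
    apply Rle_trans with (1 := proj2 (Hb k s _ Hs)), Rmult_le_compat_l; [lra|].
    rewrite Hx; apply VnS_loss; auto; lra.
- tapply tends_zero_plus; [|do 2 tapply tends_zero_mult; apply loss_tends].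
  tapply tends_zero_mult; tapply tends_norm_zero; apply (sg_tends hU).
Qed.

(** The kernel [F] is abstract since the estimate serves single iterates and also, uniformly in [n],
    the partial sums. *)
Lemma duhamel_mean (F : R -> X -> X) K w J y h eps :
  0 < h -> dom A w -> 0 < K ->
  (forall r x, 0 <= r -> <|F r x|> <= K * <|x|>) ->
  (forall r u v, 0 <= r -> F r (u [-] v) = F r u [-] F r v) ->
  is_RInt (fun s => F (h - s) (B (U s w))) 0 h J ->
  (forall s, 0 <= s <= h -> <|B (U s w) [-] B w|> <= eps) ->
  (forall r, 0 <= r <= h -> <|F r (B w) [-] y|> <= eps) ->
  <|/ h [*] J [-] y|> <= K * eps + eps.
Proof.
intros Hh Hw HK Hb Hm HJ HB HF.
replace (/ h [*] J [-] y) with (/ h [*] (J [-] ((h - 0) [*] y))) by (vec; field; lra).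
assert (0 < / h) by now apply Rinv_0_lt_compat.
rewrite norm_scal_pos by lra.
apply Rmult_le_reg_l with h; auto; rewrite <- Rmult_assoc, Rinv_r, Rmult_1_l by lra.
rewrite <- (Rminus_0_r h) at 2.
apply norm_is_RInt_const with (fun s => F (h - s) (B (U s w)) [-] y); [lra| |].
- intros s Hs.
  apply Rle_trans with (1 := norm_minus_trans (F (h - s) (B w)) _ _).
  apply Rplus_le_compat; [|apply HF; lra].
  rewrite <- Hm by lra.
  apply Rle_trans with (K * <|B (U s w) [-] B w|>); [apply Hb; lra|].
  apply Rmult_le_compat_l; [lra|auto].
- apply is_RInt_minus_vec; auto; apply is_RInt_const_vec.
Qed.

Lemma small_times (f : R -> X) eps : cont_nonneg f -> 0 < eps ->
  exists d, 0 < d /\ forall s, 0 <= s < d -> <|f s [-] f 0|> <= eps.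
Proof.
intros Hf He; destruct (Hf 0 (Rle_refl 0) eps He) as [d [Hd H]].
exists d; split; auto; intros s Hs; apply Rlt_le, H; [lra|].
rewrite Rminus_0_r, Rabs_pos_eq; lra.
Qed.

(** The limit is [B w] for [k = 0] and zero otherwise. *)
Lemma VnS_deriv k w : dom A w ->
  tends (at_right 0) (fun h => / h [*] Vn (S k) h w) (Vn k 0 (B w)).
Proof.
intros Hw; apply (proj2 (tends_at_right _ _)); intros eps He.
destruct Sn_bounded as [K [HK Hb]].
assert (He' : 0 < eps / (2 * (K + 1))) by (apply Rdiv_lt_0_compat; lra).
destruct (small_times (BU_cont Hw) He') as [d1 [Hd1 H1]].
destruct (small_times (Vn_cont k (B w)) He') as [d2 [Hd2 H2]].
rewrite (sg_zero hU) in H1.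
exists (Rmin d1 d2); split; [now apply Rmin_glb_lt|]; intros h Hh.
assert (Hm1 := Rmin_l d1 d2); assert (Hm2 := Rmin_r d1 d2).
apply Rle_lt_trans with (K * (eps / (2 * (K + 1))) + eps / (2 * (K + 1))).
- apply (duhamel_mean (F := Vn k) (w := w)); auto; [lra| | | | |].
  + intros r x Hr; now apply Hb.
  + intros r u v Hr; now apply Vn_minus.
  + apply (dp_succ hVn); auto; lra.
  + intros s Hs; apply H1; lra.
  + intros r Hr; apply H2; lra.
- replace (K * (eps / (2 * (K + 1))) + eps / (2 * (K + 1))) with (eps / 2)
    by (field; lra); lra.
Qed.

Definition IVn (n : nat) (t : R) (x : X) : X := RInt (fun s => Vn n s x) 0 t.

Lemma IVn_RInt n t x : 0 <= t -> is_RInt (fun s => Vn n s x) 0 t (IVn n t x).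
Proof.
intros Ht; apply (RInt_correct (V := X)), ex_RInt_cont_nonneg; auto; [lra|].
apply Vn_cont.
Qed.

Lemma IVn_cone n t u : 0 <= t -> cone u -> cone (IVn n t u).
Proof.
intros Ht Hu; apply (is_RInt_cone Ht) with (2 := @IVn_RInt n t u Ht).
intros s Hs; apply Vn_cone; auto; lra.
Qed.

Lemma IVn_minus n t x y : 0 <= t -> IVn n t (x [-] y) = IVn n t x [-] IVn n t y.
Proof.
intros Ht; apply (is_RInt_unique (V := X)).
apply is_RInt_ext with (fun s => Vn n s x [-] Vn n s y).
- rewrite Rmin_left, Rmax_right by lra; intros s Hs; now rewrite Vn_minus by lra.
- now apply is_RInt_minus_vec; apply IVn_RInt.
Qed.

Lemma vsum_zero (a : nat -> X) n : (forall k, a k = zero) -> vsum a n = zero.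
Proof. intros H; induction n as [|n IH]; simpl; auto; rewrite IH, H; vec. Qed.

Lemma IVn_gen n t x : 0 <= t -> dom A (IVn n t x) /\
  A (IVn n t x) = Vn n t x [-] match n with 0%nat => x | S m => B (IVn m t x) end.
Proof.
(* Strong induction: the derivatives of all the terms [Vn (S k) h] are taken at [IVn (m - k) t x],
   which must already lie in the domain. *)
intros Ht; induction n as [n IH] using (well_founded_induction Nat.lt_wf_0).
apply gen_dom; destruct n as [|m].
{ replace (IVn 0 t x) with (RInt (fun s => U s x) 0 t).
  - rewrite (dp_zero hVn) by auto; now apply gen_integral.
  - apply (RInt_ext (V := X)); rewrite Rmin_left, Rmax_right by auto.
    intros s Hs; symmetry; apply (dp_zero hVn); lra. }
assert (Hlim : tends (at_right 0)
  (fun h => (/ h [*] (RInt (fun s => Vn (S m) (s + h) x) 0 t [-] IVn (S m) t x)) [-]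
     vsum (fun k => / h [*] Vn (S k) h (IVn (m - k) t x)) (S m))
  ((Vn (S m) t x [-] Vn (S m) 0 x) [-]
     vsum (fun k => Vn k 0 (B (IVn (m - k) t x))) (S m))).
{ tapply tends_minus.
  - exact (RInt_shift_tends Ht (Vn_cont (S m) x)).
  - tapply vsum_tends; intros k Hk; apply VnS_deriv, IH; lia. }
(* Only [k = 0] survives in the limit, since iterates of positive index vanish at time 0. *)
rewrite vsum_shift, V0_time0, VnS_time0, Nat.sub_0_r in Hlim.
rewrite (vsum_zero (a := fun k => Vn (S k) 0 (B (IVn (m - S k) t x)))) in Hlim
  by (intros; apply VnS_time0).
replace (Vn (S m) t x [-] (zero : X) [-] (B (IVn m t x) [+] (zero : X))) with
  (Vn (S m) t x [-] B (IVn m t x)) in Hlim by vec.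
refine (tends_ext _ Hlim).
generalize at_right_pos; apply filter_imp; intros h Hh.
assert (E : RInt (fun s => Vn (S m) (s + h) x) 0 t =
  U h (IVn (S m) t x) [+] vsum (fun k => Vn (S k) h (IVn (m - k) t x)) (S m)).
{ apply (is_RInt_unique (V := X)).
  apply is_RInt_ext with (fun s => vsum (fun k => Vn k h (Vn (S m - k) s x)) (S (S m))).
  - rewrite Rmin_left, Rmax_right by lra; intros s Hs.
    rewrite (Rplus_comm s); symmetry; apply Vn_cocycle; lra.
  - replace (U h (IVn (S m) t x) [+] vsum (fun k => Vn (S k) h (IVn (m - k) t x)) (S m))
      with (vsum (fun k => Vn k h (IVn (S m - k) t x)) (S (S m))).
    + apply (is_RInt_vsum (f := fun k s => Vn k h (Vn (S m - k) s x))).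
      intros k Hk; apply is_RInt_linear; [apply Vn_lin; lra|now apply IVn_RInt].
    + rewrite vsum_shift, (dp_zero hVn) by lra; reflexivity. }
rewrite E, vsum_scal; vec.
Qed.

Lemma a_fun_vsum n t x : 0 <= t ->
  @vsum R_state_space (fun k => a_fun Psi A B (IVn k t x)) (S n) =
  Psi x - Psi (Sn (S n) t x) - Psi (B (IVn n t x)).
Proof.
intros Ht; induction n as [|n IH].
- change (@vsum R_state_space (fun k => a_fun Psi A B (IVn k t x)) 1) with
    (0 + - Psi (A (IVn 0 t x) [+] B (IVn 0 t x))).
  rewrite (proj2 (IVn_gen 0 x Ht)), Psi_plus, Psi_minus.
  unfold Sn; simpl; rewrite Psi_plus.
  replace (Psi zero) with 0 by (symmetry; exact (lin_zero Psi_lin)); ring.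
- change (@vsum R_state_space (fun k => a_fun Psi A B (IVn k t x)) (S (S n))) with
    (@vsum R_state_space (fun k => a_fun Psi A B (IVn k t x)) (S n) +
     - Psi (A (IVn (S n) t x) [+] B (IVn (S n) t x))).
  rewrite IH, (proj2 (IVn_gen (S n) x Ht)), Psi_plus, Psi_minus.
  unfold Sn; simpl; rewrite !Psi_plus; ring.
Qed.

(** The contributions of [B] telescope up to the last one, [B (IVn n t x)], which measures how far
    the sums are from solving the integrated equation for A+B. *)
Lemma IVn_sum_gen n t x : 0 <= t ->
  dom A (vsum (fun k => IVn k t x) n) /\
  A (vsum (fun k => IVn k t x) (S n)) [+] B (vsum (fun k => IVn k t x) (S n)) =
  Sn (S n) t x [-] x [+] B (IVn n t x).
Proof.
intros Ht.
assert (Hd : forall m, dom A (vsum (fun k => IVn k t x) m)).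
{ induction m as [|m IH]; simpl.
  - replace (zero : X) with (0 [*] IVn 0 t x) by vec; apply dom_scal, IVn_gen, Ht.
  - apply dom_plus; auto; now apply IVn_gen. }
split; auto.
induction n as [|n IH].
- replace (vsum (fun k => IVn k t x) 1) with (IVn 0 t x) by (simpl; vec).
  rewrite (proj2 (IVn_gen 0 x Ht)); unfold Sn; simpl; vec.
- change (vsum (fun k => IVn k t x) (S (S n))) with
    (vsum (fun k => IVn k t x) (S n) [+] IVn (S n) t x).
  destruct (IVn_gen (S n) x Ht) as [H1 H2].
  rewrite (proj2 (dom_plus (Hd (S n)) H1)), (B_plus (Hd (S n)) H1), H2.
  change (Sn (S (S n)) t x) with (Sn (S n) t x [+] Vn (S n) t x).
  transitivity ((A (vsum (fun k => IVn k t x) (S n)) [+] B (vsum (fun k => IVn k t x) (S n)))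
    [+] (Vn (S n) t x [-] B (IVn n t x) [+] B (IVn (S n) t x))); [vec|].
  rewrite IH; vec.
Qed.

(** * The sum of the iterates as a substochastic semigroup *)

Definition Sn_lim (t : R) (x : X) : X :=
  epsilon (inhabits zero) (fun l => tends eventually (fun n => Sn n t x) l).

Lemma Sn_increasing n t u : 0 <= t -> cone u -> cone (Sn (S n) t u [-] Sn n t u).
Proof. intros Ht Hu; unfold Sn; rewrite vsum_step; now apply Vn_cone. Qed.

Lemma Sn_lim_tends t x : 0 <= t -> tends eventually (fun n => Sn n t x) (Sn_lim t x).
Proof.
intros Ht; unfold Sn_lim; apply epsilon_spec.
assert (Hc : forall u, cone u -> exists l, tends eventually (fun n => Sn n t u) l).
{ intros u Hu; apply (@cone_monotone_cv X (fun n => Sn n t u) (<|u|>)).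
  - apply cone_zero.
  - intros n; now apply Sn_increasing.
  - intros n; now apply Sn_contr. }
destruct (cone_generating x) as [u [v [Hu [Hv ->]]]].
destruct (Hc u Hu) as [l Hl]; destruct (Hc v Hv) as [m Hm].
exists (l [-] m).
tapply (@tends_ext _ _ _ X (fun n => Sn n t u [-] Sn n t v)); [|tapply tends_minus; auto].
exists 0%nat; intros n _; symmetry; exact (lin_minus (Sn_lin n Ht) u v).
Qed.

Lemma Sn_lim_minus t u v : 0 <= t -> Sn_lim t (u [-] v) = Sn_lim t u [-] Sn_lim t v.
Proof.
intros Ht; tapply (@tends_unique nat eventually _ X (fun n => Sn n t (u [-] v))).
- now apply Sn_lim_tends.
- tapply (@tends_ext _ _ _ X (fun n => Sn n t u [-] Sn n t v)).
  + exists 0%nat; intros n _; symmetry; exact (lin_minus (Sn_lin n Ht) u v).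
  + tapply tends_minus; now apply Sn_lim_tends.
Qed.

Lemma Sn_lim_cone t u : 0 <= t -> cone u -> cone (Sn_lim t u).
Proof.
intros Ht Hu; tapply (@tends_cone X _ eventually _ (fun n => Sn n t u)).
- exists 0%nat; intros n _; now apply Sn_cone.
- now apply Sn_lim_tends.
Qed.

Lemma Sn_lim_contr t u : 0 <= t -> cone u -> <|Sn_lim t u|> <= <|u|>.
Proof.
intros Ht Hu; tapply (@tends_le_const nat eventually _ (fun n => <|Sn n t u|>)).
- exists 0%nat; intros n _; now apply Sn_contr.
- tapply tends_norm_real; now apply Sn_lim_tends.
Qed.

Lemma Sn_lim_bounded : exists K, 0 < K /\ forall t x, 0 <= t -> <|Sn_lim t x|> <= K * <|x|>.
Proof.
destruct Sn_bounded as [K [HK Hb]]; exists K; split; auto.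
intros t x Ht; tapply (@tends_le_const nat eventually _ (fun n => <|Sn n t x|>)).
- exists 0%nat; intros n _; now apply Hb.
- tapply tends_norm_real; now apply Sn_lim_tends.
Qed.

Lemma Sn_lim_lin t : 0 <= t -> is_linear (Sn_lim t).
Proof.
intros Ht; constructor.
- intros u v; change (Sn_lim t (u [+] v) = Sn_lim t u [+] Sn_lim t v).
  replace (Sn_lim t u) with (Sn_lim t ((u [+] v) [-] v)) by (f_equal; vec).
  rewrite Sn_lim_minus by auto; vec.
- intros k u; change (Sn_lim t (k [*] u) = k [*] Sn_lim t u).
  tapply (@tends_unique nat eventually _ X (fun n => Sn n t (k [*] u))).
  + now apply Sn_lim_tends.
  + tapply (@tends_ext _ _ _ X (fun n => k [*] Sn n t u)).
    * exists 0%nat; intros n _; symmetry; exact (lin_scal (Sn_lin n Ht) k u).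
    * tapply (@tends_scal _ _ _ X (fun _ => k)); [tapply tends_const|now apply Sn_lim_tends].
- destruct Sn_lim_bounded as [K [HK Hb]]; exists K; split; [exact HK|].
  intros x; exact (Hb t x Ht).
Qed.

Lemma tail_tends t x : 0 <= t ->
  tends eventually (fun n => tail n t x) (Sn_lim t x [-] U t x).
Proof.
intros Ht; tapply (@tends_ext _ _ _ X (fun n => Sn (S n) t x [-] U t x)).
- exists 0%nat; intros n _; rewrite Sn_succ by auto; vec.
- tapply tends_minus; [|tapply tends_const].
  apply (proj2 (tends_seq _ _)); intros eps He.
  destruct (proj1 (tends_seq _ _) (Sn_lim_tends x Ht) eps He) as [N HN].
  exists N; intros n Hn; apply HN; lia.
Qed.

Lemma Sn_lim_loss t p q : 0 <= t -> cone p -> cone q ->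
  <|Sn_lim t (p [-] q) [-] U t (p [-] q)|> <= loss p q t.
Proof.
intros Ht Hp Hq.
tapply (@tends_le_const nat eventually _ (fun n => <|tail n t (p [-] q)|>)).
- exists 0%nat; intros n _; now apply tail_loss.
- tapply tends_norm_real; now apply tail_tends.
Qed.

Lemma Sn_lim_add s t x : 0 <= s -> 0 <= t -> Sn_lim (s + t) x = Sn_lim s (Sn_lim t x).
Proof.
intros Hs Ht.
assert (Hc : forall u, cone u -> Sn_lim (s + t) u = Sn_lim s (Sn_lim t u)).
{ intros u Hu.
  tapply (@tends_unique nat eventually _ X (vsum (conv (fun k => Vn k s) (fun j => Vn j t u)))).
  - tapply (@tends_ext _ _ _ X (fun n => Sn n (s + t) u)); [|apply Sn_lim_tends; lra].
    exists 0%nat; intros n _; apply vsum_ext; intros k _; now apply Vn_cocycle.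
  - apply (@cauchy_product X X (fun k => Vn k s) (Sn_lim s)) with (c := 1); try lra.
    + intros k x' y'; now apply Vn_minus.
    + intros k y Hy; now apply Vn_cone.
    + intros y Hy; now apply Sn_lim_tends.
    + intros y Hy; rewrite Rmult_1_l; now apply Sn_lim_contr.
    + intros k; now apply Vn_cone.
    + now apply Sn_lim_tends. }
destruct (cone_generating x) as [u [v [Hu [Hv ->]]]].
transitivity (Sn_lim (s + t) u [-] Sn_lim (s + t) v); [apply Sn_lim_minus; lra|].
rewrite !Hc, <- Sn_lim_minus by auto; f_equal; symmetry; now apply Sn_lim_minus.
Qed.

Lemma Sn_lim_substochastic : substochastic Sn_lim.
Proof.
constructor; [constructor| |].
- intros t Ht; now apply Sn_lim_lin.
- intros x; tapply (@tends_unique nat eventually _ X (fun n => Sn n 0 x)).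
  + apply Sn_lim_tends; lra.
  + tapply (@tends_ext _ _ _ X (fun _ => x)); [|tapply tends_const].
    exists 1%nat; intros n Hn; destruct n as [|n]; [lia|].
    rewrite Sn_succ, (sg_zero hU) by lra; unfold tail.
    rewrite vsum_zero by (intros; apply VnS_time0); vec.
- intros s t x; apply Sn_lim_add.
- intros x; apply tends_filterlim.
  destruct (cone_generating x) as [u [v [Hu [Hv Hx]]]].
  apply (tends_squeeze (g := fun h => loss u v h + <|U h x [-] x|>)).
  + generalize at_right_pos; apply filter_imp; intros h Hh.
    apply Rle_trans with (1 := norm_minus_trans (U h x) _ _).
    apply Rplus_le_compat_r; rewrite Hx; apply Sn_lim_loss; auto; lra.
  + tapply tends_zero_plus; [apply loss_tends|].
    tapply tends_norm_zero; apply (sg_tends hU).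
- intros t Ht u Hu; now apply Sn_lim_cone.
- intros t u Ht Hu; now apply Sn_lim_contr.
Qed.

(** The difference quotient of [Sn_lim - U] is a limit in [n] of Duhamel means; the estimates for
    small [h] do not depend on [n], so the two limits can be exchanged. *)
Lemma Sn_lim_gen w : dom A w -> gen Sn_lim w (A w [+] B w).
Proof.
intros Hw.
assert (HB : tends (at_right 0) (fun h => / h [*] (Sn_lim h w [-] U h w)) (B w)).
{ apply (proj2 (tends_at_right _ _)); intros eps He.
  destruct Sn_bounded as [K [HK Hb]].
  destruct (cone_generating (B w)) as [p [q [Hp [Hq Hpq]]]].
  (* Chosen so that the bound [K * e + e] of [duhamel_mean] equals [eps / 2]. *)
  set (e := eps / (2 * (K + 1))).
  assert (He' : 0 < e) by (apply Rdiv_lt_0_compat; lra).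
  assert (He2 : 0 < e / 2) by lra.
  destruct (small_times (BU_cont Hw) He') as [d1 [Hd1 H1]].
  destruct (small_times (sg_cont hU (B w)) He2) as [d2 [Hd2 H2]].
  destruct (proj1 (at_right_0 _) (tends_norm_lt (loss_tends p q) He2)) as [d3 [Hd3 H3]].
  rewrite (sg_zero hU) in H1, H2.
  set (d := Rmin d1 (Rmin d2 d3)).
  assert (Hda : d <= d1) by apply Rmin_l.
  assert (Hdb : d <= d2) by (apply Rle_trans with (1 := Rmin_r _ _), Rmin_l).
  assert (Hdc : d <= d3) by (apply Rle_trans with (1 := Rmin_r _ _), Rmin_r).
  exists d; split; [repeat apply Rmin_glb_lt; auto|]; intros h Hh.
  assert (HSn : forall n r, 0 <= r <= h -> <|Sn (S n) r (B w) [-] B w|> <= e).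
  { intros n r Hr; rewrite Sn_succ by lra.
    replace (_ [-] _) with ((U r (B w) [-] B w) [+] tail n r (B w)) by vec.
    apply Rle_trans with (1 := vnorm_triangle _ _).
    assert (<|U r (B w) [-] B w|> <= e / 2) by (apply H2; lra).
    assert (<|tail n r (B w)|> <= e / 2); [|lra].
    (* The smallness of [loss] is known to the right of 0 only, so [r = 0] is treated apart. *)
    destruct (Req_dec r 0) as [->|Hr0].
    - unfold tail; rewrite vsum_zero by (intros; apply VnS_time0).
      rewrite vnorm_zero; lra.
    - assert (H4 := H3 r ltac:(lra)); rewrite Rminus_0_r in H4; apply Rabs_def2 in H4.
      apply Rle_trans with (loss p q r); [|lra].
      rewrite Hpq; apply tail_loss; auto; lra. }
  apply Rle_lt_trans with (K * e + e).
  - tapply (@tends_le_const nat eventually _ (fun n => <|/ h [*] tail (S n) h w [-] B w|>)).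
    + exists 0%nat; intros n _.
      apply (duhamel_mean (F := Sn (S n)) (w := w)); auto; [lra| | | |].
      * intros r x Hr; now apply Hb.
      * intros r u v Hr; exact (lin_minus (Sn_lin (S n) Hr) u v).
      * apply tail_RInt; auto; lra.
      * intros s Hs; apply H1; lra.
    + tapply tends_norm_real; tapply tends_minus; [|tapply tends_const].
      tapply (@tends_scal _ _ _ X (fun _ => / h)); [tapply tends_const|].
      apply (proj2 (tends_seq _ _)); intros eps' He''.
      destruct (proj1 (tends_seq _ _) (tail_tends w (Rlt_le _ _ (proj1 Hh))) eps' He'') as [N HN].
      exists N; intros n Hn; apply HN; lia.
  - replace (K * e + e) with (eps / 2) by (unfold e; field; lra); lra. }
refine (tends_ext _ (tends_plus (dom_gen Hw) HB)).
apply filter_forall; intros h; vec.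
Qed.

Lemma sg_reverse_cont (W : R -> X -> X) (y : R -> X) t :
  substochastic W -> cont_nonneg y -> cont_on 0 t (fun s => W (t - s) (y s)).
Proof.
intros HW Hy s Hs eps He.
destruct (sg_bounded HW) as [K [HK Hb]].
assert (He2 : 0 < eps / (2 * K)) by (apply Rdiv_lt_0_compat; lra).
destruct (Hy s (proj1 Hs) (eps / (2 * K)) He2) as [d1 [Hd1 H1]].
assert (He3 : 0 < eps / 2) by lra.
assert (Hts : 0 <= t - s) by lra.
destruct (sg_cont HW (y s) Hts He3) as [d2 [Hd2 H2]].
exists (Rmin d1 d2); split; [now apply Rmin_glb_lt|]; intros r Hr Hrs.
assert (Hm1 := Rmin_l d1 d2); assert (Hm2 := Rmin_r d1 d2).
apply Rle_lt_trans with (1 := norm_minus_trans (W (t - r) (y s)) _ _).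
rewrite <- (sg_minus HW) by lra.
assert (H3 : <|W (t - r) (y s) [-] W (t - s) (y s)|> < eps / 2).
{ apply H2; [lra|]; replace (t - r - (t - s)) with (- (r - s)) by ring.
  rewrite Rabs_Ropp; lra. }
assert (H4 : <|y r [-] y s|> < eps / (2 * K)) by (apply H1; lra).
assert (H5 : K * <|y r [-] y s|> < eps / 2).
{ apply Rmult_lt_compat_l with (r := K) in H4; auto.
  replace (K * (eps / (2 * K))) with (eps / 2) in H4 by (field; lra); auto. }
apply Rle_lt_trans with (K * <|y r [-] y s|> + <|W (t - r) (y s) [-] W (t - s) (y s)|>); [|lra].
apply Rplus_le_compat_r, Hb; lra.
Qed.

(** * Comparison with another semigroup whose generator extends A+B *)

Section Majorant.

Variable W : R -> X -> X.
Hypothesis hW : substochastic W.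
Hypothesis hWgen : forall u, dom A u -> gen W u (A u [+] B u).

Lemma majorant_duhamel t u : 0 <= t -> dom A u ->
  is_RInt (fun s => W (t - s) (B (U s u))) 0 t (W t u [-] U t u).
Proof.
intros Ht Hu.
(* The sign makes the right derivative of -W(t-s)U(s)u equal to the integrand W(t-s)BU(s)u. *)
replace (W t u [-] U t u) with
  (((-1) [*] W (t - t) (U t u)) [-] ((-1) [*] W (t - 0) (U 0 u))).
2: { rewrite Rminus_diag, Rminus_0_r, (sg_zero hW), (sg_zero hU); vec. }
apply (is_RInt_right_derivative (f := fun s => (-1) [*] W (t - s) (U s u))); auto.
- intros s Hs eps He.
  destruct (sg_reverse_cont (t := t) hW (sg_cont hU u) Hs He) as [d [Hd H]].
  exists d; split; auto; intros r Hr Hrs.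
  replace (_ [-] _) with ([-] (W (t - r) (U r u) [-] W (t - s) (U s u))) by vec.
  rewrite vnorm_opp; auto.
- apply sg_reverse_cont; auto; now apply BU_cont.
- intros s Hs.
  destruct (@U_dom s u) as [Hd HAd]; auto; [lra|].
  assert (Hz : tends (at_right 0) (fun h => (/ h [*] (W h (U s u) [-] U s u)) [-]
    (/ h [*] (U h (U s u) [-] U s u))) (B (U s u))).
  { replace (B (U s u)) with ((A (U s u) [+] B (U s u)) [-] A (U s u)) by vec.
    tapply tends_minus; [now apply hWgen|now apply dom_gen]. }
  set (z h := (/ h [*] (W h (U s u) [-] U s u)) [-] (/ h [*] (U h (U s u) [-] U s u))) in *.
  destruct (sg_bounded hW) as [K [HK Hb]].
  (* Factoring W(t-s) as W(t-(s+h))W(h) puts the difference quotients of both semigroups at the same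
     vector [U s u], so right derivatives at 0 suffice. *)
  assert (Hlim : tends (at_right 0) (fun h => W (t - (s + h)) (z h)) (W (t - s) (B (U s u)))).
  { apply (tends_squeeze (g := fun h => K * <|z h [-] B (U s u)|> +
      <|W (t - (s + h)) (B (U s u)) [-] W (t - s) (B (U s u))|>)).
    - apply at_right_0; exists (t - s); split; [lra|]; intros h Hh.
      apply Rle_trans with (1 := norm_minus_trans (W (t - (s + h)) (B (U s u))) _ _).
      apply Rplus_le_compat_r; rewrite <- (sg_minus hW) by lra; apply Hb; lra.
    - tapply tends_zero_plus; [tapply tends_zero_mult|]; tapply tends_norm_zero; auto.
      apply (cont_on_right (f := fun r => W (t - r) (B (U s u))) (a := 0) (b := t)); [lra|].
      apply (sg_reverse_cont (y := fun _ => B (U s u))); auto.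
      apply (cont_nonneg_modulus (g := fun _ => 0)); [|tapply tends_const].
      intros; replace (_ [-] _) with (zero : X) by vec; rewrite vnorm_zero; lra. }
  refine (tends_ext _ Hlim).
  apply at_right_0; exists (t - s); split; [lra|]; intros h Hh; unfold z.
  replace (t - s) with (t - (s + h) + h) by ring.
  rewrite (sg_add hW) by lra; rewrite (Rplus_comm s h), (sg_add hU) by lra.
  rewrite (sg_minus hW), !(sg_scal hW), !(sg_minus hW) by lra; vec.
Qed.

Lemma majorant_Sn n t u : 0 <= t -> cone u -> cone (W t u [-] Sn n t u).
Proof.
revert t u; induction n as [|n IH]; intros t u Ht Hu.
{ unfold Sn; simpl; replace (_ [-] _) with (W t u) by vec; now apply (sg_cone hW). }
destruct (dom_dense Hu) as [f [Hf Hlim]].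
tapply (@tends_cone X _ (at_right 0) _ (fun h => W t (f h) [-] Sn (S n) t (f h))).
- generalize Hf; apply filter_imp; intros h [Hd Hc].
  rewrite Sn_succ by auto.
  replace (_ [-] _) with ((W t (f h) [-] U t (f h)) [-] tail n t (f h)) by vec.
  apply (is_RInt_cone Ht) with
    (2 := is_RInt_minus_vec (majorant_duhamel Ht Hd) (tail_RInt (n := n) Ht Hd)).
  intros s Hs; apply IH; [lra|].
  apply hB_pos; [apply U_dom; auto; lra|apply (sg_cone hU); auto; lra].
- tapply tends_minus; apply tends_linear; auto; [now apply sg_lin|now apply Sn_lin].
Qed.

End Majorant.

(** * Identification of the minimal semigroup *)

Variables (V : R -> X -> X) (G : operator X).
Hypothesis hV : minimal_semigroup (perturbed A B) V G.

Lemma V_substochastic : substochastic V.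
Proof. exact (minimal_substochastic hV). Qed.

Lemma V_gen u : dom A u -> gen V u (A u [+] B u).
Proof.
intros Hu; constructor; apply (minimal_generator hV).
exact (minimal_extends hV Hu).
Qed.

Lemma V_eq_Sn_lim t x : 0 <= t -> V t x = Sn_lim t x.
Proof.
intros Ht.
assert (Hc : forall u, cone u -> V t u = Sn_lim t u).
{ intros u Hu.
  (* Minimality is tested against [operator] records, so the generator of [Sn_lim] is turned into
     one by choice. *)
  set (H := Operator (fun u => exists w, gen Sn_lim u w)
    (fun u => epsilon (inhabits zero) (gen Sn_lim u))).
  assert (HgenH : is_generator Sn_lim H).
  { intros v w; simpl; split.
    - intros [Hw <-]; apply tends_filterlim; exact (epsilon_spec _ _ Hw).
    - intros Hw; assert (Hw' : gen Sn_lim v w) by (constructor; exact Hw).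
      split; [now exists w|].
      apply (@gen_unique X Sn_lim v); auto; apply epsilon_spec; now exists w. }
  apply cone_antisym.
  - apply (minimal_least hV Sn_lim_substochastic HgenH); auto.
    intros v Hv; simpl.
    assert (Hg := Sn_lim_gen Hv); split; [now exists (A v [+] B v)|].
    apply (@gen_unique X Sn_lim v); auto; apply epsilon_spec; now exists (A v [+] B v).
  - tapply (@tends_cone X _ eventually _ (fun n => V t u [-] Sn n t u)).
    + exists 0%nat; intros n _; apply majorant_Sn; auto; [apply V_substochastic|apply V_gen].
    + tapply tends_minus; [tapply tends_const|now apply Sn_lim_tends]. }
destruct (cone_generating x) as [u [v [Hu [Hv ->]]]].
transitivity (V t u [-] V t v); [exact (sg_minus V_substochastic u v Ht)|].
rewrite !Hc by auto; symmetry; now apply Sn_lim_minus.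
Qed.

Lemma V_tends t x : 0 <= t -> tends eventually (fun n => Sn n t x) (V t x).
Proof. intros Ht; rewrite V_eq_Sn_lim by auto; now apply Sn_lim_tends. Qed.

Lemma tends_succ (Y : abstract_state_space) (f : nat -> Y) l :
  tends eventually f l -> tends eventually (fun n => f (S n)) l.
Proof.
intros H; apply (proj2 (tends_seq _ _)); intros eps He.
destruct (proj1 (tends_seq _ _) H eps He) as [N HN].
exists N; intros n Hn; apply HN; lia.
Qed.

Lemma IVn_plus n t x y : 0 <= t -> IVn n t (x [+] y) = IVn n t x [+] IVn n t y.
Proof.
intros Ht; replace (IVn n t x) with (IVn n t ((x [+] y) [-] y)) by (f_equal; vec).
rewrite IVn_minus by auto; vec.
Qed.

Lemma IVn_scal n t (k : R) x : 0 <= t -> IVn n t (k [*] x) = k [*] IVn n t x.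
Proof.
intros Ht; apply (is_RInt_unique (V := X)).
apply is_RInt_ext with (fun s => k [*] Vn n s x).
- rewrite Rmin_left, Rmax_right by lra; intros s Hs.
  symmetry; exact (lin_scal (Vn_lin n (Rlt_le _ _ (proj1 Hs))) k x).
- exact (is_RInt_scal (V := X) _ _ _ k _ (IVn_RInt (n := n) (x := x) Ht)).
Qed.

Lemma IVn_add n t h x : 0 <= t -> 0 <= h ->
  IVn n (t + h) x =
  IVn n t x [+] conv (fun k => IVn k h) (fun j => Vn j t x) n.
Proof.
intros Ht Hh; apply (is_RInt_unique (V := X)).
apply (is_RInt_Chasles (V := X) _ 0 t (t + h)); [now apply IVn_RInt|].
apply is_RInt_ext with (fun s => conv (fun k => Vn k (s + - t)) (fun j => Vn j t x) n).
- rewrite Rmin_left, Rmax_right by lra; intros s Hs.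
  rewrite <- Vn_cocycle by lra; f_equal; ring.
- apply (is_RInt_shift (f := fun s => conv (fun k => Vn k s) (fun j => Vn j t x) n)).
  replace (t + - t) with 0 by ring; replace (t + h + - t) with h by ring.
  apply (is_RInt_vsum (f := fun k s => Vn k s (Vn (n - k) t x))).
  intros k _; now apply IVn_RInt.
Qed.

(** * The series of [a] along the iterates and the defect [beta] *)

Definition ak (t : R) (k : nat) (x : X) : R := a_fun Psi A B (IVn k t x).

Lemma a_plus x y : dom A x -> dom A y ->
  a_fun Psi A B (x [+] y) = a_fun Psi A B x + a_fun Psi A B y.
Proof.
intros Hx Hy; unfold a_fun.
change (- Psi (A (x [+] y) [+] B (x [+] y)) =
  - Psi (A x [+] B x) + - Psi (A y [+] B y)).
rewrite (proj2 (dom_plus Hx Hy)), B_plus, !Psi_plus by auto; ring.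
Qed.

Lemma a_scal (k : R) x : dom A x -> a_fun Psi A B (k [*] x) = k * a_fun Psi A B x.
Proof.
intros Hx; unfold a_fun.
change (- Psi (A (k [*] x) [+] B (k [*] x)) = k * - Psi (A x [+] B x)).
rewrite (proj2 (dom_scal k Hx)), B_scal, !Psi_plus, !Psi_scal by auto; ring.
Qed.

Lemma a_ge0 x : dom A x -> cone x -> 0 <= a_fun Psi A B x.
Proof. intros Hd Hx; unfold a_fun; generalize (hAB Hd Hx); lra. Qed.

Lemma ak_plus t k x y : 0 <= t -> ak t k (x [+] y) = ak t k x + ak t k y.
Proof. intros Ht; unfold ak; rewrite IVn_plus by auto; apply a_plus; now apply IVn_gen. Qed.

Lemma ak_scal t k (c : R) x : 0 <= t -> ak t k (c [*] x) = c * ak t k x.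
Proof. intros Ht; unfold ak; rewrite IVn_scal by auto; apply a_scal; now apply IVn_gen. Qed.

Lemma ak_minus t k x y : 0 <= t -> ak t k (x [-] y) = ak t k x - ak t k y.
Proof.
intros Ht; replace (x [-] y) with (x [+] ((-1) [*] y)) by vec.
rewrite ak_plus, ak_scal by auto; ring.
Qed.

Lemma ak_ge0 t k u : 0 <= t -> cone u -> 0 <= ak t k u.
Proof. intros Ht Hu; apply a_ge0; [now apply IVn_gen|now apply IVn_cone]. Qed.

Lemma BIVn_cone n t u : 0 <= t -> cone u -> cone (B (IVn n t u)).
Proof. intros Ht Hu; apply hB_pos; [now apply IVn_gen|now apply IVn_cone]. Qed.

Definition asum (t : R) (x : X) (n : nat) : R :=
  @vsum R_state_space (fun k => ak t k x) n.

Lemma asum_eq n t x : 0 <= t ->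
  asum t x (S n) = Psi x - Psi (Sn (S n) t x) - Psi (B (IVn n t x)).
Proof. apply a_fun_vsum. Qed.

Lemma asum_bound n t u : 0 <= t -> cone u -> 0 <= asum t u n <= <|u|>.
Proof.
intros Ht Hu; split.
- apply (@vsum_cone R_state_space); intros k _; now apply ak_ge0.
- destruct n as [|n]; [apply vnorm_ge_0|].
  rewrite asum_eq, !Psi_cone by (auto; try apply Sn_cone; try apply BIVn_cone; auto).
  generalize (vnorm_ge_0 (Sn (S n) t u)), (vnorm_ge_0 (B (IVn n t u))); lra.
Qed.

Definition asum_lim (t : R) (x : X) : R :=
  epsilon (inhabits 0) (fun l => tends eventually (asum t x) l).

Lemma asum_minus t x y n : 0 <= t -> asum t (x [-] y) n = asum t x n - asum t y n.
Proof.
intros Ht; unfold asum.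
rewrite (vsum_ext (b := fun k => ak t k x [-] ak t k y))
  by (intros; now apply ak_minus).
apply (@vsum_minus R_state_space).
Qed.

Lemma asum_lim_tends t x : 0 <= t -> tends eventually (asum t x) (asum_lim t x).
Proof.
intros Ht; unfold asum_lim; apply epsilon_spec.
assert (Hc : forall u, cone u -> exists l, tends eventually (asum t u) l).
{ intros u Hu; apply (@cone_monotone_cv R_state_space (asum t u) (<|u|>)).
  - apply Rle_refl.
  - intros n; unfold asum; rewrite vsum_step; now apply ak_ge0.
  - intros n; assert (H := @asum_bound n t u Ht Hu).
    change (Rabs (asum t u n) <= <|u|>); rewrite Rabs_pos_eq; lra. }
destruct (cone_generating x) as [u [v [Hu [Hv ->]]]].
destruct (Hc u Hu) as [l Hl]; destruct (Hc v Hv) as [m Hm].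
exists (l - m).
tapply (@tends_ext _ _ _ R_state_space (fun n => asum t u n - asum t v n)).
- exists 0%nat; intros n _; symmetry; now apply asum_minus.
- tapply (@tends_minus _ _ _ R_state_space); auto.
Qed.

Lemma asum_lim_lim t x l : 0 <= t -> tends eventually (asum t x) l -> asum_lim t x = l.
Proof. intros Ht H; tapply (@tends_unique nat eventually _ R_state_space (asum t x)); auto; now apply asum_lim_tends. Qed.

Lemma asum_lim_bound t u : 0 <= t -> cone u -> 0 <= asum_lim t u <= <|u|>.
Proof.
intros Ht Hu; split.
- tapply (@tends_ge_const nat eventually _ (asum t u)); [|now apply asum_lim_tends].
  exists 0%nat; intros n _; now apply asum_bound.
- tapply (@tends_le_const nat eventually _ (asum t u)); [|now apply asum_lim_tends].
  exists 0%nat; intros n _; now apply asum_bound.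
Qed.

Lemma asum_lim_ge_first t u : 0 <= t -> cone u -> ak t 0 u <= asum_lim t u.
Proof.
intros Ht Hu; tapply (@tends_ge_const nat eventually _ (asum t u)); [|now apply asum_lim_tends].
exists 1%nat; intros n Hn; destruct n as [|n]; [lia|].
unfold asum; rewrite vsum_shift.
change (ak t 0 u <= ak t 0 u + @vsum R_state_space (fun k => ak t (S k) u) n).
assert (0 <= @vsum R_state_space (fun k => ak t (S k) u) n); [|lra].
apply (@vsum_cone R_state_space); intros k _; now apply ak_ge0.
Qed.

Lemma asum_lim_minus t x y : 0 <= t -> asum_lim t (x [-] y) = asum_lim t x - asum_lim t y.
Proof.
intros Ht; apply asum_lim_lim; auto.
tapply (@tends_ext _ _ _ R_state_space (fun n => asum t x n - asum t y n)).
- exists 0%nat; intros n _; symmetry; now apply asum_minus.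
- tapply (@tends_minus _ _ _ R_state_space); now apply asum_lim_tends.
Qed.

Lemma asum_lim_lin t : 0 <= t -> is_linear (asum_lim t : X -> R_state_space).
Proof.
intros Ht; constructor.
- intros x y; change (asum_lim t (x [+] y) = asum_lim t x + asum_lim t y).
  replace (asum_lim t x) with (asum_lim t ((x [+] y) [-] y)) by (f_equal; vec).
  rewrite asum_lim_minus by auto; ring.
- intros k x; change (asum_lim t (k [*] x) = k * asum_lim t x).
  apply asum_lim_lim; auto.
  tapply (@tends_ext _ _ _ R_state_space (fun n => k [*] asum t x n)).
  + exists 0%nat; intros n _; unfold asum; rewrite <- (@vsum_scal R_state_space).
    apply vsum_ext; intros j _; symmetry; now apply ak_scal.
  + tapply (@tends_scal _ _ _ R_state_space (fun _ => k)); [tapply tends_const|].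
    now apply asum_lim_tends.
- destruct (cone_bounded_linear X) as [K [HK H]].
  exists (K * 1); split; [lra|].
  apply (H R_state_space (asum_lim t)); [lra| |].
  + intros u v; now apply asum_lim_minus.
  + intros u Hu; change (Rabs (asum_lim t u) <= 1 * <|u|>).
    assert (Hb := asum_lim_bound Ht Hu); rewrite Rabs_pos_eq; lra.
Qed.

(** By [IVn_add], the terms at time [t + h] are those at time [t] plus the Cauchy product of the
    functionals [ak h] with the iterates of [u] at time [t]. *)
Lemma asum_lim_add t h u : 0 <= t -> 0 <= h -> cone u ->
  asum_lim (t + h) u = asum_lim t u + asum_lim h (V t u).
Proof.
intros Ht Hh Hu; apply asum_lim_lim; [lra|].
set (c := conv (Y := R_state_space) (fun k x => ak h k x) (fun j => Vn j t u)).
assert (Hc : tends eventually (vsum c) (asum_lim h (V t u))).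
{ apply (@cauchy_product X R_state_space (ak h) (asum_lim h)) with (c := 1); try lra.
  - intros k x y; now apply ak_minus.
  - intros k x Hx; now apply ak_ge0.
  - intros x Hx; now apply asum_lim_tends.
  - intros x Hx; change (Rabs (asum_lim h x) <= 1 * <|x|>).
    assert (Hb := asum_lim_bound Hh Hx); rewrite Rabs_pos_eq; lra.
  - intros k; now apply Vn_cone.
  - now apply V_tends. }
tapply (@tends_ext _ _ _ R_state_space (fun n => asum t u n + vsum c n)).
- exists 0%nat; intros n _; unfold asum.
  rewrite (vsum_ext (a := fun k => ak (t + h) k u) (b := fun k => ak t k u [+] c k)).
  + symmetry; apply (@vsum_plus R_state_space).
  + intros k _; unfold ak at 1; rewrite IVn_add by auto.
    assert (Hd : forall m, dom A (vsum (fun j => IVn j h (Vn (k - j) t u)) m) /\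
      a_fun Psi A B (vsum (fun j => IVn j h (Vn (k - j) t u)) m) =
      @vsum R_state_space (fun j => ak h j (Vn (k - j) t u)) m).
    { induction m as [|m [IH1 IH2]]; simpl.
      - replace (zero : X) with (0 [*] IVn 0 t u) by vec; split.
        + apply dom_scal, (IVn_gen 0 u Ht).
        + rewrite a_scal by apply (IVn_gen 0 u Ht); apply Rmult_0_l.
      - assert (H2 := proj1 (IVn_gen m (Vn (k - m) t u) Hh)); split.
        + now apply dom_plus.
        + rewrite a_plus, IH2 by auto; reflexivity. }
    unfold conv; rewrite a_plus by (apply (IVn_gen k u Ht) || apply (Hd (S k))).
    rewrite (proj2 (Hd (S k))); reflexivity.
- apply (@tends_plus _ _ _ R_state_space); auto; now apply asum_lim_tends.
Qed.

(* The limit of [Psi (B (IVn n t x))], see [beta_tends]. *)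
Definition beta (t : R) (x : X) : R := Psi x - Psi (V t x) - asum_lim t x.

Lemma beta_tends t x : 0 <= t ->
  tends eventually (fun n => Psi (B (IVn n t x)) : R_state_space) (beta t x).
Proof.
intros Ht.
tapply (@tends_ext _ _ _ R_state_space
  (fun n => Psi x - Psi (Sn (S n) t x) - asum t x (S n))).
- exists 0%nat; intros n _; rewrite asum_eq by auto; ring_R.
- apply (@tends_minus _ _ _ R_state_space); filt.
  + apply (@tends_minus _ _ _ R_state_space); filt; [tapply tends_const|].
    apply (tends_linear (L := Psi : X -> R_state_space)); [exact Psi_lin|].
    apply (tends_succ (f := fun n => Sn n t x)); now apply V_tends.
  + apply (tends_succ (f := asum t x : nat -> R_state_space)); now apply asum_lim_tends.
Qed.

(** The lower bound comes from [beta] as a limit of norms, the upper one from the positivity of the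
    series of [a]. *)
Lemma beta_bound t u : 0 <= t -> cone u -> 0 <= beta t u <= <|u|> - <|V t u|>.
Proof.
intros Ht Hu; split.
- tapply (@tends_ge_const nat eventually _ (fun n => Psi (B (IVn n t u)))).
  + exists 0%nat; intros n _; rewrite Psi_cone; [apply vnorm_ge_0|now apply BIVn_cone].
  + now apply beta_tends.
- unfold beta; rewrite !Psi_cone by (auto; now apply (sg_cone V_substochastic)).
  generalize (asum_lim_bound Ht Hu); lra.
Qed.

Lemma beta_minus t x y : 0 <= t -> beta t (x [-] y) = beta t x - beta t y.
Proof.
intros Ht; unfold beta; rewrite (sg_minus V_substochastic), !Psi_minus, asum_lim_minus by auto; ring.
Qed.

Lemma beta_lin t : 0 <= t -> is_linear (beta t : X -> R_state_space).
Proof.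
intros Ht; constructor.
- intros x y; change (beta t (x [+] y) = beta t x + beta t y).
  replace (beta t x) with (beta t ((x [+] y) [-] y)) by (f_equal; vec).
  rewrite beta_minus by auto; ring.
- intros k x; change (beta t (k [*] x) = k * beta t x); unfold beta.
  rewrite (sg_scal V_substochastic), !Psi_scal by auto.
  assert (H := lin_scal (asum_lim_lin Ht) k x); change (asum_lim t (k [*] x) = k * asum_lim t x) in H.
  rewrite H; ring.
- destruct (cone_bounded_linear X) as [K [HK H]].
  exists (K * 1); split; [lra|].
  apply (H R_state_space (beta t)); [lra| |].
  + intros u v; now apply beta_minus.
  + intros u Hu; change (Rabs (beta t u) <= 1 * <|u|>).
    assert (Hb := beta_bound Ht Hu); rewrite Rabs_pos_eq by lra.
    generalize (vnorm_ge_0 (V t u)); lra.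
Qed.

Lemma beta_add t h u : 0 <= t -> 0 <= h -> cone u ->
  beta (t + h) u = beta t u + beta h (V t u).
Proof.
intros Ht Hh Hu; unfold beta; rewrite asum_lim_add by auto.
rewrite Rplus_comm, (sg_add V_substochastic) by auto; ring.
Qed.

Lemma beta_time0 u : cone u -> beta 0 u = 0.
Proof.
intros Hu; assert (H := beta_bound (Rle_refl 0) Hu).
rewrite (sg_zero V_substochastic) in H; lra.
Qed.

Lemma beta_cont u : cone u -> cont_nonneg (fun s => beta s u : R_state_space).
Proof.
intros Hu; destruct (sg_bounded V_substochastic) as [K [HK Hb]].
apply (cont_nonneg_modulus (g := fun h => K * <|V h u [-] u|>)).
- intros s h Hs Hh; rewrite beta_add by (auto; lra).
  change (Rabs (beta s u + beta h (V s u) - beta s u) <= K * <|V h u [-] u|>).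
  assert (Hc := sg_cone V_substochastic Hs Hu).
  assert (H := beta_bound (Rlt_le _ _ Hh) Hc).
  rewrite Rabs_pos_eq by lra.
  apply Rle_trans with (<|V s (V h u) [-] V s u|>).
  + rewrite <- !(sg_add V_substochastic) in * by lra; rewrite Rplus_comm in H.
    assert (H1 := norm_le_minus (V s u) (V (s + h) u)).
    rewrite norm_minus_sym in H1; lra.
  + rewrite <- (sg_minus V_substochastic) by auto; now apply Hb.
- tapply tends_zero_mult; tapply tends_norm_zero; apply (sg_tends V_substochastic).
Qed.

Definition V_int (t : R) (u : X) : X := RInt (fun s => V s u) 0 t.

Lemma V_int_gen t u : 0 <= t -> gen V (V_int t u) (V t u [-] u).
Proof. intros Ht; now apply (gen_integral V_substochastic). Qed.

(** Since [beta h] is a bounded functional, it passes under the integral; additivity along the orbit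
    turns the integrand into an increment of s -> beta_s(u), and the integral into a sliding
    window. *)
Lemma beta_V_int t u : 0 <= t -> cone u ->
  tends (at_right 0) (fun h => / h * beta h (V_int t u)) (beta t u).
Proof.
intros Ht Hu.
assert (H := RInt_shift_tends Ht (beta_cont Hu)); cbv beta in H.
rewrite (beta_time0 Hu) in H.
assert (E : beta t u [-] 0 = beta t u) by (exact (Rminus_0_r _)).
rewrite E in H; refine (tends_ext _ H).
generalize at_right_pos; apply filter_imp; intros h Hh.
change (/ h * (RInt (V := R_state_space) (fun s => beta (s + h) u) 0 t -
  RInt (V := R_state_space) (fun s => beta s u) 0 t) = / h * beta h (V_int t u)).
f_equal.
assert (Hex : forall f : R -> R_state_space, cont_nonneg f -> is_RInt f 0 t (RInt f 0 t)).
{ intros f Hf; apply (RInt_correct (V := R_state_space)), ex_RInt_cont_nonneg; auto; lra. }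
assert (Hcs : cont_nonneg (fun s => beta (s + h) u : R_state_space)).
{ intros s Hs eps He.
  destruct (@beta_cont u Hu (s + h) ltac:(lra) eps He) as [d [Hd Hd']].
  exists d; split; auto; intros r Hr Hrs; apply Hd'; [lra|].
  replace (r + h - (s + h)) with (r - s) by ring; auto. }
assert (H1 := is_RInt_minus_vec (Hex _ Hcs) (Hex _ (beta_cont Hu))).
assert (H2 := is_RInt_linear (beta_lin (Rlt_le _ _ Hh))
  (sg_is_RInt V_substochastic (u := u) (Rle_refl 0) Ht)).
refine (filterlim_locally_unique (V := R_state_space) _ _ _ H1 _).
refine (is_RInt_ext (V := R_state_space) _ _ _ _ _ _ H2).
rewrite Rmin_left, Rmax_right by lra; intros s Hs.
rewrite beta_add by (auto; lra).
change (beta h (V s u) = beta s u + beta h (V s u) - beta s u); ring.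
Qed.

Lemma a_hat_V_int t u : 0 <= t -> cone u ->
  a_hat Psi A B Vn (RInt (fun s => V s u) 0 t) = <|u|> - <|V t u|> - beta t u.
Proof.
intros Ht Hu.
(* [a_hat] is total, so its value is only meaningful once the limit is exhibited. *)
apply (iota_filterlim_locally (V := R_CompleteNormedModule)).
fold (V_int t u); apply (@tends_filterlim _ _ R_state_space).
assert (H1 : tends (at_right 0)
  (fun h => - Psi (/ h [*] (V h (V_int t u) [-] V_int t u)) - / h * beta h (V_int t u))
  (- Psi (V t u [-] u) - beta t u)).
{ apply (@tends_minus _ _ _ R_state_space); filt; [|now apply beta_V_int].
  apply (@tends_opp _ _ R_state_space).
  apply (tends_linear (L := Psi : X -> R_state_space)); [exact Psi_lin|].
  now apply V_int_gen. }
rewrite Psi_minus, !Psi_cone in H1 by (auto; now apply (sg_cone V_substochastic)).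
replace (- (<|V t u|> - <|u|>) - beta t u) with (<|u|> - <|V t u|> - beta t u)
  in H1 by ring.
refine (tends_ext _ H1).
generalize at_right_pos; apply filter_imp; intros h Hh.
rewrite Psi_scal, Psi_minus.
replace (Series _) with (asum_lim h (V_int t u)).
- unfold beta; ring_R.
- symmetry; apply is_series_unique.
  (* Partial sums of [Series] include the term of index [n], those of [asum] do not; hence the
     shift. *)
  assert (H2 := tends_succ (asum_lim_tends (V_int t u) (Rlt_le _ _ Hh))).
  refine (filterlim_ext _ _ _ (tends_filterlim H2)).
  intros n; induction n as [|n IH].
  + rewrite sum_O; exact (Rplus_0_l _).
  + rewrite sum_Sn, <- IH; reflexivity.
Qed.

Lemma mild_honest_beta u : cone u ->
  (mild_honest Psi A B Vn V u <-> forall t, 0 < t -> beta t u = 0).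
Proof.
intros Hu; unfold mild_honest; split; intros H t Ht.
- assert (H1 := H t (Rlt_le _ _ Ht)); rewrite a_hat_V_int in H1 by (auto; lra).
  change (<|V t u|> = <|u|> - (<|u|> - <|V t u|> - beta t u)) in H1; lra.
- rewrite a_hat_V_int by auto.
  assert (H1 : beta t u = 0).
  { destruct (Req_dec t 0) as [->|Ht0]; [now apply beta_time0|apply H; lra]. }
  change (<|V t u|> = <|u|> - (<|u|> - <|V t u|> - beta t u)); lra.
Qed.

Lemma vanishing_beta u t : cone u -> 0 < t ->
  (is_lim_seq (fun n => norm (B (RInt (fun s => Vn n s u) 0 t))) 0 <-> beta t u = 0).
Proof.
intros Hu Ht.
assert (H : tends eventually (fun n => <|B (IVn n t u)|> : R_state_space) (beta t u)).
{ tapply (@tends_ext _ _ _ R_state_space (fun n => Psi (B (IVn n t u)))).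
  - exists 0%nat; intros n _; apply Psi_cone, BIVn_cone; auto; lra.
  - apply beta_tends; lra. }
split.
- intros H0; tapply (@tends_unique nat eventually _ R_state_space (fun n => <|B (IVn n t u)|>)); auto.
  constructor; exact H0.
- intros E; rewrite E in H; exact (tends_filterlim H).
Qed.

(** * Exchange of the sum of the iterates with the time integral *)

Definition IVsum (n : nat) (t : R) (x : X) : X := vsum (fun k => IVn k t x) n.

Lemma IVsum_RInt n t x : 0 <= t -> is_RInt (fun s => Sn n s x) 0 t (IVsum n t x).
Proof.
intros Ht; apply (is_RInt_vsum (f := fun k s => Vn k s x)).
intros k _; now apply IVn_RInt.
Qed.

Lemma IVsum_bound n t u : 0 <= t -> cone u -> <|IVsum n t u|> <= t * <|u|>.
Proof.
intros Ht Hu; rewrite <- (Rminus_0_r t) at 2.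
apply (norm_is_RInt_const Ht) with (2 := IVsum_RInt (n := n) (x := u) Ht).
intros s Hs; apply Sn_contr; auto; lra.
Qed.

Definition IVsum_lim (t : R) (x : X) : X :=
  epsilon (inhabits zero) (fun l => tends eventually (fun n => IVsum n t x) l).

Lemma IVsum_lim_tends t u : 0 <= t -> cone u -> tends eventually (fun n => IVsum n t u) (IVsum_lim t u).
Proof.
intros Ht Hu; unfold IVsum_lim; apply epsilon_spec.
apply (@cone_monotone_cv X (fun n => IVsum n t u) (t * <|u|>)).
- apply cone_zero.
- intros n; unfold IVsum; rewrite vsum_step; now apply IVn_cone.
- intros n; now apply IVsum_bound.
Qed.

Lemma IVsum_lim_bound t u : 0 <= t -> cone u -> <|IVsum_lim t u|> <= t * <|u|>.
Proof.
intros Ht Hu; tapply (@tends_le_const nat eventually _ (fun n => <|IVsum n t u|>)).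
- exists 0%nat; intros n _; now apply IVsum_bound.
- tapply tends_norm_real; now apply IVsum_lim_tends.
Qed.

Lemma IVsum_lim_add t h u : 0 <= t -> 0 <= h -> cone u ->
  IVsum_lim (t + h) u = IVsum_lim t u [+] IVsum_lim h (V t u).
Proof.
intros Ht Hh Hu.
tapply (@tends_unique nat eventually _ X (fun n => IVsum n (t + h) u)).
- apply IVsum_lim_tends; auto; lra.
- tapply (@tends_ext _ _ _ X (fun n => IVsum n t u [+]
    vsum (conv (fun k => IVn k h) (fun j => Vn j t u)) n)).
  + exists 0%nat; intros n _; unfold IVsum; rewrite <- vsum_plus.
    apply vsum_ext; intros k _; symmetry; now apply IVn_add.
  + tapply tends_plus; [now apply IVsum_lim_tends|].
    apply (@cauchy_product X X (fun k => IVn k h) (IVsum_lim h)) with (c := h); auto.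
    * intros k x y; now apply IVn_minus.
    * intros k x Hx; now apply IVn_cone.
    * intros x Hx; now apply IVsum_lim_tends.
    * intros x Hx; now apply IVsum_lim_bound.
    * intros k; now apply Vn_cone.
    * now apply V_tends.
Qed.

Lemma IVsum_lim_deriv u : cone u -> tends (at_right 0) (fun h => / h [*] IVsum_lim h u) u.
Proof.
intros Hu; apply (proj2 (tends_at_right _ _)); intros eps He.
assert (He2 : 0 < eps / 3) by lra.
destruct (small_times (sg_cont hU u) He2) as [d [Hd H]].
rewrite (sg_zero hU) in H.
exists d; split; auto; intros h Hh.
assert (Hhi : 0 < / h) by (apply Rinv_0_lt_compat; lra).
apply Rle_lt_trans with (2 * (eps / 3)); [|lra].
tapply (@tends_le_const nat eventually _ (fun n => <|/ h [*] IVsum (S n) h u [-] u|>)).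
- exists 0%nat; intros n _.
  replace (/ h [*] IVsum (S n) h u [-] u) with
    (/ h [*] (IVsum (S n) h u [-] ((h - 0) [*] u))) by (vec; field; lra).
  rewrite norm_scal_pos by lra.
  apply Rmult_le_reg_l with h; [lra|].
  rewrite <- Rmult_assoc, Rinv_r, Rmult_1_l by lra.
  rewrite <- (Rminus_0_r h) at 3.
  apply norm_is_RInt_const with (fun s => Sn (S n) s u [-] u); [lra| |].
  + intros s Hs; rewrite Sn_succ by lra.
    replace (_ [-] _) with ((U s u [-] u) [+] tail n s u) by vec.
    apply Rle_trans with (1 := vnorm_triangle _ _).
    assert (H1 := H s ltac:(lra)).
    assert (H2 := tail_bound n (proj1 Hs) Hu).
    assert (H3 := norm_le_minus u (U s u)); rewrite norm_minus_sym in H3; lra.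
  + apply is_RInt_minus_vec; [apply IVsum_RInt; lra|apply is_RInt_const_vec].
- tapply tends_norm_real; tapply tends_minus; [|tapply tends_const].
  tapply (@tends_scal _ _ _ X (fun _ => / h)); [tapply tends_const|].
  apply (tends_succ (f := fun n => IVsum n h u)), IVsum_lim_tends; auto; lra.
Qed.

(** In place of a dominated convergence theorem: the sum of the integrals vanishes at time 0, is
    continuous, and by additivity along the orbit has right derivative [V t u]. *)
Lemma IVsum_lim_eq t u : 0 <= t -> cone u -> IVsum_lim t u = V_int t u.
Proof.
intros Ht Hu; symmetry; apply (is_RInt_unique (V := X)).
assert (J0 : IVsum_lim 0 u = zero).
{ apply vnorm_eq_zero, Rle_antisym; [|apply vnorm_ge_0].
  generalize (IVsum_lim_bound (Rle_refl 0) Hu); lra. }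
replace (IVsum_lim t u) with (IVsum_lim t u [-] IVsum_lim 0 u) by (rewrite J0; vec).
apply (is_RInt_right_derivative (f := fun s => IVsum_lim s u)); auto.
- apply cont_nonneg_on; [lra|].
  apply (cont_nonneg_modulus (g := fun h => h * <|u|>)).
  + intros s h Hs Hh; rewrite IVsum_lim_add by (auto; lra).
    replace (_ [-] _) with (IVsum_lim h (V s u)) by vec.
    apply Rle_trans with (h * <|V s u|>).
    * apply IVsum_lim_bound; [lra|now apply (sg_cone V_substochastic)].
    * apply Rmult_le_compat_l; [lra|now apply (sg_contr V_substochastic)].
  + tapply (@tends_ext _ _ _ R_state_space (fun h => <|u|> * h)).
    * apply filter_forall; intros h; apply Rmult_comm.
    * tapply tends_zero_mult; apply (proj2 (tends_at_right _ _)).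
      intros eps He; exists eps; split; auto; intros h Hh.
      change (Rabs (h - 0) < eps); rewrite Rminus_0_r, Rabs_pos_eq; lra.
- apply cont_nonneg_on; [lra|apply (sg_cont V_substochastic)].
- intros s Hs; refine (tends_ext _ (IVsum_lim_deriv (sg_cone V_substochastic (proj1 Hs) Hu))).
  generalize at_right_pos; apply filter_imp; intros h Hh.
  rewrite IVsum_lim_add by (auto; lra); vec.
Qed.

Lemma IVsum_tends t u : 0 <= t -> cone u ->
  tends eventually (fun n => IVsum n t u) (V_int t u).
Proof. intros Ht Hu; rewrite <- IVsum_lim_eq by auto; now apply IVsum_lim_tends. Qed.

Lemma IVsum_gen n t u : 0 <= t ->
  dom A (IVsum (S n) t u) /\
  A (IVsum (S n) t u) [+] B (IVsum (S n) t u) =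
  Sn (S n) t u [-] u [+] B (IVn n t u).
Proof.
intros Ht; split; [apply (IVn_sum_gen (S n) u Ht)|apply (IVn_sum_gen n u Ht)].
Qed.

(** * Behaviour of [beta] for small times and the closure of A+B *)

(** The means of U(s)v over [0,h] tend to [v] in the graph norm of [A], for which [a] is continuous;
    the limit is a(v). *)
Lemma first_term_tends v : dom A v ->
  tends (at_right 0) (fun h => / h * ak h 0 v) (- Psi (A v) - Psi (B v)).
Proof.
intros Hv.
assert (HI : forall h, 0 < h -> dom A (/ h [*] IVn 0 h v) /\
  A (/ h [*] IVn 0 h v) = / h [*] (U h v [-] v)).
{ intros h Hh; destruct (IVn_gen 0 v (Rlt_le _ _ Hh)) as [H1 H2].
  destruct (dom_scal (/ h) H1) as [H3 H4]; split; auto.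
  rewrite H4, H2, (dp_zero hVn) by lra; reflexivity. }
assert (HA : tends (at_right 0) (fun h => A (/ h [*] IVn 0 h v)) (A v)).
{ refine (tends_ext _ (dom_gen Hv)).
  generalize at_right_pos; apply filter_imp; intros h Hh.
  symmetry; now apply HI. }
assert (HB : tends (at_right 0) (fun h => B (/ h [*] IVn 0 h v)) (B v)).
{ tapply B_tends; auto.
  - generalize at_right_pos; apply filter_imp; intros h Hh; now apply HI.
  - refine (tends_ext _ (sg_mean_tends hU v)).
    generalize at_right_pos; apply filter_imp; intros h Hh; f_equal.
    apply (RInt_ext (V := X)); rewrite Rmin_left, Rmax_right by lra.
    intros s Hs; symmetry; apply (dp_zero hVn); lra. }
tapply (@tends_ext _ _ _ R_state_space
  (fun h => - Psi (A (/ h [*] IVn 0 h v)) - Psi (B (/ h [*] IVn 0 h v)))).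
- generalize at_right_pos; apply filter_imp; intros h Hh.
  assert (Hd := proj1 (IVn_gen 0 v (Rlt_le _ _ Hh))).
  rewrite (proj2 (dom_scal (/ h) Hd)), (B_scal (/ h) Hd), !Psi_scal.
  unfold ak, a_fun.
  change (- (/ h * Psi (A (IVn 0 h v))) - / h * Psi (B (IVn 0 h v)) =
    / h * - Psi (A (IVn 0 h v) [+] B (IVn 0 h v))).
  rewrite Psi_plus; ring.
- apply (@tends_minus _ _ _ R_state_space); filt.
  + apply (@tends_opp _ _ R_state_space).
    apply (tends_linear (L := Psi : X -> R_state_space)); [exact Psi_lin|auto].
  + apply (tends_linear (L := Psi : X -> R_state_space)); [exact Psi_lin|auto].
Qed.

Lemma beta_dom_cone v : dom A v -> cone v ->
  tends (at_right 0) (fun h => / h * beta h v) 0.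
Proof.
intros Hd Hv.
assert (H : tends (at_right 0)
  (fun h => - Psi (/ h [*] (V h v [-] v)) - / h * ak h 0 v)
  (- Psi (A v [+] B v) - (- Psi (A v) - Psi (B v)))).
{ apply (@tends_minus _ _ _ R_state_space); filt; [|now apply first_term_tends].
  apply (@tends_opp _ _ R_state_space).
  apply (tends_linear (L := Psi : X -> R_state_space)); [exact Psi_lin|now apply V_gen]. }
rewrite Psi_plus in H.
replace (- (Psi (A v) + Psi (B v)) - (- Psi (A v) - Psi (B v))) with 0 in H by ring.
(* The series of [a] is bounded below by its first term, so [beta h v] is at most the loss of mass
   under [V] minus that term; divided by [h], both tend to a(v). *)
refine (tends_squeeze (X := R_state_space) _ H).
generalize at_right_pos; apply filter_imp; intros h Hh.
assert (Hh0 : 0 <= h) by lra.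
assert (H1 := beta_bound Hh0 Hv).
assert (Hhi : 0 < / h) by now apply Rinv_0_lt_compat.
change (Rabs (/ h * beta h v - 0) <= - Psi (/ h [*] (V h v [-] v)) - / h * ak h 0 v).
rewrite Rminus_0_r, Rabs_pos_eq by (apply Rmult_le_pos; lra).
rewrite Psi_scal, Psi_minus.
replace (- (/ h * (Psi (V h v) - Psi v)) - / h * ak h 0 v) with
  (/ h * (Psi v - Psi (V h v) - ak h 0 v)) by ring.
apply Rmult_le_compat_l; [lra|].
unfold beta; generalize (asum_lim_ge_first Hh0 Hv); lra.
Qed.

Lemma beta_dom v : dom A v -> tends (at_right 0) (fun h => / h * beta h v) 0.
Proof.
intros Hv; destruct (gen_positive_decomposition hU) as [C [_ Hdec]].
destruct (Hdec v (A v) (dom_gen Hv)) as [v1 [v2 [w1 [w2 [H1 [H2 [Hg1 [Hg2 [-> _]]]]]]]]].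
assert (Ht := @tends_minus _ _ _ R_state_space _ _ _ _
  (beta_dom_cone (proj1 (gen_dom Hg1)) H1) (beta_dom_cone (proj1 (gen_dom Hg2)) H2)).
assert (E : (0 : R_state_space) [-] (0 : R_state_space) = 0) by exact (Rminus_0_r 0).
rewrite E in Ht; refine (tends_ext _ Ht).
generalize at_right_pos; apply filter_imp; intros h Hh.
rewrite beta_minus by lra.
change (/ h * beta h v1 - / h * beta h v2 = / h * (beta h v1 - beta h v2)); ring.
Qed.

(** The factor [h] appears because on positive elements of D(G) [beta] is at most the loss of mass,
    which is an integral over [0,h] of the orbit of the generator's value. The decomposition is now
    the one for [V]. *)
Lemma beta_graph_bound : exists C, 0 < C /\ forall h x z, 0 < h -> gen V x z ->
  Rabs (beta h x) <= h * (C * (<|x|> + <|z|>)).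
Proof.
destruct (gen_positive_decomposition V_substochastic) as [C [HC Hdec]].
destruct (sg_bounded V_substochastic) as [K [HK HKb]].
destruct Psi_bounded as [P [HP HPb]].
exists (2 * (P * K * C)); split; [repeat apply Rmult_lt_0_compat; lra|].
intros h x z Hh Hg.
destruct (Hdec x z Hg) as [x1 [x2 [z1 [z2 [H1 [H2 [Hg1 [Hg2 [Hx [_ [Hz1 Hz2]]]]]]]]]]].
assert (Hb : forall y w, cone y -> gen V y w -> <|w|> <= C * (<|x|> + <|z|>) ->
  Rabs (beta h y) <= h * (P * K * C * (<|x|> + <|z|>))).
{ intros y w Hy Hgy Hw.
  assert (Hh0 : 0 <= h) by lra.
  assert (Hbd := beta_bound Hh0 Hy); rewrite Rabs_pos_eq by lra.
  apply Rle_trans with (Rabs (Psi (V h y [-] y))).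
  - rewrite Psi_minus, !Psi_cone by (auto; now apply (sg_cone V_substochastic)).
    rewrite Rabs_minus_sym; apply Rle_trans with (2 := Rle_abs _); lra.
  - apply Rle_trans with (1 := HPb _).
    replace (h * (P * K * C * (<|x|> + <|z|>))) with
      (P * ((h - 0) * (K * (C * (<|x|> + <|z|>))))) by ring.
    apply Rmult_le_compat_l; [lra|].
    apply norm_is_RInt_const with (3 := gen_FTC V_substochastic Hh0 Hgy); [lra|].
    intros s Hs; apply Rle_trans with (K * <|w|>); [apply HKb; lra|].
    apply Rmult_le_compat_l; lra. }
rewrite Hx at 1; rewrite beta_minus by lra.
apply Rle_trans with (1 := Rabs_triang _ _); rewrite Rabs_Ropp.
generalize (Hb x1 z1 H1 Hg1 Hz1), (Hb x2 z2 H2 Hg2 Hz2); lra.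
Qed.

Lemma closure_gen x y : in_graph_closure (perturbed A B) x y ->
  exists v : nat -> X, (forall n, dom A (v n)) /\ tends eventually v x /\
    tends eventually (fun n => A (v n) [+] B (v n)) y.
Proof.
intros H.
assert (Hn : forall n : nat, exists v, dom A v /\ <|v [-] x|> < / (INR n + 1) /\
  <|(A v [+] B v) [-] y|> < / (INR n + 1)).
{ intros n; apply (H (/ (INR n + 1))), Rinv_0_lt_compat.
  generalize (pos_INR n); lra. }
set (f n := constructive_indefinite_description _ (Hn n)).
assert (Hlim : forall (g : nat -> X) l,
  (forall n, <|g n [-] l|> < / (INR n + 1)) -> tends eventually g l).
{ intros g l Hg; apply (proj2 (tends_seq _ _)); intros eps He.
  destruct (INR_unbounded (/ eps)) as [N HN].
  exists N; intros n Hn'; apply Rlt_trans with (1 := Hg n).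
  rewrite <- (Rinv_inv eps); apply Rinv_lt_contravar.
  - apply Rmult_lt_0_compat; [now apply Rinv_0_lt_compat|].
    generalize (pos_INR n); lra.
  - apply le_INR in Hn'; lra. }
exists (fun n => proj1_sig (f n)); split; [|split].
- intros n; apply (proj2_sig (f n)).
- apply Hlim; intros n; apply (proj2_sig (f n)).
- apply Hlim; intros n; apply (proj2_sig (f n)).
Qed.

Lemma beta_of_closure t u : 0 < t -> cone u ->
  closure_dom (perturbed A B) (V_int t u) -> beta t u = 0.
Proof.
intros Ht Hu [y Hy].
assert (Ht0 : 0 <= t) by lra.
destruct (closure_gen Hy) as [v [Hd [Hv Hw]]].
assert (Hgy : gen V (V_int t u) y).
{ apply (gen_closed V_substochastic (u := v) (w := fun n => A (v n) [+] B (v n))); auto.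
  intros n; now apply V_gen. }
destruct beta_graph_bound as [C [HC Hb]].
assert (Hz : Rabs (beta t u) <= 0).
{ apply le_epsilon; intros eps He; rewrite Rplus_0_l.
  (* The approximation errors of the vector and of its image are each below [e], so the graph bound
     is at most C * (2 * e) = eps. *)
  set (e := eps / (2 * C)).
  assert (He' : 0 < e) by (apply Rdiv_lt_0_compat; lra).
  destruct (proj1 (tends_seq _ _) Hv e He') as [N1 HN1].
  destruct (proj1 (tends_seq _ _) Hw e He') as [N2 HN2].
  set (n := (N1 + N2)%nat).
  assert (H1 : <|v n [-] V_int t u|> < e) by (apply HN1; unfold n; lia).
  assert (H2 : <|(A (v n) [+] B (v n)) [-] y|> < e) by (apply HN2; unfold n; lia).
  assert (Hlim := @tends_minus _ _ _ R_state_space _ _ _ _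
    (beta_V_int Ht0 Hu) (beta_dom (Hd n))).
  assert (E : beta t u [-] (0 : R_state_space) = beta t u) by exact (Rminus_0_r _).
  rewrite E in Hlim.
  apply (@tends_le_const _ (at_right 0) _
    (fun h => Rabs (/ h * beta h (V_int t u) - / h * beta h (v n)))).
  - generalize at_right_pos; apply filter_imp; intros h Hh.
    assert (Hhi : 0 < / h) by now apply Rinv_0_lt_compat.
    rewrite <- Rmult_minus_distr_l, Rabs_mult, (Rabs_pos_eq (/ h)) by lra.
    rewrite <- beta_minus by lra.
    apply Rmult_le_reg_l with h; auto.
    rewrite <- Rmult_assoc, Rinv_r, Rmult_1_l by lra.
    apply Rle_trans with (1 := Hb h _ _ Hh (gen_minus V_substochastic Hgy (V_gen (Hd n)))).
    apply Rmult_le_compat_l; [lra|].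
    rewrite (norm_minus_sym (V_int t u)), (norm_minus_sym y).
    replace eps with (C * (2 * e)) by (unfold e; field; lra).
    apply Rmult_le_compat_l; lra.
  - exact (tends_norm_real Hlim). }
generalize (Rabs_pos (beta t u)); intros H0.
destruct (Req_dec (beta t u) 0) as [|Hne]; auto.
apply Rabs_pos_lt in Hne; lra.
Qed.

Lemma BIVn_norm_tends t u : 0 < t -> cone u -> beta t u = 0 ->
  tends eventually (fun n => B (IVn n t u)) zero.
Proof.
intros Ht Hu Hbeta; assert (Ht0 : 0 <= t) by lra.
apply (tends_to_zero (g := fun n => Psi (B (IVn n t u)))).
- exists 0%nat; intros n _; rewrite Psi_cone by (now apply BIVn_cone).
  apply Rle_refl.
- rewrite <- Hbeta; now apply beta_tends.
Qed.

(** The approximants are the sums of integrated iterates: their images under A+B tend to V(t)u - u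
    exactly when the last contribution of [B] disappears. *)
Lemma closure_of_beta t u : 0 < t -> cone u -> beta t u = 0 ->
  closure_dom (perturbed A B) (V_int t u).
Proof.
intros Ht Hu Hbeta; exists (V t u [-] u); intros eps He.
assert (Ht0 : 0 <= t) by lra.
assert (H1 := tends_succ (IVsum_tends Ht0 Hu)).
assert (Hn := BIVn_norm_tends Ht Hu Hbeta).
assert (H2 := tends_plus (tends_minus (tends_succ (V_tends u Ht0)) (tends_const u)) Hn).
assert (E : (V t u [-] u) [+] (zero : X) = V t u [-] u) by vec.
rewrite E in H2.
destruct (proj1 (tends_seq _ _) H1 eps He) as [N1 HN1].
destruct (proj1 (tends_seq _ _) H2 eps He) as [N2 HN2].
destruct (IVsum_gen (N1 + N2) u Ht0) as [H3 H4].
exists (IVsum (S (N1 + N2)) t u); split; [exact H3|split].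
- apply HN1; lia.
- change (<|(A (IVsum (S (N1 + N2)) t u) [+] B (IVsum (S (N1 + N2)) t u)) [-]
    (V t u [-] u)|> < eps).
  rewrite H4; apply HN2; lia.
Qed.

(* [Psi] composed with the mean [y -> RInt V y] annihilates weak cluster points
   of [B (IVn n t u)]; no separation theorem is needed. *)
Lemma cluster_beta t u y : 0 < t -> cone u ->
  (forall P, weak_nbhd y P -> forall N, exists n, (N <= n)%nat /\ P (B (IVn n t u))) ->
  beta t u = 0.
Proof.
intros Ht Hu Hcl; assert (Ht0 : 0 <= t) by lra.
(* A functional that converges along the whole sequence takes its limit as value at the cluster
   point. *)
assert (Hval : forall (f : X -> R) l, functional f ->
  tends eventually (fun n => f (B (IVn n t u)) : R_state_space) l -> f y = l).
{ intros f l Hf Hl; apply (@norm_minus_eq0 R_state_space), Rle_antisym; [|apply vnorm_ge_0].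
  apply le_epsilon; intros eps He; rewrite Rplus_0_l.
  assert (He2 : 0 < eps / 2) by lra.
  destruct (proj1 (tends_seq _ _) Hl _ He2) as [N HN].
  destruct (Hcl (fun z => Rabs (f z - f y) < eps / 2)) with (N := N) as [n [Hn Hfn]].
  { exists (cons f nil), (eps / 2); split; auto; split.
    - intros g [<-|[]]; auto.
    - intros z Hz; apply Hz; now left. }
  assert (H := HN n Hn).
  change (Rabs (f (B (IVn n t u)) - l) < eps / 2) in H.
  change (Rabs (f y - l) <= eps).
  apply Rabs_def2 in H; apply Rabs_def2 in Hfn; apply Rabs_le; lra. }
rewrite <- (Hval Psi (beta t u) (proj1 hPsi) (beta_tends u Ht0)).
set (M h x := RInt (fun s => V s x) 0 h).
destruct (sg_bounded V_substochastic) as [K [HK HKb]].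
assert (HM : forall h x, 0 <= h -> is_RInt (fun s => V s x) 0 h (M h x))
  by (intros h x Hh; apply (sg_is_RInt V_substochastic); auto; lra).
assert (HMm : forall h x z, 0 <= h -> M h (x [-] z) = M h x [-] M h z).
{ intros h x z Hh; apply (is_RInt_unique (V := X)).
  apply is_RInt_ext with (fun s => V s x [-] V s z).
  - rewrite Rmin_left, Rmax_right by lra; intros s Hs; rewrite (sg_minus V_substochastic) by lra; auto.
  - now apply is_RInt_minus_vec; apply HM. }
assert (HMl : forall h, 0 < h -> is_linear (M h)).
{ intros h Hh; assert (Hh0 : 0 <= h) by lra; constructor.
  - intros x z; change (M h (x [+] z) = M h x [+] M h z).
    replace (M h x) with (M h ((x [+] z) [-] z)) by (f_equal; vec).
    rewrite HMm by auto; vec.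
  - intros k x; change (M h (k [*] x) = k [*] M h x).
    apply (is_RInt_unique (V := X)), is_RInt_ext with (fun s => k [*] V s x).
    + rewrite Rmin_left, Rmax_right by lra; intros s Hs; rewrite (sg_scal V_substochastic) by lra; auto.
    + exact (is_RInt_scal (V := X) _ _ _ k _ (HM h x Hh0)).
  - exists (h * K); split; [now apply Rmult_lt_0_compat|].
    intros x; change (<|M h x|> <= h * K * <|x|>).
    replace (h * K * <|x|>) with ((h - 0) * (K * <|x|>)) by ring.
    apply norm_is_RInt_const with (3 := HM h x Hh0); auto.
    intros s Hs; apply HKb; lra. }
assert (Hzero : forall h, 0 < h -> Psi (M h y) = 0).
{ intros h Hh; assert (Hh0 : 0 <= h) by lra.
  apply (Hval (fun x => Psi (M h x))).
  { exact (is_linear_comp (M h) Psi (HMl h Hh) (proj1 hPsi)). }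
  (* Integrating [V] over the equation of [IVsum_gen] expresses [M h (B (IVn n t u))] through
     convergent terms; their limit is zero because the integrated orbit has generator value V(t)u -
     u. *)
  replace 0 with (Psi (((V h (V_int t u) [-] V_int t u)) [-] M h (V t u [-] u))).
  2: { unfold M; rewrite (is_RInt_unique (V := X) _ _ _ _ (gen_FTC V_substochastic Hh0 (V_int_gen u Ht0))).
    rewrite Psi_minus; ring. }
  apply (tends_linear (L := Psi : X -> R_state_space)); [exact Psi_lin|].
  tapply (@tends_ext _ _ _ X (fun n => (V h (IVsum (S n) t u) [-] IVsum (S n) t u) [-]
    M h (Sn (S n) t u [-] u))).
  - exists 0%nat; intros n _.
    destruct (IVsum_gen n u Ht0) as [H1 H2].
    assert (H3 := V_gen H1); rewrite H2 in H3.
    rewrite <- (is_RInt_unique (V := X) _ _ _ _ (gen_FTC V_substochastic Hh0 H3)).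
    fold (M h (Sn (S n) t u [-] u [+] B (IVn n t u))).
    rewrite <- HMm by auto; f_equal; vec.
  - assert (HI := tends_succ (IVsum_tends Ht0 Hu)).
    tapply tends_minus; [tapply tends_minus; auto|].
    + apply tends_linear; auto; now apply (sg_lin V_substochastic).
    + apply tends_linear; [now apply HMl|].
      tapply tends_minus; [|tapply tends_const].
      apply (tends_succ (f := fun n => Sn n t u)); now apply V_tends. }
(* The means of V(s)y over [0,h] tend to [y], hence Psi(y) = 0. *)
tapply (@tends_unique _ (at_right 0) _ R_state_space (fun h => Psi (/ h [*] M h y))).
- apply (tends_linear (L := Psi : X -> R_state_space)); [exact Psi_lin|].
  apply (sg_mean_tends V_substochastic).
- tapply (@tends_ext _ _ _ R_state_space (fun _ => 0)); [|tapply tends_const].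
  generalize at_right_pos; apply filter_imp; intros h Hh.
  rewrite Psi_scal, Hzero by auto; ring_R.
Qed.

End DysonPhillips.

Theorem theorem4p8
  (X : abstract_state_space)
  (Psi : X -> R) (hPsi : norm_functional Psi)
  (U : R -> X -> X) (A : operator X)
  (hU : substochastic U) (hA : is_generator U A)
  (B : X -> X)
  (hB_lin : linear_on (dom A) B)
  (hB_pos : positive_on (dom A) B)
  (hAB : forall u, dom A u -> cone u -> Psi (plus (A u) (B u)) <= 0)
  (V : R -> X -> X) (G : operator X)
  (hV : minimal_semigroup (perturbed A B) V G)
  (Vn : nat -> R -> X -> X)
  (hVn : dyson_phillips U A B Vn)
  (u : X) (hu : cone u) :
  let honest := mild_honest Psi A B Vn V u in
  let vanishing :=
    forall t, 0 < t ->
      is_lim_seq (fun n => norm (B (RInt (fun s => Vn n s u) 0 t))) 0 in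
  let in_closure :=
    forall t, 0 < t ->
      closure_dom (perturbed A B) (RInt (fun s => V s u) 0 t) in
  let weak_cpt :=
    forall t, 0 < t ->
      relatively_weakly_compact
        (fun x => exists n : nat, x = B (RInt (fun s => Vn n s u) 0 t)) in
  (honest <-> vanishing) /\
  (honest <-> in_closure) /\
  (honest <-> weak_cpt).
Proof.
intros honest vanishing in_closure weak_cpt.
assert (Hh : honest <-> forall t, 0 < t -> beta Psi A B Vn V t u = 0)
  by exact (mild_honest_beta hPsi hU hA hB_lin hB_pos hAB hVn hV hu).
split; [|split]; rewrite Hh; split; intros H t Ht.
- apply (vanishing_beta hPsi hU hA hB_lin hB_pos hAB hVn hV hu Ht); auto.
- apply (vanishing_beta hPsi hU hA hB_lin hB_pos hAB hVn hV hu Ht); auto.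
- apply (closure_of_beta hPsi hU hA hB_lin hB_pos hAB hVn hV Ht hu); auto.
- apply (beta_of_closure hPsi hU hA hB_lin hB_pos hAB hVn hV Ht hu), H, Ht.
- apply null_sequence_weakly_compact.
  apply (BIVn_norm_tends hPsi hU hA hB_lin hB_pos hAB hVn hV Ht hu); auto.
- destruct (weak_cluster_point (H t Ht)) as [y Hy].
  apply (cluster_beta hPsi hU hA hB_lin hB_pos hAB hVn hV Ht hu Hy).
Qed.
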